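(* Let $\phi:\Sigma\to\mathbb{H}^2\times\mathbb{R}$ be an isometric minimal immersion of a simply connected Riemann surface $\Sigma$ satisfying $\nu^2<1$, where $\nu=\langle N,\partial_t\rangle$, $N$ is a unit normal field to $\phi$ and $\partial_t$ is the unit vector field tangent to the factor $\mathbb{R}$. Then there exists a conformal maximal immersion $\psi:\Sigma\to\mathbf{H}^3_1$ such that $\phi=\hat\nu_\psi$ up to an ambient isometry of $\mathbb{H}^2\times\mathbb{R}$, where $\hat\nu_\psi:\Sigma\to\mathbb{H}^2\times\mathbb{R}$ is the modified Gauss map of $\psi$.
   Context: $\mathbb{H}^2\times\mathbb{R}$ carries the Riemannian product metric ($\mathbb{H}^2$ of curvature $-1$), and the conformal structure of $\Sigma$ is that of the metric induced by $\phi$. Let $\mathbb{R}^4_2$ be $\mathbb{R}^4$ with its standard orientation and the metric $\langle\!\langle u,v\rangle\!\rangle=u_1v_1+u_2v_2-u_3v_3-u_4v_4$. Anti-De Sitter space is $\mathbf{H}^3_1=\{p\in\mathbb{R}^4_2:\langle\!\langle p,p\rangle\!\rangle=-1\}$ with the induced Lorentzian metric. A maximal immersion into $\mathbf{H}^3_1$ is a spacelike immersion with vanishing mean curvature. For a conformal maximal immersion $\psi:\Sigma\to\mathbf{H}^3_1$ and a conformal parameter $z=x+iy$, let $N_\psi$ be the unit timelike normal field ($\langle\!\langle N_\psi,N_\psi\rangle\!\rangle=-1$, $N_\psi$ tangent to $\mathbf{H}^3_1$ and orthogonal to $\psi$) such that $\{\psi_x,\psi_y,\psi,N_\psi\}$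 is positively oriented in $\mathbb{R}^4_2$. Its Hopf differential is the holomorphic quadratic differential $\Theta_\psi=\langle\!\langle\psi_z,(N_\psi)_z\rangle\!\rangle\,dz\otimes dz$ (complex-bilinear extension). On $\Lambda^2\mathbb{R}^4_2$ consider the metric $g(v\wedge w,v'\wedge w')=\langle\!\langle v,w'\rangle\!\rangle\langle\!\langle w,v'\rangle\!\rangle-\langle\!\langle v,v'\rangle\!\rangle\langle\!\langle w,w'\rangle\!\rangle$ and the star operator defined by $\alpha\wedge(\star\beta)=g(\alpha,\beta)\Omega$, with $\Omega$ the orientation form. Its eigenspace $\Lambda^2_+\mathbb{R}^4_2$ for the eigenvalue $+1$ is isometric to Lorentz–Minkowski 3-space, and $\mathbb{H}^2_+\equiv\mathbb{H}^2$ denotes the hyperbolic plane in it (one sheet of $\{g(\alpha,\alpha)=-1\}$, of curvature $-1$; the two sheets are identified through $\alpha\mapsto-\alpha$). The first component of the Gauss map of $\psi$ is $\nu^+_\psi:\Sigma\to\mathbb{H}^2_+$, $$\nu^+_\psi(p)=\tfrac1{\sqrt2}\bigl[e_1\wedge e_2+N_\psi(p)\wedge\psi(p)\bigr],$$ where $\{e_1,e_2\}$ is an oriented orthonormal basis of $T_p\Sigma$ (regarded in $\mathbb{R}^4_2$ via $d\psi_p$). Modified Gauss map: suppose $\psi$ has Hopf differential $\Theta_\psi=\tfrac i2e^{it}\,dz\otimes dz$ for some $t\in\mathbb{R}$ and some conformal parameter $z$ on $\Sigma$ (a holomorphic function $z:\Sigma\to\mathbb{C}$ with nowhere vanishing differential).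 The modified Gauss map pairs $\nu_\psi^+$ with the second Gauss map component of the hyperbolic cylinder having the same Hopf differential; that second component takes values in a geodesic of $\mathbb{H}^2$, identified with $\mathbb{R}$, and explicitly $$\hat\nu_\psi=\bigl(\nu^+_\psi,\,2\,\mathrm{Im}(ze^{it/2})\bigr):\Sigma\to\mathbb{H}^2\times\mathbb{R}.$$ *)

(* Defs.v *)
From HB Require Import structures.
From mathcomp Require Import all_boot all_order all_algebra.
From mathcomp Require Import all_classical all_reals all_analysis.
From mathcomp Require Export complex.
From mathcomp Require Import ring lra.

Set Implicit Arguments.
Unset Strict Implicit.
Unset Printing Implicit Defensive.

Import Order.TTheory GRing.Theory Num.Theory.
Import numFieldNormedType.Exports.

Local Open Scope classical_set_scope.
Local Open Scope ring_scope.
Local Open Scope complex_scope.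

Section Smooth.
Context {R : realType} {V W : normedModType R}.

(* Meant for open U: f is k times continuously differentiable on U. *)
Fixpoint Ck (k : nat) (U : set V) (f : V -> W) : Prop :=
  match k with
  | 0 => {in U, continuous f}
  | k'.+1 => (forall x, U x -> differentiable f x) /\
             (forall v : V, Ck k' U (fun x => 'D_v f x))
  end.

Definition smooth_on (U : set V) (f : V -> W) : Prop := forall k, Ck k U f.

End Smooth.

Section Surfaces.
Context {R : realType}.

(* The complex line R[i]^o carries the topology of R[i], and derivability over
   it is complex differentiability. *)
Notation C := (R[i]^o).

Record chart (T : Type) := Chart {
  cdom : set T;
  cmap : T -> C;
  cinv : C -> T }.

Definition crange (T : Type) (c : chart T) : set C := cmap c @` cdom c.

Record chart_axioms (T : topologicalType) (c : chart T) : Prop := ChartAxioms {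
  cdom_open : open (cdom c);
  crange_open : open (crange c);
  cmapK : {in cdom c, cancel (cmap c) (cinv c)};
  cmap_continuous : {in cdom c, continuous (cmap c)};
  cinv_continuous : {in crange c, continuous (cinv c)} }.

Record riemann_surface (T : topologicalType) (A : set (chart T)) : Prop :=
  RiemannSurface {
    rs_connected : connected [set: T];
    rs_hausdorff : hausdorff_space T;
    rs_chart : forall c, A c -> chart_axioms c;
    rs_cover : forall p, exists2 c, A c & cdom c p;
    rs_holomorphic : forall c1 c2, A c1 -> A c2 ->
      forall p, cdom c1 p -> cdom c2 p ->
      derivable (cmap c2 \o cinv c1 : C -> C) (cmap c1 p) 1 }.

Definition simply_connected (T : topologicalType) : Prop :=
  (forall x y : T, exists gamma : R -> T,
     [/\ {within `[0, 1], continuous gamma}, gamma 0 = x & gamma 1 = y]) /\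
  (forall gamma : R -> T,
     {within `[0, 1], continuous gamma} -> gamma 0 = gamma 1 ->
     exists H : R * R -> T,
       [/\ {within `[0, 1] `*` `[0, 1], continuous H},
           {in `[0, 1], forall s, H (s, 0) = gamma s},
           {in `[0, 1], forall s, H (s, 1) = gamma 0} &
           {in `[0, 1], forall t, H (0, t) = gamma 0 /\ H (1, t) = gamma 0}]).

Section Local.
Context {T : Type} {V : normedModType R}.
Implicit Types (c : chart T) (f : T -> V) (p : T).

(* f read in the real coordinates (x, y) of the chart with parameter x + iy. *)
Definition loc c f : (R^o * R^o)%type -> V := fun q => f (cinv c (q.1 +i* q.2)).

Definition pt c p : (R^o * R^o)%type := (complex.Re (cmap c p), complex.Im (cmap c p)).

Definition dx c f p : V := 'D_(1, 0) (loc c f) (pt c p).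
Definition dy c f p : V := 'D_(0, 1) (loc c f) (pt c p).
Definition dxx c f p : V := 'D_(1, 0) (fun q => 'D_(1, 0) (loc c f) q) (pt c p).
Definition dxy c f p : V := 'D_(1, 0) (fun q => 'D_(0, 1) (loc c f) q) (pt c p).
Definition dyy c f p : V := 'D_(0, 1) (fun q => 'D_(0, 1) (loc c f) q) (pt c p).

Definition smooth (A : set (chart T)) f : Prop :=
  forall c, A c -> smooth_on [set q | crange c (q.1 +i* q.2)] (loc c f).

End Local.

(* Immersed surfaces in a submanifold M of a vector space V, where M carries the
   metric induced by the constant symmetric bilinear form B and TM x is the
   tangent space of M at x. *)
Section Immersions.
Context {T : Type} {V : normedModType R}.
Variables (A : set (chart T)) (M : set V) (TM : V -> set V) (B : V -> V -> R).

(* f^* B = lambda |dw|^2 with lambda > 0 in every chart w; in particular df is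
   injective and f^* B is positive definite. *)
Definition conformal_immersion (f : T -> V) : Prop :=
  [/\ smooth A f, forall p, M (f p) &
      forall c p, A c -> cdom c p ->
        [/\ B (dx c f p) (dx c f p) = B (dy c f p) (dy c f p),
            B (dx c f p) (dy c f p) = 0 & 0 < B (dx c f p) (dx c f p)]].

(* n is normal to the surface within M, and of square eps = 1 or -1. *)
Definition unit_normal_at (eps : R) (f : T -> V) (p : T) (n : V) : Prop :=
  [/\ TM (f p) n, B n n = eps &
      forall c, A c -> cdom c p -> B (dx c f p) n = 0 /\ B (dy c f p) n = 0].

Definition unit_normal_field (eps : R) (f N : T -> V) : Prop :=
  smooth A N /\ forall p, unit_normal_at eps f p (N p).

(* Half the trace, with respect to f^* B, of the second fundamental form
   II(X, Y) = B(nabla_X Y, n).  The connection nabla of M is the tangential part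
   of the flat connection of V and n is tangent to M, so that the coefficients
   of II in a chart are B(f_xx, n), B(f_xy, n), B(f_yy, n). *)
Definition mean_curvature (c : chart T) (f : T -> V) (n : V) (p : T) : R :=
  let E := B (dx c f p) (dx c f p) in
  let F := B (dx c f p) (dy c f p) in
  let G := B (dy c f p) (dy c f p) in
  (B (dxx c f p) n * G - 2 * B (dxy c f p) n * F + B (dyy c f p) n * E)
  / (2 * (E * G - F ^+ 2)).

Definition zero_mean_curvature (eps : R) (f : T -> V) : Prop :=
  forall c p n, A c -> cdom c p -> unit_normal_at eps f p n ->
    mean_curvature c f n p = 0.

End Immersions.

(* u_1 v_1 + u_2 v_2 - u_3 v_3 - ... - u_n v_n *)
Definition pform {K : pzRingType} {n} (u v : 'rV[K]_n) : K :=
  \sum_(i < n) (if (i < 2)%N then 1 else -1) * u 0 i * v 0 i.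

(* The hyperboloid model of the hyperbolic plane, and H^2 x R. *)
Definition H2 : set 'rV[R]_3 := [set x | pform x x = -1 /\ 0 < x 0 2].

Notation L3R := ('rV[R]_3 * R^o)%type.

Definition H2R : set L3R := [set x | H2 x.1].
Definition TH2R (x : L3R) : set L3R := [set v | pform x.1 v.1 = 0].
Definition gH2R (v w : L3R) : R := pform v.1 w.1 + v.2 * w.2.
Definition dt : L3R := (0, 1).

(* Phi is a bijection of H^2 x R which is smooth, i.e. smoothly extended to a
   neighbourhood in the ambient space, and preserves the Riemannian metric; only
   the values of Phi on H^2 x R are relevant. *)
Definition isometry_H2R (Phi : L3R -> L3R) : Prop :=
  set_bij H2R H2R Phi /\
  exists U : set L3R,
    [/\ open U, H2R `<=` U, smooth_on U Phi &
        forall x v w, H2R x -> TH2R x v -> TH2R x w ->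
          gH2R ('D_v Phi x) ('D_w Phi x) = gH2R v w].

Definition H31 : set 'rV[R]_4 := [set p | pform p p = -1].
Definition TH31 (p : 'rV[R]_4) : set 'rV[R]_4 := [set v | pform p v = 0].

Definition det4 (u v w x : 'rV[R]_4) : R :=
  \det (\matrix_(i < 4) nth 0 [:: u; v; w; x] i).

(* Bivectors of R^4_2 as skew-symmetric matrices. *)
Definition wedge (v w : 'rV[R]_4) : 'M[R]_4 := v^T *m w - w^T *m v.

Definition eta : 'M[R]_4 := diag_mx (\row_i (if (i < 2)%N then 1 else -1)).

(* The bilinear form with values on decomposable bivectors as in gLambda_wedge. *)
Definition gLambda (a b : 'M[R]_4) : R := 2^-1 * \tr (a *m eta *m b *m eta).

(* a /\ b = wedge4 a b Omega, with Omega the standard orientation form; see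
   wedge4_wedge. *)
Definition wedge4 (a b : 'M[R]_4) : R :=
  a 0 1 * b 2 3 - a 0 2 * b 1 3 + a 0 3 * b 1 2
  + a 1 2 * b 0 3 - a 1 3 * b 0 2 + a 2 3 * b 0 1.

(* sb is the star of b: a /\ sb = g(a, b) Omega for all bivectors a. *)
Definition is_star (b sb : 'M[R]_4) : Prop :=
  sb^T = - sb /\ forall a : 'M[R]_4, a^T = - a -> wedge4 a sb = gLambda a b.

Definition Lambda_plus : set 'M[R]_4 := [set b | is_star b b].

Definition std (i : 'I_4) : 'rV[R]_4 := delta_mx 0 i.

(* An orthonormal basis of Lambda_plus, the third vector being timelike. *)
Definition basis_plus (k : 'I_3) : 'M[R]_4 :=
  (Num.sqrt 2)^-1 *:
  nth 0 [:: wedge (std 0) (std 2) + wedge (std 3) (std 1);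
            wedge (std 0) (std 3) + wedge (std 1) (std 2);
            wedge (std 0) (std 1) + wedge (std 3) (std 2)] k.

(* The linear isometry of Lambda_plus with Minkowski 3-space given by the basis
   above, see pform_coord_plus. *)
Definition coord_plus (a : 'M[R]_4) : 'rV[R]_3 :=
  \row_k ((if (k < 2)%N then 1 else -1) * gLambda a (basis_plus k)).

(* The two sheets of {g(a, a) = -1} in Lambda_plus are identified by a |-> -a. *)
Definition to_H2 (a : 'M[R]_4) : 'rV[R]_3 :=
  if 0 < coord_plus a 0 2 then coord_plus a else - coord_plus a.

Section AntiDeSitter.
Context {T : Type}.
Variables (A : set (chart T)).

Definition oriented_normal_field (psi N : T -> 'rV[R]_4) : Prop :=
  unit_normal_field A TH31 pform (-1) psi N /\
  forall c p, A c -> cdom c p -> 0 < det4 (dx c psi p) (dy c psi p) (psi p) (N p).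

Definition complexify {n} (v : 'rV[R]_n) : 'rV[R[i]]_n := map_mx (real_complex R) v.

(* The Wirtinger derivative f_w = (f_x - i f_y) / 2 in the chart w = x + iy. *)
Definition wirtinger {n} (c : chart T) (f : T -> 'rV[R]_n) (p : T) : 'rV[R[i]]_n :=
  2^-1 *: (complexify (dx c f p) - 'i *: complexify (dy c f p)).

(* The coefficient of dw (x) dw in the Hopf differential, in the chart w. *)
Definition hopf_coef (c : chart T) (psi N : T -> 'rV[R]_4) (p : T) : R[i] :=
  pform (wirtinger c psi p) (wirtinger c N p).

Definition cis (t : R) : R[i] := cos t +i* sin t.

(* dz/dw in the chart w *)
Definition dz (c : chart T) (z : T -> R[i]) (p : T) : R[i] :=
  'D_1 (z \o cinv c : C -> C) (cmap c p).

(* A holomorphic function with nowhere vanishing differential. *)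
Definition conformal_parameter (z : T -> R[i]) : Prop :=
  forall c p, A c -> cdom c p ->
    derivable (z \o cinv c : C -> C) (cmap c p) 1 /\ dz c z p != 0.

(* Theta_psi = (i/2) e^(it) dz (x) dz *)
Definition hopf_normalized (psi N : T -> 'rV[R]_4) (t : R) (z : T -> R[i]) : Prop :=
  conformal_parameter z /\
  forall c p, A c -> cdom c p ->
    hopf_coef c psi N p = 'i / 2 * cis t * dz c z p ^+ 2.

Definition oriented_onb (c : chart T) (psi : T -> 'rV[R]_4) (p : T)
    (e1 e2 : 'rV[R]_4) : Prop :=
  [/\ pform e1 e1 = 1, pform e1 e2 = 0, pform e2 e2 = 1 &
      exists a11 a12 a21 a22 : R,
        [/\ e1 = a11 *: dx c psi p + a12 *: dy c psi p,
            e2 = a21 *: dx c psi p + a22 *: dy c psi p &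
            0 < a11 * a22 - a12 * a21]].

(* nu = nu^+_psi, as a map into the bivectors *)
Definition gauss_map_plus (psi N : T -> 'rV[R]_4) (nu : T -> 'M[R]_4) : Prop :=
  forall c p e1 e2, A c -> cdom c p -> oriented_onb c psi p e1 e2 ->
    nu p = (Num.sqrt 2)^-1 *: (wedge e1 e2 + wedge (N p) (psi p)).

(* The Hopf differential of psi is normalized by some t and z, and nuhat is the
   modified Gauss map of psi for these t and z. *)
Definition modified_gauss_map (psi : T -> 'rV[R]_4) (nuhat : T -> L3R) : Prop :=
  exists N nu t z,
    [/\ oriented_normal_field psi N, gauss_map_plus psi N nu,
        hopf_normalized psi N t z &
        forall p, nuhat p = (to_H2 (nu p), 2 * complex.Im (z p * cis (t / 2)))].

End AntiDeSitter.

Lemma etaE (u v : 'rV[R]_4) : u *m eta *m v^T = (pform u v)%:M.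
Proof.
apply/rowP => j; rewrite !mxE (ord1 j) eqxx mulr1n /pform.
apply: eq_bigr => i _; rewrite mul_mx_diag !mxE; congr (_ * _).
by rewrite mulrC.
Qed.

Lemma gLambda_wedge (v w v' w' : 'rV[R]_4) :
  gLambda (wedge v w) (wedge v' w') =
  pform v w' * pform w v' - pform v v' * pform w w'.
Proof.
have tr4 (a b c d : 'rV[R]_4) :
    \tr (a^T *m b *m eta *m (c^T *m d) *m eta) = pform b c * pform d a.
  rewrite -!mulmxA mxtrace_mulC !mulmxA etaE -!mulmxA (mulmxA d) etaE.
  by rewrite -scalar_mxM mxtrace_scalar mulr1n.
have pformC (a b : 'rV[R]_4) : pform a b = pform b a.
  by apply: eq_bigr => i _; rewrite -!mulrA; congr (_ * _); rewrite mulrC.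
rewrite /gLambda /wedge !(mulmxBl, mulmxBr) !raddfB /= !tr4.
rewrite (pformC v' w) (pformC v' v) (pformC w' w) (pformC w' v).
by field.
Qed.

Lemma sum4 (K : nmodType) (F : 'I_4 -> K) :
  \sum_i F i = F 0 + (F 1 + (F 2 + F 3)).
Proof.
rewrite !big_ord_recl big_ord0 addr0; congr (F _ + (F _ + (F _ + F _))).
all: exact: val_inj.
Qed.

Lemma sum3 (K : nmodType) (F : 'I_3 -> K) : \sum_i F i = F 0 + (F 1 + F 2).
Proof.
rewrite !big_ord_recl big_ord0 addr0; congr (F _ + (F _ + F _)).
all: exact: val_inj.
Qed.

Lemma gLambdaE (a b : 'M[R]_4) : gLambda a b = 2^-1 *
  \sum_(i < 4) \sum_(j < 4) (if (i < 2)%N then 1 else -1) * (if (j < 2)%N then 1 else -1)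
     * a i j * b j i.
Proof.
rewrite /gLambda /mxtrace; congr (_ * _); apply: eq_bigr => i _.
rewrite mul_mx_diag !mxE mulr_suml; apply: eq_bigr => j _.
rewrite mul_mx_diag !mxE; ring.
Qed.

Lemma det4E (M : 'M[R]_4) : \det M =
  let m3 i j k := M 1 i * (M 2 j * M 3 k - M 2 k * M 3 j)
                - M 1 j * (M 2 i * M 3 k - M 2 k * M 3 i)
                + M 1 k * (M 2 i * M 3 j - M 2 j * M 3 i) in
  M 0 0 * m3 1 2 3 - M 0 1 * m3 0 2 3 + M 0 2 * m3 0 1 3 - M 0 3 * m3 0 1 2.
Proof.
rewrite (expand_det_row _ 0) sum4 /cofactor.
rewrite !(expand_det_row _ (0 : 'I_3)) !sum3 /cofactor.
rewrite !(expand_det_row _ (0 : 'I_2)) !big_ord_recl !big_ord0 /cofactor.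
rewrite !det_mx11 !mxE /=.
pose m (a b : nat) := M (inord a) (inord b).
have Mm i j : M i j = m i j by rewrite /m !inord_val.
rewrite !Mm; move: m {Mm} => m.
rewrite /= !modn_small //= /bump /= !add0n ?expr0 ?expr1.
ring.
Qed.

Lemma pform4E (u v : 'rV[R]_4) :
  pform u v = u 0 0 * v 0 0 + u 0 1 * v 0 1 - u 0 2 * v 0 2 - u 0 3 * v 0 3.
Proof. rewrite /pform sum4 /=; ring. Qed.

Lemma pform3E (u v : 'rV[R]_3) :
  pform u v = u 0 0 * v 0 0 + u 0 1 * v 0 1 - u 0 2 * v 0 2.
Proof. rewrite /pform sum3 /=; ring. Qed.

Lemma wedge4_wedge (u v w x : 'rV[R]_4) :
  wedge4 (wedge u v) (wedge w x) = det4 u v w x.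
Proof.
rewrite /det4 det4E /= !mxE /= /wedge4 /wedge !mxE !big_ord1 !mxE; ring.
Qed.

Lemma wedgeE (v w : 'rV[R]_4) i j : wedge v w i j = v 0 i * w 0 j - w 0 i * v 0 j.
Proof. by rewrite !mxE !big_ord1 !mxE. Qed.

Lemma gLambda_skewE (a b : 'M[R]_4) : a^T = - a -> b^T = - b ->
  gLambda a b = - a 0 1 * b 0 1 + a 0 2 * b 0 2 + a 0 3 * b 0 3
    + a 1 2 * b 1 2 + a 1 3 * b 1 3 - a 2 3 * b 2 3.
Proof.
move=> sa sb.
have ea i j : a i j = - a j i.
  by move/matrixP: sa => /(_ j i); rewrite !mxE.
have eb i j : b i j = - b j i.
  by move/matrixP: sb => /(_ j i); rewrite !mxE.
have da i : a i i = 0 by have := ea i i; lra.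
rewrite gLambdaE !sum4 !da /=.
rewrite (ea 1 0) (ea 2 0) (ea 3 0) (ea 2 1) (ea 3 1) (ea 3 2).
rewrite (eb 1 0) (eb 2 0) (eb 3 0) (eb 2 1) (eb 3 1) (eb 3 2).
by field; rewrite ?pnatr_eq0 ?s0.
Qed.

Lemma wedge_skew (v w : 'rV[R]_4) : (wedge v w)^T = - wedge v w.
Proof. by rewrite /wedge linearB /= !trmx_mul !trmxK opprB. Qed.

Lemma Lambda_plusP (b : 'M[R]_4) : Lambda_plus b <->
  [/\ b^T = - b, b 0 1 = - b 2 3, b 0 2 = - b 1 3 & b 0 3 = b 1 2].
Proof.
split=> [[sb hb]|[sb h1 h2 h3]]; last first.
  by split=> // a sa; rewrite gLambda_skewE // /wedge4 h1 h2 h3; ring.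
have key i j := hb _ (wedge_skew (std i) (std j)).
have {key} key i j := etrans (key i j) (gLambda_skewE (wedge_skew _ _) sb).
move: (key 0 1) (key 0 2) (key 0 3).
rewrite /wedge4 !wedgeE !mxE /= => k1 k2 k3.
split=> //; lra.
Qed.

Lemma basis_plus_skew k : (basis_plus k)^T = - basis_plus k.
Proof.
by case: k => [[|[|[]]] // ?]; rewrite /basis_plus /= linearZ /= linearD /=
  !wedge_skew -opprD scalerN.
Qed.

Lemma basis_plus_Lambda_plus k : Lambda_plus (basis_plus k).
Proof.
apply/Lambda_plusP; split; first exact: basis_plus_skew.
all: case: k => [[|[|[]]] // ?]; rewrite /basis_plus /= !(mxE, big_ord1) /=; ring.
Qed.

Lemma pform_coord_plus (a b : 'M[R]_4) : Lambda_plus a -> Lambda_plus b ->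
  pform (coord_plus a) (coord_plus b) = gLambda a b.
Proof.
move=> /Lambda_plusP[sa a1 a2 a3] /Lambda_plusP[sb b1 b2 b3].
have s2 : (Num.sqrt 2 : R) ^+ 2 = 2 by rewrite sqr_sqrtr.
have s0 : (Num.sqrt 2 : R) != 0 by rewrite sqrtr_eq0 -ltNge.
rewrite pform3E !mxE /= !gLambda_skewE //; do ?exact: basis_plus_skew.
rewrite /basis_plus /= !(mxE, big_ord1) /= a1 a2 a3 b1 b2 b3.
have q2 : (Num.sqrt 2 : R)^-1 ^+ 2 * 2 = 1 by rewrite exprVn s2 mulVf.
move: (Num.sqrt 2)^-1 q2 => q q2.
transitivity ((q ^+ 2 * 2) * 2 * (a 1 3 * b 1 3 + a 1 2 * b 1 2 - a 2 3 * b 2 3)).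
  by ring.
by rewrite q2; ring.
Qed.

End Surfaces.

Arguments chart R T : clear implicits.
Arguments simply_connected R T : clear implicits.

(* Main.v *)
(* Write phi = (X, h) and N = (n, nu), set C = n x X (Lorentzian cross product), and
   replace N by -N if needed so that <X_x, C> = - h_y and <X_y, C> = h_x in every chart.
   Identify Minkowski 3-space with the self-dual bivectors and let J(a) be the skew
   endomorphism of R^4_2 given by a. The form
     alpha = ((h_x C - h_y n) dx + (h_y C + h_x n) dy) / (2 (1 - nu))
   does not depend on the chart; the structure equations of phi give div alpha = 0 and
   make the connection d - J(alpha) flat. As Sigma is simply connected, the equation
   d psi = psi J(alpha) has a global solution with <psi, psi> = -1. Since alpha is
   conformal and orthogonal to X, psi is conformal with normal psi J(X) and Gauss map X;
   its Laplacian is a multiple of psi because div alpha = 0, so psi is maximal. Its Hopf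
   differential is (i/2) dz^2, where z is the holomorphic function with imaginary part
   h / 2 (h is harmonic), so that the modified Gauss map for t = 0 is (X, h) = phi. *)

Require Import Defs.
From HB Require Import structures.
From mathcomp Require Import all_boot all_order all_algebra.
From mathcomp Require Import all_classical all_reals all_analysis.
From mathcomp Require Import ring lra.

Set Implicit Arguments.
Unset Strict Implicit.
Unset Printing Implicit Defensive.

Import Order.TTheory GRing.Theory Num.Theory.
Import numFieldNormedType.Exports.

Local Open Scope classical_set_scope.
Local Open Scope ring_scope.
Local Open Scope complex_scope.

(** * Differentiability and smoothness *)

(** For [pform psi psi = -1] the map a |-> psi J(a) is an isometry of Minkowski space onto the
    tangent space of anti-de Sitter space at psi, so writing d psi = psi J(alpha) is no restriction:
    alpha is the true unknown. Conformality and the Gauss map X force alpha = a1 dx + (X x a1) dy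
    with a1 orthogonal to X, so a1 = p C + q n. The Hopf differential is then linear in (p, q), and
    prescribing it is a 2 by 2 system of determinant (1 - nu)^2 (h_x^2 + h_y^2) up to sign; its
    solution is the alpha above, and only integrability remains to be checked. The hypothesis nu^2 <
    1 enters twice: it makes 1 - nu invertible, and it makes (X, n, C) an orthogonal frame, of
    squares -1, 1 - nu^2, 1 - nu^2, in which the structure equations are solved. The surface comes
    with an atlas and null-homotopies of loops, but with no global coordinate, so solutions found on
    small squares are continued as horizontal sections of a flat bundle. The same continuation
    theorem, with nilpotent coefficients, provides the harmonic conjugate of h. *)

Section EpsDiff.
Context {K : numFieldType} {V W : normedModType K}.

Lemma is_diff_eps (f : V -> W) (L : {linear V -> W}) x : continuous L ->
  (forall e, 0 < e -> \forall h \near (0 : V), `|f (h + x) - f x - L h| <= e * `|h|) ->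
  is_diff x f L.
Proof.
move=> cL H.
have E : f \o shift x = cst (f x) + L +o_ 0 id.
  apply/eqaddoP => e e0; have := H e e0; apply: filterS => h.
  by rewrite !fctE /= opprD addrA.
have D := diff_unique cL E.
by apply: DiffDef => //; apply/diff_locallyP; rewrite D.
Qed.

Lemma differentiable_eps (f : V -> W) x : differentiable f x ->
  forall e, 0 < e -> \forall h \near (0 : V), `|f (h + x) - f x - 'd f x h| <= e * `|h|.
Proof.
move=> /diff_locallyP[_ /eqaddoP H] e e0; have := H e e0; apply: filterS => h.
by rewrite !fctE /= opprD addrA.
Qed.

Lemma near_eq_is_diff (f g : V -> W) x :
  (\forall y \near x, f y = g y) -> differentiable f x ->
  is_diff x g ('d f x).
Proof.
move=> fg df; apply: is_diff_eps; first exact: diff_continuous.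
move=> e e0; have fg0 : \forall h \near (0 : V), f (h + x) = g (h + x).
  move: fg; rewrite (near_shift 0) /=; by apply: filterS => h; rewrite subr0.
have := differentiable_eps df e0; have fx := nbhs_singleton fg.
by move: fg0; apply: filterS2 => h <-; rewrite fx.
Qed.

Lemma derive_linear (U : normedModType K) (L : {linear W -> U}) (f : V -> W) x v :
  continuous L -> differentiable f x ->
  differentiable (L \o f) x /\ 'D_v (L \o f) x = L ('D_v f x).
Proof.
move=> cL df; have dL : differentiable L (f x) by exact: linear_differentiable.
have dLf : differentiable (L \o f) x by exact: differentiable_comp.
by split=> //; rewrite !deriveE // diff_comp //= diff_lin.
Qed.
End EpsDiff.

Lemma open_near (T : topologicalType) (U : set T) x : open U -> U x -> \forall y \near x, U y.
Proof. by move=> oU Ux; apply: open_nbhs_nbhs; split. Qed.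

Section CkTheory.
Context {R : realType} {V : normedModType R}.
Implicit Types (U : set V).

(** Openness of [U] is essential: a directional derivative at a point of [U] depends on the germ of
    the function there, and f and g agree on that germ. *)
Lemma Ck_ext (W : normedModType R) k U (f g : V -> W) :
  open U -> {in U, f =1 g} -> Ck k U f -> Ck k U g.
Proof.
move=> oU; elim: k f g => [|k IH] f g fg.
  move=> cf x xU; have Ux := set_mem xU; rewrite /continuous_at -fg //.
  apply: cvg_trans (cf x xU); apply: near_eq_cvg.
  by apply: filterS (open_near oU Ux) => y /mem_set /fg.
move=> [df cf]; split=> [x Ux|v].
  have fgx : \forall y \near x, f y = g y.
    by apply: filterS (open_near oU Ux) => y /mem_set /fg.
  by have [] := near_eq_is_diff fgx (df x Ux).
apply: IH (cf v) => x /set_mem Ux; apply: near_eq_derive.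
by apply: filterS (open_near oU Ux) => y /mem_set /fg.
Qed.

Lemma CkW (W : normedModType R) k U (f : V -> W) : Ck k.+1 U f -> Ck k U f.
Proof.
elim: k f => [|k IH] f [df cf]; last by split=> // v; apply: IH.
by move=> x /set_mem Ux; exact/differentiable_continuous/df.
Qed.

Lemma Ck_linear (W W' : normedModType R) (L : {linear W -> W'}) k U (f : V -> W) :
  continuous L -> open U -> Ck k U f -> Ck k U (L \o f).
Proof.
move=> cL oU; elim: k f => [|k IH] f.
  by move=> cf x xU; apply: continuous_comp; [exact: cf|exact: cL].
move=> [df cf]; split=> [x Ux|v].
  by have [] := derive_linear 0 cL (df x Ux).
apply: Ck_ext (IH _ (cf v)) => // x /set_mem Ux /=.
by have [_ ->] := derive_linear v cL (df x Ux).
Qed.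

Lemma Ck_cst (W : normedModType R) k U (w : W) : Ck k U (cst w).
Proof.
elim: k w => [|k IH] w; first by move=> x _; exact: cst_continuous.
split=> [x _|v]; first exact: differentiable_cst.
rewrite (_ : (fun x => _) = cst 0); first exact: IH.
by apply/funext => x; rewrite derive_cst.
Qed.

Lemma CkD (W : normedModType R) k U (f g : V -> W) : open U ->
  Ck k U f -> Ck k U g -> Ck k U (f \+ g).
Proof.
move=> oU; elim: k f g => [|k IH] f g.
  by move=> cf cg x xU; apply: continuousD; [exact: cf|exact: cg].
move=> [df cf] [dg cg]; split=> [x Ux|v].
  by apply: differentiableD; [exact: df|exact: dg].
apply: Ck_ext (IH _ _ (cf v) (cg v)) => // x /set_mem Ux /=.
by rewrite deriveD //; apply: diff_derivable; [exact: df|exact: dg].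
Qed.

Lemma CkM k U (f g : V -> R^o) : open U ->
  Ck k U f -> Ck k U g -> Ck k U (f \* g : V -> R^o).
Proof.
move=> oU; elim: k f g => [|k IH] f g.
  by move=> cf cg x xU; apply: continuousM; [exact: cf|exact: cg].
move=> /[dup] /CkW Cf [df cf] /[dup] /CkW Cg [dg cg]; split=> [x Ux|v].
  by apply: differentiableM; [exact: df|exact: dg].
have H := CkD oU (IH _ _ Cf (cg v)) (IH _ _ Cg (cf v)).
apply: Ck_ext H => // x /set_mem Ux /=.
by rewrite deriveM //; apply: diff_derivable; [exact: df|exact: dg].
Qed.

Lemma CkV k U (f : V -> R^o) : open U -> (forall x, U x -> f x != 0) ->
  Ck k U f -> Ck k U (fun x => (f x)^-1 : R^o).
Proof.
move=> oU f0; elim: k f f0 => [|k IH] f f0.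
  by move=> cf x xU; apply: continuousV; [exact/f0/set_mem|exact: cf].
move=> /[dup] /CkW Cf [df cf]; split=> [x Ux|v].
  by apply: differentiableV; [exact: df|exact: f0].
have iC := IH _ f0 Cf.
have H := CkM oU (Ck_cst k U (-1 : R^o)) (CkM oU (CkM oU iC iC) (cf v)).
apply: Ck_ext H => // x /set_mem Ux /=.
rewrite deriveV; [|exact: f0|exact/diff_derivable/df].
by rewrite /cst /GRing.scale /= mulN1r mulNr expr2 invfM.
Qed.

Lemma Ck_sum (W : normedModType R) k n U (f : 'I_n -> V -> W) : open U ->
  (forall i, Ck k U (f i)) -> Ck k U (fun x => \sum_i f i x).
Proof.
move=> oU; elim: n f => [|n IH] f cf.
  by apply: (Ck_ext oU _ (Ck_cst k U (0 : W))) => x _; rewrite big_ord0.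
apply: (Ck_ext oU _ (CkD oU (cf ord0) (IH (fun i => f (lift ord0 i)) _))) => //.
by move=> x _; rewrite big_ord_recl.
Qed.

End CkTheory.

Section SmoothTheory.
Context {R : realType} {V : normedModType R}.
Variable (U : set V) (oU : open U).

Lemma smooth_ext (W : normedModType R) (f g : V -> W) :
  {in U, f =1 g} -> smooth_on U f -> smooth_on U g.
Proof. by move=> fg sf k; apply: Ck_ext (sf k). Qed.

Lemma smooth_differentiable (W : normedModType R) (f : V -> W) x :
  smooth_on U f -> U x -> differentiable f x.
Proof. by move=> /(_ 1)[df _]; exact: df. Qed.

Lemma smooth_derive (W : normedModType R) (f : V -> W) v :
  smooth_on U f -> smooth_on U ('D_v f).
Proof. by move=> sf k; have [_ H] := sf k.+1; exact: H. Qed.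

Lemma smooth_linear (W W' : normedModType R) (L : {linear W -> W'}) (f : V -> W) :
  continuous L -> smooth_on U f -> smooth_on U (L \o f).
Proof. by move=> cL sf k; exact: Ck_linear. Qed.

Lemma smooth_cst (W : normedModType R) (w : W) : smooth_on U (cst w).
Proof. by move=> k; exact: Ck_cst. Qed.

Lemma smoothD (W : normedModType R) (f g : V -> W) :
  smooth_on U f -> smooth_on U g -> smooth_on U (fun x => f x + g x).
Proof. by move=> sf sg k; exact: CkD. Qed.

Lemma smoothM (f g : V -> R^o) :
  smooth_on U f -> smooth_on U g -> smooth_on U (fun x => f x * g x : R^o).
Proof. by move=> sf sg k; exact: CkM. Qed.

Lemma smoothV (f : V -> R^o) : (forall x, U x -> f x != 0) ->
  smooth_on U f -> smooth_on U (fun x => (f x)^-1 : R^o).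
Proof. by move=> f0 sf k; exact: CkV. Qed.

Lemma smoothN (f : V -> R^o) : smooth_on U f -> smooth_on U (fun x => - f x : R^o).
Proof.
move=> sf; have := smoothM (smooth_cst (-1 : R^o)) sf.
by apply: smooth_ext => x _; rewrite /= mulN1r.
Qed.

Lemma smoothB (f g : V -> R^o) :
  smooth_on U f -> smooth_on U g -> smooth_on U (fun x => f x - g x : R^o).
Proof. by move=> sf sg; apply: smoothD => //; exact: smoothN. Qed.

Lemma smooth_sum (W : normedModType R) n (f : 'I_n -> V -> W) :
  (forall i, smooth_on U (f i)) -> smooth_on U (fun x => \sum_i f i x).
Proof. by move=> sf k; apply: Ck_sum => // i; exact: sf. Qed.

End SmoothTheory.

(** * Linear differential equations *)

Section MatrixNorm.
Context {R : realType}.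

Lemma mx_norm_entry m n (M : 'M[R]_(m, n)) i j : `|M i j| <= `|M|.
Proof.
rewrite [leRHS]/Num.Def.normr /= mx_normrE.
exact: (le_bigmax _ (fun ij : 'I_m * 'I_n => `|M ij.1 ij.2|) (i, j)).
Qed.

Lemma mx_norm_le m n (M : 'M[R]_(m, n)) K : 0 <= K ->
  (forall i j, `|M i j| <= K) -> `|M| <= K.
Proof.
move=> K0 H; rewrite /Num.Def.normr /= mx_normrE.
by apply: bigmax_le => // -[i j] _; exact: H.
Qed.

Lemma mx_norm_mul m n p (A : 'M[R]_(m, n)) (B : 'M[R]_(n, p)) :
  `|A *m B| <= n%:R * (`|A| * `|B|).
Proof.
apply: mx_norm_le => [|i j]; first by rewrite !mulr_ge0.
rewrite !mxE (le_trans (ler_norm_sum _ _ _)) //.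
rewrite -[X in X%:R * _]card_ord -sum1_card natr_sum mulr_suml ler_sum // => k _.
by rewrite mul1r normrM ler_pM // mx_norm_entry.
Qed.

Lemma is_derive_mx (V : normedModType R) m n (M : V -> 'M[R]_(m, n)) t v dM :
  is_derive t v M dM <-> forall i j, is_derive t v (fun x => M x i j) (dM i j).
Proof.
split=> [[D <-] i j|H].
  apply: DeriveDef; first by move/derivable_mxP: D; exact.
  by rewrite derive_mx // mxE.
have D : derivable M t v by apply/derivable_mxP => i j; have [] := H i j.
by apply: DeriveDef => //; rewrite derive_mx //; apply/matrixP => i j; rewrite mxE derive_val.
Qed.

Lemma continuous_mx (T : topologicalType) m n (M : T -> 'M[R]_(m, n)) x :
  (forall i j, {for x, continuous (fun y => M y i j)}) -> {for x, continuous M}.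
Proof.
move=> H; apply/cvgrPdist_le => e e0; near=> y.
apply: mx_norm_le => [|i j]; first exact: ltW.
rewrite !mxE; move: i j; near: y.
apply: filter_forall => i; apply: filter_forall => j.
by have /cvgrPdist_le/(_ e e0) := H i j.
Unshelve. all: by end_near. Qed.

Lemma continuous_mulmx (T : topologicalType) m n p (A : T -> 'M[R]_(m, n))
    (B : T -> 'M[R]_(n, p)) x :
  {for x, continuous A} -> {for x, continuous B} ->
  {for x, continuous (fun y => A y *m B y)}.
Proof.
move=> cA cB; apply: continuous_mx => i j.
rewrite (_ : (fun y => _) = fun y => \sum_k A y i k * B y k j); last first.
  by apply/funext => y; rewrite mxE.
apply: cvg_big => [|k _]; first exact: add_continuous.
apply: continuousM.
  exact: (continuous_comp cA (@coord_continuous _ _ _ i k _)).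
exact: (continuous_comp cB (@coord_continuous _ _ _ k j _)).
Qed.

Lemma is_derive_mulmx (V : normedModType R) m n p (A : V -> 'M[R]_(m, n))
    (B : V -> 'M[R]_(n, p)) t v dA dB :
  is_derive t v A dA -> is_derive t v B dB ->
  is_derive t v (fun s => A s *m B s) (dA *m B t + A t *m dB).
Proof.
move=> /is_derive_mx HA /is_derive_mx HB; apply/is_derive_mx => i j.
rewrite (_ : (fun x => _) = \sum_k (fun x => A x i k * B x k j : R^o)); last first.
  by apply/funext => y; rewrite mxE fct_sumE.
have H k : is_derive t v (fun x => A x i k * B x k j : R^o)
    (dA i k * B t k j + A t i k * dB k j).
  apply: is_derive_eq (is_deriveM (HA i k) (HB k j)) _.
  by rewrite /GRing.scale /= addrC; congr (_ + _); rewrite mulrC.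
apply: is_derive_eq (is_derive_sum H) _.
by rewrite !mxE -big_split.
Qed.

Lemma is_derive_continuous (V : normedModType R) (f : R -> V) t d :
  is_derive t (1 : R) f d -> {for t, continuous f}.
Proof. by case=> /derivable1_diffP D _; exact: differentiable_continuous. Qed.

(** The norm is the largest entry, so the scalar mean value theorem applied to each entry bounds the
    increment without any loss. The interval is written with [Num.min] and [Num.max] because b may
    lie on either side of a. *)
Lemma mx_mean_value m n (y dy : R -> 'M[R]_(m, n)) (a b K : R) : 0 <= K ->
  (forall t, Num.min a b <= t <= Num.max a b -> is_derive t 1 y (dy t)) ->
  (forall t, Num.min a b <= t <= Num.max a b -> `|dy t| <= K) ->
  `|y b - y a| <= K * `|b - a|.
Proof.
move=> K0; wlog ab : a b / a <= b => [H|].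
  case/orP: (le_total a b) => [|ba]; first exact: H.
  move=> D Db.
  rewrite distrC [`|b - a|]distrC; apply: H ba _ _ => t.
    by rewrite minC maxC; exact: D.
  by rewrite minC maxC; exact: Db.
rewrite (min_idPl ab) (max_idPr ab) => D Db; apply: mx_norm_le => [|i j].
  by rewrite mulr_ge0.
have Dij t : a <= t <= b -> is_derive t 1 (fun x => y x i j) (dy t i j).
  by move/D/is_derive_mx.
have [|//|c cab E] := @MVT_segment R (fun x => y x i j) (fun x => dy x i j) a b ab.
    by move=> x; rewrite in_itv /= => /andP[ax xb]; apply: Dij; rewrite !ltW.
  apply/continuous_in_subspaceT => x /set_mem /=; rewrite in_itv /= => xab.
  exact: is_derive_continuous (Dij x xab).
rewrite !mxE E normrM ler_wpM2r //; apply: le_trans (mx_norm_entry _ _ _) (Db _ _).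
by move: cab; rewrite in_itv.
Qed.

Lemma min_max_norm (a b d t : R) : `|a| <= d -> `|b| <= d ->
  Num.min a b <= t <= Num.max a b -> `|t| <= d.
Proof.
rewrite !ler_norml => /andP[a1 a2] /andP[b1 b2] /andP[t1 t2].
apply/andP; split; first by apply: le_trans t1; rewrite le_min a1.
by apply: le_trans t2 _; rewrite ge_max a2.
Qed.

Lemma within_norm_continuous (V : normedModType R) (f : R -> V) d :
  (forall t : R, `|t| <= d -> {for t, continuous f}) ->
  {within `[- d, d], continuous f}.
Proof.
move=> H; apply/continuous_in_subspaceT => x /set_mem /=.
by rewrite in_itv /= -ler_norml => /H.
Qed.

(* Gronwall on an interval so short that no exponential is needed. *)
Lemma short_gronwall m n (y dy : R -> 'M[R]_(m, n)) (d K e : R) :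
  0 <= d -> 0 <= K -> 0 <= e -> K * d <= 2^-1 ->
  (forall t : R, `|t| <= d -> is_derive t 1 y (dy t)) ->
  (forall t : R, `|t| <= d -> `|dy t| <= K * `|y t| + e) ->
  forall t : R, `|t| <= d -> `|y t| <= 2 * (`|y 0| + d * e).
Proof.
move=> d0 K0 e0 Kd D Db.
have cy : {within `[- d, d], continuous (fun t => `|y t| : R)}.
  apply: within_norm_continuous => t td.
  exact: continuous_comp (is_derive_continuous (D t td)) (@norm_continuous _ _ _).
have [c] := EVT_max (ge0_cp d0).2 cy.
rewrite in_itv /= -ler_norml => cd ymax t td.
apply: le_trans (ymax t _) _; first by rewrite in_itv /= -ler_norml.
have B : `|y c - y 0| <= (K * `|y c| + e) * `|c - 0|.
  apply: (@mx_mean_value _ _ y dy).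
  - by rewrite addr_ge0 ?mulr_ge0.
  - by move=> s /min_max_norm sd; apply: D; apply: sd => //; rewrite normr0.
  - move=> s /min_max_norm sd.
    have {}sd : `|s| <= d by apply: sd => //; rewrite normr0.
    apply: le_trans (Db s sd) _; rewrite lerD2r ler_wpM2l // ymax //.
    by rewrite in_itv /= -ler_norml.
rewrite subr0 in B.
have B2 : (K * `|y c| + e) * `|c| <= `|y c| / 2 + d * e.
  apply: le_trans (_ : (K * `|y c| + e) * d <= _).
    by rewrite ler_wpM2l // addr_ge0 ?mulr_ge0.
  rewrite mulrDl [e * d]mulrC lerD2r mulrAC [_ / 2]mulrC.
  by rewrite ler_wpM2r.
have := lerB_normD (y c) (- y 0); rewrite normrN => B3.
lra.
Qed.

End MatrixNorm.

(** * Picard iteration for linear equations on a short interval *)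

Section LinearODE.
Context {R : realType}.

(** The retraction of the line onto [-d, d]: precomposing with it turns data controlled on the
    interval into globally continuous and bounded data. *)
Definition clamp (d t : R) : R := Num.max (- d) (Num.min d t).

Lemma clamp_id d t : `|t| <= d -> clamp d t = t.
Proof.
by rewrite ler_norml => /andP[a b]; rewrite /clamp (min_idPr b) (max_idPr a).
Qed.

Lemma clamp_norm d t : 0 <= d -> `|clamp d t| <= d.
Proof.
move=> d0; rewrite ler_norml /clamp le_max lexx /= ge_max ge_min lexx /= andbT.
by rewrite ge0_cp.
Qed.

Lemma clamp_continuous d : continuous (clamp d : R -> R^o).
Proof.
move=> t; apply: (@continuous_max _ _ (cst (- d)) (fun s : R => Num.min d s)).
  exact: cst_continuous.
by apply: (@continuous_min _ _ (cst d) id); [exact: cst_continuous|exact: cvg_id].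
Qed.

(** The base point lies strictly to the left of [-d, d], so every point of that interval, endpoints
    included, is interior to the interval of integration and t may be on either side of 0. The
    subtracted constant makes the primitive vanish at 0. *)
Definition primitive (d : R) (g : R -> R) (t : R) : R :=
  parameterized_integral lebesgue_measure (- (d + 1)) t g
  - parameterized_integral lebesgue_measure (- (d + 1)) 0 g.

Lemma is_derive_primitive d g t : continuous g -> `|t| <= d ->
  is_derive t (1 : R) (primitive d g : R -> R^o) (g t).
Proof.
move=> cg; rewrite ler_norml => /andP[t1 t2].
have td : t < d + 1 by apply: le_lt_trans t2 _; rewrite ltrDl.
have dt' : - (d + 1) < t by apply: lt_le_trans t1; rewrite opprD ltrBlDr ltrDl.
have [|D E] := continuous_FTC1_closed td _ dt' (cg t).
  apply: continuous_compact_integrable; first exact: segment_compact.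
  exact: continuous_subspaceT.
have H : is_derive t (1 : R) (fun x => parameterized_integral lebesgue_measure (- (d + 1)) x g : R^o) (g t).
  by apply: DeriveDef; [exact: D|rewrite -derive1E; exact: E].
by apply: is_derive_eq (is_deriveB H (is_derive_cst _ _ _)) _; rewrite subr0.
Qed.

Lemma primitive0 d g : primitive d g 0 = 0.
Proof. exact: subrr. Qed.

Definition mx_primitive m n d (g : R -> 'M[R]_(m, n)) (t : R) : 'M[R]_(m, n) :=
  \matrix_(i, j) primitive d (fun s => g s i j) t.

Lemma mx_primitive0 m n d (g : R -> 'M[R]_(m, n)) : mx_primitive d g 0 = 0.
Proof. by apply/matrixP => i j; rewrite !mxE primitive0. Qed.

Lemma is_derive_mx_primitive m n d (g : R -> 'M[R]_(m, n)) t : continuous g ->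
  `|t| <= d -> is_derive t (1 : R) (mx_primitive d g) (g t).
Proof.
move=> cg td; apply/is_derive_mx => i j.
rewrite (_ : (fun x => _) = primitive d (fun s => g s i j)); last first.
  by apply/funext => x; rewrite mxE.
apply: is_derive_primitive td => x.
exact: (continuous_comp (cg x) (@coord_continuous _ _ _ i j _)).
Qed.

(* The limit is the supremum of the lower bounds u k - 2 M / 2 ^ k. *)
Lemma dyadic_limit (u : nat -> R) M :
  (forall k, `|u k.+1 - u k| <= M / 2 ^+ k) ->
  exists l, forall k, `|l - u k| <= 2 * M / 2 ^+ k.
Proof.
move=> H.
have M0 : 0 <= M by have := H 0%N; rewrite expr0 divr1; exact: le_trans.
pose a k := u k - 2 * M / 2 ^+ k; pose b k := u k + 2 * M / 2 ^+ k.
have half k : 2 * M / 2 ^+ k = 2 * M / 2 ^+ k.+1 + M / 2 ^+ k.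
  rewrite exprS; have : (2 : R) ^+ k != 0 by rewrite expf_neq0.
  by move=> k0; field.
have a_incr k : a k <= a k.+1.
  by have := H k; rewrite ler_norml /a (half k) => /andP[h1 _]; lra.
have b_decr k : b k.+1 <= b k.
  by have := H k; rewrite ler_norml /b (half k) => /andP[_ h1]; lra.
have ab k : a k <= b k.
  have : 0 <= 2 * M / 2 ^+ k by rewrite divr_ge0 // ?mulr_ge0 // exprn_ge0.
  rewrite /a /b; lra.
have a_homo : {homo a : i j / (i <= j)%N >-> i <= j}.
  exact: (homo_leq (@lexx _ _) (@le_trans _ _)).
have b_homo : {homo b : i j / (i <= j)%N >-> j <= i}.
  by apply: (homo_leq (r := fun x y => y <= x)) => // y x z xy yz; apply: le_trans yz xy.
have a_le_b j k : a j <= b k.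
  case/orP: (leq_total j k) => jk.
    exact: le_trans (a_homo _ _ jk) (ab k).
  exact: le_trans (ab j) (b_homo _ _ jk).
have ub k : ubound (range a) (b k) by move=> _ [j _ <-].
have hs : has_sup (range a) by split; [exists (a 0), 0|exists (b 0)].
exists (sup (range a)) => k; rewrite ler_norml; apply/andP; split.
  have : a k <= sup (range a) by apply: ub_le_sup; [exists (b 0)|exists k].
  rewrite /a; lra.
have : sup (range a) <= b k by apply: ge_sup => //; exists (a 0), 0.
rewrite /b; lra.
Qed.

Lemma dyadic_small (M e : R) : 0 <= M -> 0 < e -> exists k, M / 2 ^+ k < e.
Proof.
move=> M0 e0; have := cvg_geometric M (z := 2^-1 : R).
rewrite ger0_norm ?invr_ge0 // => /(_ (ltac:(lra)))/cvgrPdist_lt/(_ e e0)[k _ /(_ k)].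
rewrite /= leqnn => /(_ isT); rewrite sub0r normrN /geometric /= exprVn => H.
by exists k; apply: le_lt_trans H; exact: ler_norm.
Qed.

(** The smallness hypothesis makes each Picard step halve distances, so the iterates converge
    dyadically. The factor [n%:R] is there because the largest-entry norm is submultiplicative only
    up to the dimension. *)
Lemma linear_ode m n (A : R -> 'M[R]_n) (y0 : 'M[R]_(m, n)) (d L : R) :
  0 <= d -> 0 <= L -> continuous A -> (forall t, `|A t| <= L) ->
  n%:R * L * d <= 2^-1 ->
  exists y : R -> 'M[R]_(m, n), y 0 = y0 /\
    forall t : R, `|t| <= d -> is_derive t 1 y (y t *m A t).
Proof.
move=> d0 L0 cA bA nLd.
pose step (y : R -> 'M[R]_(m, n)) t := y0 + mx_primitive d (fun s => y s *m A s) t.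
have cmul (y : R -> 'M[R]_(m, n)) : continuous y -> continuous (fun s => y s *m A s).
  by move=> cy s; apply: continuous_mulmx; [exact: cy|exact: cA].
have dstep (y : R -> 'M[R]_(m, n)) (t : R) : continuous y -> `|t| <= d -> is_derive t 1 (step y) (y t *m A t).
  move=> cy td; have := is_derive_mx_primitive (cmul y cy) td => H.
  by apply: is_derive_eq (is_deriveD (is_derive_cst y0 _ _) H) _; rewrite add0r.
have step0 y : step y 0 = y0 by rewrite /step mx_primitive0 addr0.
have cstep (y : R -> 'M[R]_(m, n)) : continuous y -> continuous (step y \o clamp d).
  move=> cy t; apply: continuous_comp; first exact: clamp_continuous.
  exact: is_derive_continuous (dstep y _ cy (clamp_norm _ d0)).
have contr (y y' : R -> 'M[R]_(m, n)) D : continuous y -> continuous y' -> 0 <= D ->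
    (forall t, `|y t - y' t| <= D) ->
    forall t, `|step y (clamp d t) - step y' (clamp d t)| <= D / 2.
  move=> cy cy' D0 HD t; set s := clamp d t.
  have sd : `|s| <= d by exact: clamp_norm.
  have H : `|(step y s - step y' s) - (step y 0 - step y' 0)| <= (n%:R * (D * L)) * `|s - 0|.
    apply: (@mx_mean_value _ _ _ (fun s => step y s - step y' s)
        (fun s => y s *m A s - y' s *m A s)).
    - by rewrite !mulr_ge0.
    - move=> r /min_max_norm rd; have {}rd : `|r| <= d by apply: rd; rewrite ?normr0.
      exact: is_deriveB (dstep _ _ cy rd) (dstep _ _ cy' rd).
    - move=> r _; rewrite -mulmxBl (le_trans (mx_norm_mul _ _)) // ler_wpM2l //.
      by rewrite ler_pM.
  move: H; rewrite !step0 subrr !subr0 => /le_trans; apply.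
  apply: le_trans (_ : n%:R * (D * L) * d <= _).
    by rewrite ler_wpM2l // !mulr_ge0.
  rewrite (_ : _ * d = D * (n%:R * L * d)); last by ring.
  exact: ler_wpM2l.
pose u := fix u k : R -> 'M[R]_(m, n) :=
  if k is k'.+1 then step (u k') \o clamp d else cst y0.
have cu k : continuous (u k).
  by elim: k => [|k IH]; [move=> t; exact: cst_continuous|exact: cstep].
pose M := `|y0|; have M0 : 0 <= M by exact: normr_ge0.
have du k t : `|u k.+1 t - u k t| <= M / 2 ^+ k.
  elim: k t => [t|k IH t].
    have z : forall t : R, `|cst y0 t - cst (0 : 'M[R]_(m, n)) t| <= M.
      by move=> s; rewrite /cst subr0.
    have cc (w : 'M[R]_(m, n)) : continuous (cst w : R -> 'M[R]_(m, n)).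
      by move=> s; exact: cst_continuous.
    have := contr (cst y0) (cst 0) M (cc _) (cc _) (normr_ge0 _) z t.
    (* The starting iterate [cst y0] is itself the image under [step] of the zero function, so the
       contraction estimate between [cst y0] and [cst 0] already bounds the first difference. *)
    have -> : step (cst 0) (clamp d t) = y0.
      have H : `|step (cst 0) (clamp d t) - step (cst 0) 0| <= 0 * `|clamp d t - 0|.
        apply: (@mx_mean_value _ _ _ (step (cst 0)) (fun s => 0 *m A s)) => // r.
          move=> /min_max_norm rd; apply: dstep; first exact: cc.
          by apply: rd; rewrite ?normr0 //; exact: clamp_norm.
        by move=> _; rewrite mul0mx normr0.
      by move: H; rewrite mul0r normr_le0 step0 subr_eq0 => /eqP.
    rewrite expr0 divr1 => /le_trans; apply.
    by have := normr_ge0 y0; rewrite -/M; lra.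
  rewrite exprSr invfM mulrA; apply: (contr (u k.+1) (u k) _ (cu k.+1) (cu k) _ IH).
  by rewrite divr_ge0 ?exprn_ge0.
have [y Hy] : exists y : R -> 'M[R]_(m, n), forall k t, `|y t - u k t| <= 2 * M / 2 ^+ k.
  have Hl t i j : exists l, forall k, `|l - u k t i j| <= 2 * M / 2 ^+ k.
    apply: dyadic_limit => k; apply: le_trans (du k t).
    by apply: le_trans (mx_norm_entry _ i j); rewrite !mxE.
  exists (fun t => \matrix_(i, j) sval (cid (Hl t i j))) => k t.
  apply: mx_norm_le => [|i j]; last by rewrite !mxE; case: cid => l /=.
  by rewrite divr_ge0 ?mulr_ge0 ?exprn_ge0.
have cy : continuous y.
  move=> t; apply/cvgrPdist_lt => e e0.
  have [|k Hk] := @dyadic_small (2 * M) (e / 3) _ (ltac:(lra)).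
    by rewrite mulr_ge0.
  have /cvgrPdist_lt/(_ (e / 3) (ltac:(lra))) := cu k t; apply: filterS => s Hs.
  have -> : y t - y s = (y t - u k t) + (u k t - u k s) - (y s - u k s).
    by rewrite opprB !subrKA.
  apply: le_lt_trans (ler_normB _ _) _.
  have := ler_normD (y t - u k t) (u k t - u k s).
  have := Hy k t; have := Hy k s; lra.
have fixy t : step y (clamp d t) = y t.
  apply/eqP; rewrite -subr_eq0 -normr_le0; apply/ler_addgt0Pr => e e0; rewrite add0r.
  have [|k Hk] := @dyadic_small (2 * M) (e / 2) _ (ltac:(lra)).
    by rewrite mulr_ge0.
  have E0 : 0 <= 2 * M / 2 ^+ k by rewrite divr_ge0 ?mulr_ge0 ?exprn_ge0.
  have H1 := contr y (u k) _ cy (cu k) E0 (Hy k) t.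
  have H2 := Hy k.+1 t.
  have E2 : 2 * M / 2 ^+ k.+1 <= 2 * M / 2 ^+ k.
    rewrite exprSr invfM mulrA; lra.
  have -> : step y (clamp d t) - y t =
      (step y (clamp d t) - u k.+1 t) - (y t - u k.+1 t).
    by rewrite opprB addrA subrK.
  apply: le_trans (ler_normB _ _) _.
  have H3 : `|step y (clamp d t) - u k.+1 t| <= 2 * M / 2 ^+ k / 2 by exact: H1.
  lra.
(* The witness is [step y] and not its clamped version y: the latter is constant beyond d and -d and
   may fail to be differentiable at these two points. *)
exists (step y); split=> // t td.
by have := dstep y t cy td; rewrite -(fixy t) clamp_id.
Qed.

End LinearODE.

Section Lines.
Context {R : realType}.

Lemma is_derive_line (V W : normedModType R) (g : V -> W) p v (t : R) :
  differentiable g (p + t *: v) ->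
  is_derive t (1 : R) (fun s => g (p + s *: v)) ('D_v g (p + t *: v)).
Proof.
move=> dg; have D : derivable g (p + t *: v) v by exact: diff_derivable.
have E : (fun h : R => h^-1 *: (g (p + (h *: (1 : R) + t) *: v) - g (p + t *: v))) =
         (fun h : R => h^-1 *: (g (h *: v + (p + t *: v)) - g (p + t *: v))).
  by apply/funext => h; rewrite [h *: (1 : R)]mulr1 scalerDl addrCA.
by apply: DeriveDef; [rewrite /derivable E|rewrite /derive E].
Qed.

(** The mean value inequality is used twice, on [dg] and then on g minus its linear part at x. This
    gives the Taylor remainder up to the factor 1/2, for matrices and for k of either sign. *)
Lemma second_order m n (g dg ddg : R -> 'M[R]_(m, n)) (x k K : R) : 0 <= K ->
  (forall t, Num.min x (x + k) <= t <= Num.max x (x + k) -> is_derive t 1 g (dg t)) ->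
  (forall t, Num.min x (x + k) <= t <= Num.max x (x + k) -> is_derive t 1 dg (ddg t)) ->
  (forall t, Num.min x (x + k) <= t <= Num.max x (x + k) -> `|ddg t| <= K) ->
  `|g (x + k) - g x - k *: dg x| <= K * `|k| ^+ 2.
Proof.
move=> K0 D1 D2 B.
have xx : Num.min x (x + k) <= x <= Num.max x (x + k).
  by rewrite ge_min le_max lexx.
have H1 t : Num.min x (x + k) <= t <= Num.max x (x + k) -> `|dg t - dg x| <= K * `|k|.
  move=> xt.
  have sub s : Num.min x t <= s <= Num.max x t -> Num.min x (x + k) <= s <= Num.max x (x + k).
    case/andP: xt => t1 t2; case/andP: xx => x1 x2 /andP[s1 s2]; apply/andP; split.
      by apply: le_trans s1; rewrite le_min x1.
    by apply: le_trans s2 _; rewrite ge_max x2.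
  apply: le_trans (mx_mean_value K0 (fun s h => D2 s (sub s h)) (fun s h => B s (sub s h))) _.
  rewrite ler_wpM2l //.
  case/andP: xt; have [k0|k0] := leP 0 k.
    have xk : x <= x + k by rewrite lerDl.
    rewrite (min_idPl xk) (max_idPr xk) => h1 h2.
    by rewrite !ger0_norm ?subr_ge0 // lerBlDl.
  have xk : x + k <= x by rewrite gerDl ltW.
  rewrite (min_idPr xk) (max_idPl xk) => h1 h2.
  by rewrite !ler0_norm ?subr_le0 ?(ltW k0) // opprB; lra.
pose h t := g t - t *: dg x.
have Dh t : Num.min x (x + k) <= t <= Num.max x (x + k) -> is_derive t 1 h (dg t - dg x).
  move=> /D1 Dt; apply/is_derive_mx => i j.
  have {}Dt : is_derive t 1 (fun s => g s i j) (dg t i j) by move/is_derive_mx: Dt.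
  rewrite (_ : (fun s => h s i j) = (fun s => g s i j) - (fun s => dg x i j *: s)); last first.
    by apply/funext => s; rewrite /h !mxE /= fctE /GRing.scale /= [s * _]mulrC.
  apply: is_derive_eq (is_deriveB Dt (is_deriveZ (dg x i j) (is_derive_id t (1 : R)))) _.
  by rewrite !mxE /GRing.scale /= mulr1.
have E : h (x + k) - h x = g (x + k) - g x - k *: dg x.
  rewrite /h scalerDl opprB addrA; set u := x *: _; set w := k *: _.
  by rewrite opprD !addrA [_ - w + u]addrAC subrK addrAC.
rewrite -E; apply: le_trans (mx_mean_value (mulr_ge0 K0 (normr_ge0 k)) Dh H1) _.
by rewrite addrAC subrr add0r -mulrA -expr2.
Qed.

Definition lin2 (W : lmodType R) (A B : W) (v : R^o * R^o) : W := v.1 *: A + v.2 *: B.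

Lemma lin2_is_linear (W : lmodType R) (A B : W) : linear (lin2 A B).
Proof.
by move=> k u v; rewrite /lin2 /= scalerDr !scalerA !scalerDl addrACA.
Qed.
HB.instance Definition _ (W : lmodType R) (A B : W) :=
  GRing.isLinear.Build R (R^o * R^o)%type W *:%R (lin2 A B) (lin2_is_linear A B).

Lemma lin2_continuous (W : normedModType R) (A B : W) : continuous (lin2 A B).
Proof.
by move=> v; apply: cvgD; apply: cvgZr_tmp; [exact: cvg_fst|exact: cvg_snd].
Qed.

Lemma lin2_10 (W : lmodType R) (A B : W) : lin2 A B (1, 0) = A.
Proof. by rewrite /lin2 /= scale1r scale0r addr0. Qed.

Lemma lin2_01 (W : lmodType R) (A B : W) : lin2 A B (0, 1) = B.
Proof. by rewrite /lin2 /= scale1r scale0r add0r. Qed.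
End Lines.

(** * Flat systems on a square *)

Section FlatSystem.
Context {R : realType} {n : nat}.
Notation R2 := (R^o * R^o)%type.
Implicit Types (a b : R2 -> 'M[R]_n).

(** The coefficients act on the right, so left multiplication by a constant matrix preserves
    solutions. Equality of the mixed derivatives of F asks for b a + a_y = a b + b_x, which is the
    form of flatness used throughout. *)
Definition flat_sol m a b (F : R2 -> 'M[R]_(m, n)) (q : R2) :=
  [/\ differentiable F q, 'D_(1, 0) F q = F q *m a q & 'D_(0, 1) F q = F q *m b q].

Definition at_ (q0 : R2) (x y : R) : R2 := (q0.1 + x, q0.2 + y).

Lemma is_derive_at1 (W : normedModType R) (g : R2 -> W) (q0 : R2) (x y : R) :
  differentiable g (at_ q0 x y) ->
  is_derive x (1 : R) (fun s => g (at_ q0 s y)) ('D_(1, 0) g (at_ q0 x y)).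
Proof.
have E s : at_ q0 s y = at_ q0 0 y + s *: ((1, 0) : R2).
  by congr pair; rewrite /= /GRing.scale /= ?mulr1 ?mulr0 !addr0.
rewrite E (_ : (fun s => g _) = (fun s => g (at_ q0 0 y + s *: ((1, 0) : R2)))).
  exact: is_derive_line.
by apply/funext => s; rewrite E.
Qed.

Lemma is_derive_at2 (W : normedModType R) (g : R2 -> W) (q0 : R2) (x y : R) :
  differentiable g (at_ q0 x y) ->
  is_derive y (1 : R) (fun s => g (at_ q0 x s)) ('D_(0, 1) g (at_ q0 x y)).
Proof.
have E s : at_ q0 x s = at_ q0 x 0 + s *: ((0, 1) : R2).
  by congr pair; rewrite /= /GRing.scale /= ?mulr1 ?mulr0 !addr0.
rewrite E (_ : (fun s => g _) = (fun s => g (at_ q0 x 0 + s *: ((0, 1) : R2)))).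
  exact: is_derive_line.
by apply/funext => s; rewrite E.
Qed.

(** A single K dominates the dimension, the coefficients and those derivatives that enter the Taylor
    estimates. Hence K * K bounds the operator of right multiplication by a coefficient, and [gs_dK]
    is the smallness required by [short_gronwall] and [linear_ode]. *)
Record good_square a b (q0 : R2) (K d : R) : Prop := GoodSquare {
  gs_K1 : 1 <= K; gs_nK : n%:R <= K; gs_d : 0 < d; gs_dK : K * K * d <= 2^-1;
  gs_a : forall x y, `|x| <= d -> `|y| <= d -> differentiable a (at_ q0 x y);
  gs_b : forall x y, `|x| <= d -> `|y| <= d -> differentiable b (at_ q0 x y);
  gs_bx : forall x y, `|x| <= d -> `|y| <= d -> differentiable ('D_(1, 0) b) (at_ q0 x y);
  gs_na : forall x y, `|x| <= d -> `|y| <= d -> `|a (at_ q0 x y)| <= K;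
  gs_nb : forall x y, `|x| <= d -> `|y| <= d -> `|b (at_ q0 x y)| <= K;
  gs_nax : forall x y, `|x| <= d -> `|y| <= d -> `|'D_(1, 0) a (at_ q0 x y)| <= K;
  gs_nbx : forall x y, `|x| <= d -> `|y| <= d -> `|'D_(1, 0) b (at_ q0 x y)| <= K;
  gs_nby : forall x y, `|x| <= d -> `|y| <= d -> `|'D_(0, 1) b (at_ q0 x y)| <= K;
  gs_nbxx : forall x y, `|x| <= d -> `|y| <= d ->
    `|'D_(1, 0) ('D_(1, 0) b) (at_ q0 x y)| <= K }.

Lemma bounded_near k (V W : normedModType R) (g : 'I_k -> V -> W) (U : set V) (q0 : V) (c : R) :
  open U -> U q0 -> (forall i, {for q0, continuous (g i)}) -> 0 <= c ->
  exists K r : R, [/\ 1 <= K, c <= K, 0 < r &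
    forall q, ball q0 r q -> U q /\ forall i, `|g i q| <= K].
Proof.
move=> oU Uq cg c0; pose K := \sum_i (`|g i q0| + 1) + (c + 1).
have S0 : 0 <= \sum_i (`|g i q0| + 1) by apply: sumr_ge0 => i _; rewrite addr_ge0.
have gK i : `|g i q0| + 1 <= K.
  have Si : 0 <= \sum_(j | j != i) (`|g j q0| + 1).
    by apply: sumr_ge0 => j _; rewrite addr_ge0.
  rewrite /K (bigD1 i) //=; lra.
have nK : \forall q \near q0, forall i, `|g i q| <= K.
  apply: filter_forall => i; have : (fun q => `|g i q|) @ q0 --> `|g i q0|.
    by apply: cvg_norm; exact: cg.
  move/cvgrPdist_le/(_ 1 ltr01); apply: filterS => q.
  by rewrite ler_norml => /andP[h _]; have := gK i; lra.
have : \forall q \near q0, U q /\ forall i, `|g i q| <= K.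
  by apply: filterS2 (open_near oU Uq) nK.
move=> /nbhs_ballP[r /= r0 H].
by exists K, r; split => //; rewrite /K; lra.
Qed.

Lemma good_squareP a b (U : set R2) (q0 : R2) :
  open U -> U q0 -> smooth_on U a -> smooth_on U b ->
  exists K d, good_square a b q0 K d /\
    (forall x y, `|x| <= d -> `|y| <= d -> U (at_ q0 x y)).
Proof.
move=> oU Uq sa sb.
have sax := smooth_derive ((1, 0) : R2) sa; have sbx := smooth_derive ((1, 0) : R2) sb.
have sby := smooth_derive ((0, 1) : R2) sb; have sbxx := smooth_derive ((1, 0) : R2) sbx.
pose gs := [:: a; b; 'D_(1, 0) a; 'D_(1, 0) b; 'D_(0, 1) b; 'D_(1, 0) ('D_(1, 0) b)].
have [|K [r [K1 nK r0 H]]] :=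
    @bounded_near 6 R2 'M[R]_n (fun i => nth a gs i) U q0 n%:R oU Uq _ (ler0n _ _).
  move=> i; apply: differentiable_continuous.
  case: i => -[|[|[|[|[|[|//]]]]]] ? /=.
  - exact: (smooth_differentiable sa Uq).
  - exact: (smooth_differentiable sb Uq).
  - exact: (smooth_differentiable sax Uq).
  - exact: (smooth_differentiable sbx Uq).
  - exact: (smooth_differentiable sby Uq).
  - exact: (smooth_differentiable sbxx Uq).
(* Half the radius keeps the closed square inside the open ball; the second bound gives K * K * d <=
   1/2. *)
pose d := Num.min (r / 2) (2 * (K * K))^-1.
have KK0 : 0 < 2 * (K * K) by rewrite !mulr_gt0 //; lra.
have d0 : 0 < d by rewrite lt_min invr_gt0 KK0 divr_gt0.
have dr : d < r by rewrite gt_min; apply/orP; left; lra.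
have B x y : `|x| <= d -> `|y| <= d -> ball q0 r (at_ q0 x y).
  move=> xd yd; split; rewrite /= /ball /= opprD addNKr normrN.
    exact: le_lt_trans dr.
  exact: le_lt_trans dr.
have U_at x y : `|x| <= d -> `|y| <= d -> U (at_ q0 x y).
  by move=> xd yd; have [] := H _ (B x y xd yd).
exists K, d; split=> //; split=> //.
- have : d <= (2 * (K * K))^-1 by rewrite ge_min lexx orbT.
  by rewrite -(ler_pM2l KK0) mulfV ?gt_eqF // -mulrA; lra.
- by move=> x y xd yd; exact: (smooth_differentiable sa (U_at _ _ xd yd)).
- by move=> x y xd yd; exact: (smooth_differentiable sb (U_at _ _ xd yd)).
- by move=> x y xd yd; exact: (smooth_differentiable sbx (U_at _ _ xd yd)).
- by move=> x y xd yd; have [_ /(_ (@Ordinal 6 0 isT))] := H _ (B x y xd yd).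
- by move=> x y xd yd; have [_ /(_ (@Ordinal 6 1 isT))] := H _ (B x y xd yd).
- by move=> x y xd yd; have [_ /(_ (@Ordinal 6 2 isT))] := H _ (B x y xd yd).
- by move=> x y xd yd; have [_ /(_ (@Ordinal 6 3 isT))] := H _ (B x y xd yd).
- by move=> x y xd yd; have [_ /(_ (@Ordinal 6 4 isT))] := H _ (B x y xd yd).
- by move=> x y xd yd; have [_ /(_ (@Ordinal 6 5 isT))] := H _ (B x y xd yd).
Qed.

(** Gronwall with zero initial value, along the horizontal axis and then along the vertical through
    x. The half-lengths are |x| and |y| instead of d because the equation is only assumed in the
    open square. *)
Lemma flat_sol_unique m a b (q0 : R2) K d (F : R2 -> 'M[R]_(m, n)) :
  good_square a b q0 K d -> F q0 = 0 ->
  (forall x y, `|x| < d -> `|y| < d -> flat_sol a b F (at_ q0 x y)) ->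
  forall x y, `|x| < d -> `|y| < d -> F (at_ q0 x y) = 0.
Proof.
move=> gs F0 sF x y xd yd.
have K0 : 0 <= K by apply: le_trans (gs_K1 gs).
have Kb (t : R) : `|t| < d -> K * K * `|t| <= 2^-1.
  move=> td; apply: le_trans (gs_dK gs); rewrite ler_wpM2l ?mulr_ge0 //; exact: ltW.
have bnd p (A : 'M[R]_(p, n)) (B : 'M[R]_n) : `|B| <= K -> `|A *m B| <= K * K * `|A| + 0.
  move=> BK; rewrite addr0 (le_trans (mx_norm_mul _ _)) // -mulrA [K * `|A|]mulrC.
  by rewrite ler_pM ?mulr_ge0 ?(gs_nK gs) // ler_wpM2l.
have F1 : F (at_ q0 x 0) = 0.
  apply/eqP; rewrite -normr_le0.
  have := @short_gronwall _ _ _ (fun s => F (at_ q0 s 0)) (fun s => F (at_ q0 s 0) *m a (at_ q0 s 0))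
    `|x| (K * K) 0 (normr_ge0 _) (mulr_ge0 K0 K0) (lexx 0) (Kb x xd) _ _ x (lexx _).
  have -> : F (at_ q0 0 0) = 0 by rewrite /at_ !addr0 -[RHS]F0; case: (q0).
  rewrite normr0 mulr0 addr0 mulr0; apply.
    move=> t tx; have [D Dx _] : flat_sol a b F (at_ q0 t 0).
      by apply: sF; [exact: le_lt_trans xd|rewrite normr0 (gs_d gs)].
    by rewrite -Dx; exact: is_derive_at1.
  move=> t tx; apply: bnd; apply: (gs_na gs); rewrite ?normr0 ?(ltW (gs_d gs)) //.
  exact/ltW/(le_lt_trans tx).
apply/eqP; rewrite -normr_le0.
have := @short_gronwall _ _ _ (fun s => F (at_ q0 x s)) (fun s => F (at_ q0 x s) *m b (at_ q0 x s))
    `|y| (K * K) 0 (normr_ge0 _) (mulr_ge0 K0 K0) (lexx 0) (Kb y yd) _ _ y (lexx _).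
rewrite F1 normr0 mulr0 addr0 mulr0; apply.
  move=> t ty; have [D _ Dy] : flat_sol a b F (at_ q0 x t).
    by apply: sF => //; exact: le_lt_trans yd.
  by rewrite -Dy; exact: is_derive_at2.
move=> t ty; apply: bnd; apply: (gs_nb gs); apply: ltW => //.
exact: le_lt_trans ty yd.
Qed.

End FlatSystem.

Lemma at_subK {R : realType} (q0 q : (R^o * R^o)%type) :
  at_ q0 (q.1 - q0.1) (q.2 - q0.2) = q.
Proof. by case: q => u v; rewrite /at_ /= ![_ + (_ - _)]addrC !subrK. Qed.

Lemma good_square_le {R : realType} n (a b : (R^o * R^o)%type -> 'M[R]_n)
    (q0 : (R^o * R^o)%type) (K d d' : R) :
  0 < d' -> d' <= d -> good_square a b q0 K d -> good_square a b q0 K d'.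
Proof.
move=> d'0 d'd gs.
have le (P : R -> R -> Prop) : (forall x y, `|x| <= d -> `|y| <= d -> P x y) ->
    forall x y, `|x| <= d' -> `|y| <= d' -> P x y.
  by move=> H x y xd yd; apply: H; exact: le_trans d'd.
split=> //; [exact: gs_K1 gs|exact: gs_nK gs| |exact: le (gs_a gs)|exact: le (gs_b gs)|
  exact: le (gs_bx gs)|exact: le (gs_na gs)|exact: le (gs_nb gs)|exact: le (gs_nax gs)|
  exact: le (gs_nbx gs)|exact: le (gs_nby gs)|exact: le (gs_nbxx gs)].
apply: le_trans (gs_dK gs); rewrite ler_wpM2l // mulr_ge0 // (le_trans _ (gs_K1 gs)) //.
Qed.

(** * Existence for flat systems *)

Section FlatExistence.
Context {R : realType} {m n : nat}.
Notation R2 := (R^o * R^o)%type.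
Variables (a b : R2 -> 'M[R]_n) (q0 : R2) (K d : R) (F0 : 'M[R]_(m, n)).
Hypothesis gs : good_square a b q0 K d.
Hypothesis flat : forall x y, `|x| <= d -> `|y| <= d ->
  let q := at_ q0 x y in b q *m a q + 'D_(0, 1) a q = a q *m b q + 'D_(1, 0) b q.
Hypothesis a_diff : forall x y, `|x| <= d -> `|y| <= d -> differentiable a (at_ q0 x y).

Let d0 : 0 <= d. Proof. exact: ltW (gs_d gs). Qed.
Let K0 : 0 <= K. Proof. exact: le_trans (gs_K1 gs). Qed.
Let n0d : `|0 : R| <= d. Proof. by rewrite normr0. Qed.

Lemma norm_mul_le p r (A : 'M[R]_(p, n)) (B : 'M[R]_(n, r)) x y :
  `|A| <= x -> `|B| <= y -> `|A *m B| <= K * (x * y).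
Proof.
move=> Ax By; apply: le_trans (mx_norm_mul _ _) _.
by rewrite ler_pM ?mulr_ge0 ?(gs_nK gs) // ler_pM.
Qed.

Lemma nKd : n%:R * K * d <= 2^-1.
Proof.
apply: le_trans (gs_dK gs); rewrite ler_wpM2r // ler_wpM2r //; exact: gs_nK gs.
Qed.

Lemma ode_a : exists y : R -> 'M[R]_(m, n), y 0 = F0 /\
  forall t : R, `|t| <= d -> is_derive t 1 y (y t *m a (at_ q0 t 0)).
Proof.
have [|t|y [y0 Dy]] := @linear_ode R m n (fun t => a (at_ q0 (clamp d t) 0)) F0 d K d0 K0 _ _ nKd.
- move=> t; have td := clamp_norm t d0.
  have := is_derive_continuous (is_derive_at1 (gs_a gs td n0d)).
  exact: continuous_comp (@clamp_continuous _ d t).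
- exact: (gs_na gs (clamp_norm t d0) n0d).
by exists y; split=> // t td; have := Dy t td; rewrite clamp_id.
Qed.

Lemma ode_b (x : R) (z : 'M[R]_(m, n)) : `|x| <= d -> exists y : R -> 'M[R]_(m, n), y 0 = z /\
  forall t : R, `|t| <= d -> is_derive t 1 y (y t *m b (at_ q0 x t)).
Proof.
move=> xd.
have [|t|y [y0 Dy]] := @linear_ode R m n (fun t => b (at_ q0 x (clamp d t))) z d K d0 K0 _ _ nKd.
- move=> t; have td := clamp_norm t d0.
  have := is_derive_continuous (is_derive_at2 (gs_b gs xd td)).
  exact: continuous_comp (@clamp_continuous _ d t).
- exact: (gs_nb gs xd (clamp_norm t d0)).
by exists y; split=> // t td; have := Dy t td; rewrite clamp_id.
Qed.

Lemma ode_bound (y : R -> 'M[R]_(m, n)) (B : R -> 'M[R]_n) :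
  (forall t : R, `|t| <= d -> is_derive t 1 y (y t *m B t)) ->
  (forall t, `|t| <= d -> `|B t| <= K) ->
  forall t, `|t| <= d -> `|y t| <= 2 * `|y 0|.
Proof.
move=> D BK t td.
have := @short_gronwall _ _ _ y (fun t => y t *m B t) d (K * K) 0 d0 (mulr_ge0 K0 K0)
  (lexx _) (gs_dK gs) D _ t td.
rewrite mulr0 addr0; apply=> s sd; rewrite addr0.
by apply: le_trans (norm_mul_le (lexx _) (BK s sd)) _; rewrite mulrA mulrAC.
Qed.

(** The candidate solution: y along the horizontal axis, [G x] along the vertical through x with
    initial value [y x]. The vertical equation holds by construction, but the curves [G x] are
    chosen separately for each x, so even continuity in x has to be proved; this is the purpose of
    the quantitative estimates that follow. *)
Variables (y : R -> 'M[R]_(m, n)) (G : R -> R -> 'M[R]_(m, n)).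
Hypothesis y0 : y 0 = F0.
Hypothesis Dy : forall t : R, `|t| <= d -> is_derive t 1 y (y t *m a (at_ q0 t 0)).
Hypothesis G0 : forall x, `|x| <= d -> G x 0 = y x.
Hypothesis DG : forall x t : R, `|x| <= d -> `|t| <= d ->
  is_derive t 1 (G x) (G x t *m b (at_ q0 x t)).

(** Each Gronwall estimate costs a factor 2: one along the axis, one along the vertical. *)
Let B := 4 * `|F0|.
Let B0 : 0 <= B. Proof. by rewrite mulr_ge0. Qed.

Lemma y_bound t : `|t| <= d -> `|y t| <= B.
Proof.
move=> td; have := ode_bound Dy (fun s sd => gs_na gs sd n0d) td.
rewrite y0 /B => /le_trans; apply; have := normr_ge0 F0; lra.
Qed.

Lemma G_bound x t : `|x| <= d -> `|t| <= d -> `|G x t| <= B.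
Proof.
move=> xd td; have := ode_bound (fun s sd => DG xd sd) (fun s sd => gs_nb gs xd sd) td.
have := ode_bound Dy (fun s sd => gs_na gs sd n0d) xd.
rewrite G0 // y0 /B; lra.
Qed.

Let C0 := K * (K * (B * K) * K) + K * (B * K).
Let C0_ge0 : 0 <= C0. Proof. by rewrite addr_ge0 ?mulr_ge0. Qed.

Lemma ddode_bound (A B' : 'M[R]_n) (z : 'M[R]_(m, n)) :
  `|z| <= B -> `|A| <= K -> `|B'| <= K -> `|z *m A *m A + z *m B'| <= C0.
Proof.
move=> zB AK BK; apply: le_trans (ler_normD _ _) _; apply: lerD.
  by apply: norm_mul_le => //; exact: norm_mul_le.
exact: norm_mul_le.
Qed.

Lemma y_taylor x k : `|x| <= d -> `|x + k| <= d ->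
  `|y (x + k) - y x - k *: (y x *m a (at_ q0 x 0))| <= C0 * `|k| ^+ 2.
Proof.
move=> xd xkd.
apply: (@second_order _ _ _ y (fun s => y s *m a (at_ q0 s 0))
  (fun s => y s *m a (at_ q0 s 0) *m a (at_ q0 s 0) + y s *m 'D_(1, 0) a (at_ q0 s 0))) => //.
- by move=> t /(min_max_norm xd xkd) td; exact: Dy.
- move=> t /(min_max_norm xd xkd) td.
  apply: is_derive_mulmx; first exact: Dy.
  by apply: is_derive_at1; exact: (gs_a gs).
- move=> t /(min_max_norm xd xkd) td; apply: ddode_bound => //.
  + exact: y_bound.
  + exact: (gs_na gs td n0d).
  + exact: (gs_nax gs td n0d).
Qed.

Lemma G_taylor2 x t k : `|x| <= d -> `|t| <= d -> `|t + k| <= d ->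
  `|G x (t + k) - G x t - k *: (G x t *m b (at_ q0 x t))| <= C0 * `|k| ^+ 2.
Proof.
move=> xd td tkd.
apply: (@second_order _ _ _ (G x) (fun s => G x s *m b (at_ q0 x s))
  (fun s => G x s *m b (at_ q0 x s) *m b (at_ q0 x s) + G x s *m 'D_(0, 1) b (at_ q0 x s))) => //.
- by move=> s /(min_max_norm td tkd) sd; exact: DG.
- move=> s /(min_max_norm td tkd) sd.
  apply: is_derive_mulmx; first exact: DG.
  by apply: is_derive_at2; exact: (gs_b gs).
- move=> s /(min_max_norm td tkd) sd; apply: ddode_bound => //.
  + exact: G_bound.
  + exact: (gs_nb gs xd sd).
  + exact: (gs_nby gs xd sd).
Qed.

Lemma b_lip x k t : `|x| <= d -> `|x + k| <= d -> `|t| <= d ->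
  `|b (at_ q0 (x + k) t) - b (at_ q0 x t)| <= K * `|k|.
Proof.
move=> xd xkd td.
have := @mx_mean_value _ _ _ (fun s => b (at_ q0 s t)) (fun s => 'D_(1, 0) b (at_ q0 s t))
  x (x + k) K K0.
rewrite [x + k - x]addrAC subrr add0r; apply.
  by move=> s /(min_max_norm xd xkd) sd; apply: is_derive_at1; exact: (gs_b gs).
by move=> s /(min_max_norm xd xkd) sd; exact: (gs_nbx gs).
Qed.

Lemma b_taylor x k t : `|x| <= d -> `|x + k| <= d -> `|t| <= d ->
  `|b (at_ q0 (x + k) t) - b (at_ q0 x t) - k *: 'D_(1, 0) b (at_ q0 x t)| <= K * `|k| ^+ 2.
Proof.
move=> xd xkd td.
apply: (@second_order _ _ _ (fun s => b (at_ q0 s t)) (fun s => 'D_(1, 0) b (at_ q0 s t))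
  (fun s => 'D_(1, 0) ('D_(1, 0) b) (at_ q0 s t)) x k K K0) => s /(min_max_norm xd xkd) sd.
- exact: (is_derive_at1 (gs_b gs sd td)).
- exact: (is_derive_at1 (gs_bx gs sd td)).
- exact: (gs_nbxx gs sd td).
Qed.

(** [e * |k| ^ 2] bounds the inhomogeneous term [err] in the proof of [G_taylor1], and C1 is what
    [short_gronwall] makes of it together with the initial error C0 on the axis. *)
Let e := K * (B * K) + K * (K * (B * K) * K).
Let C1 := 2 * (C0 + d * e).

(* By flatness the error [u t] of the first order expansion of [G x t] in x
   solves the same equation as [G] up to a quadratic term. *)
Lemma G_taylor1 x k t : `|x| <= d -> `|x + k| <= d -> `|t| <= d ->
  `|G (x + k) t - G x t - k *: (G x t *m a (at_ q0 x t))| <= C1 * `|k| ^+ 2.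
Proof.
move=> xd xkd td.
pose u s := G (x + k) s - G x s - k *: (G x s *m a (at_ q0 x s)).
pose b' s := b (at_ q0 (x + k) s).
pose err s := G x s *m (b' s - b (at_ q0 x s) - k *: 'D_(1, 0) b (at_ q0 x s))
  + k *: (G x s *m a (at_ q0 x s) *m (b' s - b (at_ q0 x s))).
have Du s : `|s| <= d -> is_derive s (1 : R) u (u s *m b' s + err s).
  move=> sd.
  have Da := is_derive_at2 (a_diff xd sd).
  have DGa := is_deriveZ k (is_derive_mulmx (DG xd sd) Da).
  apply: is_derive_eq (is_deriveB (is_deriveB (DG xkd sd) (DG xd sd)) DGa) _.
  (* Differentiating [G x s *m a] vertically produces G (b a + a_y); flatness trades it for G (a b +
     b_x), whose first term is of the form required by the equation for u and whose second is
     absorbed in the expansion of b. *)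
  rewrite -mulmxA -mulmxDr flat // mulmxDr /err /u /b' !mulmxA.
  rewrite !mulmxBl !mulmxBr -!scalemxAl -!scalemxAr.
  set g' := G (x + k) s *m _; set g := G x s *m b (at_ q0 x s).
  set p := G x s *m b _; set q := G x s *m _ *m _; set w := G x s *m _ *m _.
  set v := G x s *m _; clearbody g' g p q w v.
  by apply/matrixP => i j; rewrite !mxE; ring.
have e0 : 0 <= e * `|k| ^+ 2 by rewrite mulr_ge0 ?exprn_ge0 // addr_ge0 ?mulr_ge0.
have := @short_gronwall _ _ _ u _ d (K * K) _ d0 (mulr_ge0 K0 K0) e0 (gs_dK gs) Du _ t td.
have u0 : `|u 0| <= C0 * `|k| ^+ 2 by rewrite /u !G0 //; exact: y_taylor.
move=> H; apply: le_trans (H _) _; last by rewrite /C1 mulrA -[in leRHS]mulrA mulrDl; lra.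
move=> s sd; apply: le_trans (ler_normD _ _) _; apply: lerD.
  apply: le_trans (norm_mul_le (lexx _) (gs_nb gs xkd sd)) _.
  by rewrite mulrA mulrAC.
apply: le_trans (ler_normD _ _) _; rewrite /e mulrDl; apply: lerD.
  apply: le_trans (norm_mul_le (G_bound xd sd) (b_taylor xd xkd sd)) _.
  by rewrite !mulrA.
rewrite normrZ.
have := norm_mul_le (norm_mul_le (G_bound xd sd) (gs_na gs xd sd)) (b_lip xd xkd sd).
move/(ler_wpM2l (normr_ge0 k)) => /le_trans; apply; rewrite le_eqVlt; apply/orP; left.
by apply/eqP; ring.
Qed.

Let C2 := C1 * (2 * d) + K * (B * K).
Let C3 := K * (C2 * K) + K * (B * K).
Let e_ge0 : 0 <= e. Proof. by apply: addr_ge0; rewrite ?mulr_ge0. Qed.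
Let C1_ge0 : 0 <= C1. Proof. by apply: mulr_ge0 => //; apply: addr_ge0 => //; apply: mulr_ge0. Qed.
Let C2_ge0 : 0 <= C2.
Proof. by apply: addr_ge0; apply: mulr_ge0 => //; apply: mulr_ge0. Qed.
Let C3_ge0 : 0 <= C3.
Proof. by apply: addr_ge0; apply: mulr_ge0 => //; apply: mulr_ge0. Qed.

Lemma Gb_lip x k t : `|x| <= d -> `|x + k| <= d -> `|t| <= d ->
  `|G (x + k) t *m b (at_ q0 (x + k) t) - G x t *m b (at_ q0 x t)| <= C3 * `|k|.
Proof.
move=> xd xkd td.
have kd : `|k| <= 2 * d.
  have -> : k = (x + k) - x by rewrite addrAC subrr add0r.
  by apply: le_trans (ler_normB _ _) _; lra.
have Glip : `|G (x + k) t - G x t| <= C2 * `|k|.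
  have H := G_taylor1 xd xkd td.
  have H2 := norm_mul_le (G_bound xd td) (gs_na gs xd td).
  rewrite -[X in `|X|](subrK (k *: (G x t *m a (at_ q0 x t)))).
  apply: le_trans (ler_normD _ _) _; rewrite /C2 mulrDl; apply: lerD.
    apply: le_trans H _; rewrite -mulrA ler_wpM2l // expr2 ler_wpM2r //.
  by rewrite normrZ mulrC ler_wpM2r.
set b' := b (at_ q0 (x + k) t).
have -> : G (x + k) t *m b' - G x t *m b (at_ q0 x t) =
    (G (x + k) t - G x t) *m b' + G x t *m (b' - b (at_ q0 x t)).
  by rewrite mulmxBl mulmxBr addrA subrK.
apply: le_trans (ler_normD _ _) _; rewrite /C3 mulrDl; apply: lerD.
  apply: le_trans (norm_mul_le Glip (gs_nb gs xkd td)) _.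
  by rewrite le_eqVlt; apply/orP; left; apply/eqP; ring.
apply: le_trans (norm_mul_le (G_bound xd td) (b_lip xd xkd td)) _.
by rewrite !mulrA.
Qed.

(** The increment is split at the corner (x + h, t). The vertical slope is then taken at x + h, and
    moving it back to x costs the Lipschitz term [Gb_lip], multiplied by |k| and therefore still
    quadratic. *)
Lemma G_taylor x t h k : `|x| <= d -> `|x + h| <= d -> `|t| <= d -> `|t + k| <= d ->
  `|G (x + h) (t + k) - G x t
    - (h *: (G x t *m a (at_ q0 x t)) + k *: (G x t *m b (at_ q0 x t)))|
  <= (C0 + C1 + C3) * (Num.max `|h| `|k|) ^+ 2.
Proof.
move=> xd xhd td tkd; set M := Num.max _ _.
have hM : `|h| <= M by rewrite le_max lexx.
have kM : `|k| <= M by rewrite le_max lexx orbT.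
have M0 : 0 <= M by apply: le_trans hM.
have T2 := G_taylor2 xhd td tkd; have T1 := G_taylor1 xd xhd td; have T3 := Gb_lip xd xhd td.
set u := G (x + h) (t + k) in T2 *; set v := G (x + h) t in T1 T2 T3.
set w := G x t in T1 T3 *; set p := w *m _ in T1 *; set q := w *m _ in T3 *.
set r := v *m _ in T2 T3.
have -> : u - w - (h *: p + k *: q) = (u - v - k *: r) + (v - w - h *: p) + k *: (r - q).
  by clearbody u v w p q r; apply/matrixP => i j; rewrite !mxE; ring.
apply: le_trans (ler_normD _ _) _; rewrite mulrDl; apply: lerD.
  apply: le_trans (ler_normD _ _) _; rewrite mulrDl; apply: lerD.
    by apply: le_trans T2 _; rewrite ler_wpM2l // lerXn2r // nnegrE.
  by apply: le_trans T1 _; rewrite ler_wpM2l // lerXn2r // nnegrE.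
rewrite normrZ expr2 mulrCA ler_pM //.
by apply: le_trans T3 _; rewrite ler_wpM2l.
Qed.

Lemma G_flat_sol q : ball q0 d q ->
  flat_sol a b (fun p : R2 => G (p.1 - q0.1) (p.2 - q0.2)) q.
Proof.
case=> q1 q2; set F := (X in flat_sol _ _ X _).
pose x := q.1 - q0.1; pose t := q.2 - q0.2.
have xd : `|x| < d by rewrite /x distrC.
have td : `|t| < d by rewrite /t distrC.
have Eq : q = at_ q0 x t by rewrite at_subK.
have Fq : F q = G x t by [].
have DF : is_diff q F (lin2 (F q *m a q) (F q *m b q)).
  apply: is_diff_eps; first exact: lin2_continuous.
  move=> eps eps0; pose C := C0 + C1 + C3 + 1.
  have C_gt0 : 0 < C by rewrite ltr_wpDl //; apply: addr_ge0 => //; apply: addr_ge0.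
  pose r := Num.min (Num.min (d - `|x|) (d - `|t|)) (eps / C).
  have r0 : 0 < r by rewrite !lt_min !subr_gt0 xd td divr_gt0.
  apply/nbhs_ballP; exists r; first exact: r0.
  move=> h [h1 h2]; rewrite /= /ball /= !sub0r !normrN in h1 h2.
  have hE : `|h| = Num.max `|h.1| `|h.2| by rewrite prod_normE.
  have rx : r <= d - `|x| by rewrite !ge_min lexx.
  have rt : r <= d - `|t| by rewrite !ge_min lexx orbT.
  have re : r <= eps / C by rewrite !ge_min lexx orbT.
  have xhd : `|x + h.1| <= d by apply: le_trans (ler_normD _ _) _; lra.
  have thd : `|t + h.2| <= d by apply: le_trans (ler_normD _ _) _; lra.
  have := G_taylor (ltW xd) xhd (ltW td) thd.
  rewrite -Eq -Fq -hE /lin2.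
  have -> : G (x + h.1) (t + h.2) = F (h + q).
    by rewrite /F /x /t /= ![h.1 + _]addrC ![h.2 + _]addrC -!addrA ![- _ + _]addrC.
  move=> /le_trans; apply; rewrite expr2 mulrA ler_wpM2r //.
  have he : `|h| <= eps / C by rewrite hE ge_max !ltW // (lt_le_trans _ re).
  apply: le_trans (_ : C * `|h| <= _); first by rewrite ler_wpM2r // lerDl.
  by rewrite -ler_pdivlMl // mulrC.
have D := ex_diff (is_diff_def := DF); split=> //.
  by rewrite deriveE // diff_val lin2_10.
by rewrite deriveE // diff_val lin2_01.
Qed.

End FlatExistence.

(** Because the system is linear, the radius d depends on the coefficients alone and not on the
    initial value. Uniqueness is stated for germs, the form in which two local frames are compared
    later. *)
Theorem flat_local {R : realType} n (a b : (R^o * R^o)%type -> 'M[R]_n)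
    (U : set (R^o * R^o)%type) (q0 : (R^o * R^o)%type) :
  open U -> smooth_on U a -> smooth_on U b ->
  (forall q, U q -> b q *m a q + 'D_(0, 1) a q = a q *m b q + 'D_(1, 0) b q) ->
  U q0 -> exists d, [/\ 0 < d, forall q, ball q0 d q -> U q,
    forall m (F0 : 'M[R]_(m, n)), exists F : (R^o * R^o)%type -> 'M[R]_(m, n),
      F q0 = F0 /\ forall q, ball q0 d q -> flat_sol a b F q &
    forall m (F : (R^o * R^o)%type -> 'M[R]_(m, n)), F q0 = 0 ->
      (\forall q \near q0, flat_sol a b F q) -> \forall q \near q0, F q = 0].
Proof.
move=> oU sa sb flat Uq; have [K [d [gs Ud]]] := good_squareP oU Uq sa sb.
have d0 := gs_d gs.
have atE e (q : (R^o * R^o)%type) : ball q0 e q -> exists x y,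
    [/\ `|x| < e, `|y| < e & q = at_ q0 x y].
  case=> q1 q2; exists (q.1 - q0.1), (q.2 - q0.2); split; [by rewrite distrC..|].
  by rewrite at_subK.
have at_ball e x y : `|x| < e -> `|y| < e -> ball q0 e (at_ q0 x y).
  by move=> xd yd; split; rewrite /= /ball /= opprD addNKr normrN.
exists d; split=> //.
- by move=> q /atE[x [y [xd yd ->]]]; apply: Ud; exact: ltW.
- move=> m F0.
  have fl x y : `|x| <= d -> `|y| <= d -> let q := at_ q0 x y in
      b q *m a q + 'D_(0, 1) a q = a q *m b q + 'D_(1, 0) b q.
    by move=> xd yd; apply: flat; exact: Ud.
  have [y [y0 Dy]] := ode_a F0 gs.
  (* The axiom of choice needs a curve for every real x; outside the square it is the zero function,
     about which nothing is claimed. *)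
  have HG x : exists Gx : R -> 'M[R]_(m, n), `|x| <= d -> Gx 0 = y x /\
      forall t : R, `|t| <= d -> is_derive t 1 Gx (Gx t *m b (at_ q0 x t)).
    have [xd|_] := boolP (`|x| <= d); last by exists (fun=> 0).
    by have [Gx HGx] := ode_b gs (y x) xd; exists Gx.
  have {HG} [G HG] := choice HG.
  exists (fun p => G (p.1 - q0.1) (p.2 - q0.2)); split.
    by rewrite !subrr; have [->] := HG 0 (ltac:(by rewrite normr0 ltW)).
  move=> q qb; apply: (G_flat_sol gs fl (gs_a gs) y0 Dy) qb.
    by move=> x xd; have [] := HG x xd.
  by move=> x t xd; have [_] := HG x xd; apply.
- move=> m F Fq /nbhs_ballP[e /= e0 sF]; pose e' := Num.min d e.
  have e'0 : 0 < e' by rewrite lt_min d0.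
  have e'd : e' <= d by rewrite ge_min lexx.
  have e'e : e' <= e by rewrite ge_min lexx orbT.
  apply/nbhs_ballP; exists e' => // q /atE[x [y [xd yd ->]]].
  apply: (flat_sol_unique (good_square_le e'0 e'd gs) Fq) xd yd => x' y' xd' yd'.
  by apply: sF; apply: at_ball; exact: lt_le_trans e'e.
Qed.

(** * Monodromy *)

Section Cousin.
Context {R : realType}.

(** Compactness of [0, 1] in the form of real induction: at the supremum of the x with P 0 x, the
    local hypothesis and additivity push past the supremum unless it is 1. It replaces the choice of
    a mesh finer than a Lebesgue number. *)
Lemma cousin (P : R -> R -> Prop) :
  (forall a b c, 0 <= a -> a <= b -> b <= c -> c <= 1 -> P a b -> P b c -> P a c) ->
  (forall x, 0 <= x <= 1 -> exists2 e, 0 < e & forall a b, 0 <= a -> b <= 1 ->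
     a <= x <= b -> x - e < a -> b < x + e -> P a b) ->
  P 0 1.
Proof.
move=> add loc; pose S := [set x : R | 0 <= x <= 1 /\ P 0 x].
have S0 : S 0.
  have [|e e0 H] := loc 0; first by rewrite lexx ler01.
  by split; [rewrite lexx ler01|apply: H; rewrite ?lexx //; lra].
have supS : has_sup S by split; [exists 0|exists 1 => x [/andP[]]].
pose s := sup S.
have s01 : 0 <= s <= 1.
  rewrite ub_le_sup //=; last by case: supS.
  by apply: ge_sup; [exists 0|move=> x [/andP[]]].
have [e e0 H] := loc s s01.
have [a [/andP[a0 a1] Pa] sa] := sup_adherent e0 supS.
have as_ : a <= s by apply: ub_le_sup; [case: supS|split; [rewrite a0|]].
case/andP: s01 => s0 s1; rewrite -/s in sa.
pose b := Num.min 1 (s + e / 2).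
have b1 : b <= 1 by rewrite ge_min lexx.
have sb : s <= b by rewrite le_min s1 /=; lra.
have be : b < s + e by rewrite gt_min; apply/orP; right; lra.
have Pb : P 0 b.
  apply: (add 0 a b) => //; first exact: le_trans sb.
  by apply: H => //; rewrite as_ sb.
have bs : b <= s.
  by apply: ub_le_sup; [case: supS|split=> //; rewrite b1 (le_trans s0 sb)].
suff E : b = 1 by rewrite -E.
by move: bs; rewrite /b; case: (leP 1 (s + e / 2)) => // _; rewrite gerDl leNgt divr_gt0.
Qed.
End Cousin.

Lemma within_near (K T : topologicalType) (S : set K) (H : K -> T) k (P : set T) :
  {within S, continuous H} -> S k ->
  (\forall r \near H k, P r) -> \forall k' \near k, S k' -> P (H k').
Proof. by move=> /subspace_continuousP cH Sk nP; have := cH k Sk _ nP. Qed.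

Section HorizontalLifts.
Context {T : topologicalType} {V : Type}.
Variables (D : T -> set T) (E G : T -> T -> V -> V).
Hypothesis D_open : forall p, open (D p).
Hypothesis D_in : forall p, D p p.
Hypothesis GK : forall p r v, D p r -> G p r (E p r v) = v.
(** The changes of trivialization are locally constant: the bundle is flat. The fibre V carries no
    topology, so this is also what plays the role of continuity for lifts. *)
Hypothesis compat : forall p p' r, D p r -> D p' r ->
  \forall s \near r, forall v, E p' s (G p s v) = E p' r (G p r v).

Section Lifts.
Context {K : topologicalType}.
Implicit Types (S : set K) (H : K -> T) (g : K -> V).

(* [E p r] reads the fibre over [r] in the trivialization around [p], with
   inverse [G p r]; horizontal means locally constant in trivializations. *)
Definition hor S H g k :=
  \forall k' \near k, S k' -> E (H k) (H k') (g k') = E (H k) (H k) (g k).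

Lemma hor_near_D S H k p : {within S, continuous H} -> S k -> D p (H k) ->
  \forall k' \near k, S k' -> D p (H k').
Proof.
by move=> cH Sk Dk; apply: (within_near cH Sk); apply: open_nbhs_nbhs; split.
Qed.

Lemma hor_unique S H g1 g2 k0 : connected S -> {within S, continuous H} ->
  (forall k, S k -> hor S H g1 k) -> (forall k, S k -> hor S H g2 k) ->
  S k0 -> g1 k0 = g2 k0 -> forall k, S k -> g1 k = g2 k.
Proof.
move=> cS cH h1 h2 Sk0 e0.
have near_iff k : S k -> \forall k' \near k, S k' -> (g1 k' = g2 k' <-> g1 k = g2 k).
  move=> Sk; have n1 := h1 k Sk; have n2 := h2 k Sk; have n3 := hor_near_D cH Sk (D_in _).
  move: n1 n2 n3; apply: filterS3 => k' e1 e2 Dk Sk'.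
  have {}e1 := e1 Sk'; have {}e2 := e2 Sk'; have {}Dk := Dk Sk'; split=> e.
    by rewrite -(GK (g1 k) (D_in (H k))) -e1 e e2 GK.
  by rewrite -(GK (g1 k') Dk) e1 e -e2 GK.
pose B := [set k | S k /\ g1 k = g2 k].
have BS : B = S.
  apply: cS; first by exists k0.
    exists (interior [set k | S k -> g1 k = g2 k]); first exact: open_interior.
    apply/seteqP; split=> [k [Sk ek]|k [Sk /interior_subset /(_ Sk)]] //.
    split=> //; have := near_iff k Sk; apply: filterS => k' H' Sk'.
    exact/H'.
  exists (~` (interior [set k | S k -> g1 k <> g2 k])).
    exact/open_closedC/open_interior.
  apply/seteqP; split=> [k [Sk ek]|k [Sk nk]].
    by split=> // /interior_subset /(_ Sk).
  split=> //; apply: contrapT => ne; apply: nk.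
  by have := near_iff k Sk; apply: filterS => k' H' Sk' e; apply: ne; apply/(H' Sk').
by move=> k; rewrite -BS => -[].
Qed.

Lemma hor_sub S S' H g k : S' `<=` S -> hor S H g k -> hor S' H g k.
Proof. by move=> SS; apply: filterS => k' h /SS. Qed.

Lemma hor_ext S H H' g g' k : {in S, H =1 H'} -> {in S, g =1 g'} -> S k ->
  hor S H g k -> hor S H' g' k.
Proof.
move=> eH eg Sk; apply: filterS => k' h Sk'.
by rewrite -!eH ?inE // -!eg ?inE // h.
Qed.

(** Closedness settles the points that lie in only one piece: near such a point the other piece is
    absent, so its values do not interfere. *)
Lemma hor_glue S1 S2 H g1 g2 : closed S1 -> closed S2 ->
  (forall k, S1 k -> hor S1 H g1 k) -> (forall k, S2 k -> hor S2 H g2 k) ->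
  (forall k, S1 k -> S2 k -> g1 k = g2 k) ->
  forall k, (S1 `|` S2) k ->
    hor (S1 `|` S2) H (fun k => if `[< S1 k >] then g1 k else g2 k) k.
Proof.
move=> c1 c2 h1 h2 e12; set g := fun k => _.
have gE1 k : S1 k -> g k = g1 k by move=> Sk; rewrite /g asboolT.
have gE2 k : S2 k -> g k = g2 k.
  by move=> Sk; rewrite /g; case: asboolP => // S1k; exact: e12.
have one S k gi : closed S -> (forall k, S k -> hor S H gi k) ->
    (forall k, S k -> g k = gi k) ->
    \forall k' \near k, S k' -> S k /\ E (H k) (H k') (g k') = E (H k) (H k) (g k).
  move=> cS hS gE; have [Sk|nSk] := pselect (S k).
    by have := hS k Sk; apply: filterS => k' h Sk'; split=> //; rewrite !gE // h.
  have oC : open (~` S) by exact: closed_openC.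
  by have : \forall k' \near k, (~` S) k' by [exact: open_nbhs_nbhs];
    apply: filterS => k' nk' /nk'.
move=> k Sk; have n1 := one S1 k g1 c1 h1 gE1; have n2 := one S2 k g2 c2 h2 gE2.
by move: n1 n2; apply: filterS2 => k' o1 o2 [/o1[]|/o2[]].
Qed.

Lemma local_lift S H p v : {within S, continuous H} -> (forall k, S k -> D p (H k)) ->
  forall k, S k -> hor S H (fun k => G p (H k) v) k.
Proof.
move=> cH DS k Sk.
have := within_near cH Sk (compat (DS k Sk) (D_in (H k))).
by apply: filterS => k' h Sk'; rewrite h.
Qed.

Lemma hor_cst S p v k : hor S (fun=> p) (fun=> v) k.
Proof. by near=> k'. Unshelve. all: by end_near. Qed.

End Lifts.

Lemma hor_comp (K K' : topologicalType) (S : set K) (S' : set K') H g (j : K' -> K) k :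
  {within S', continuous j} -> (forall s, S' s -> S (j s)) -> S' k ->
  hor S H g (j k) -> hor S' (H \o j) (g \o j) k.
Proof.
move=> cj jS Sk h.
by have := within_near cj Sk h; apply: filterS => s hs Ss; apply: hs => //; exact: jS.
Qed.

(** * Lifting maps defined on a square *)

Section Square.
Context {R : realType}.
Implicit Types (H : R * R -> T) (a b c d e : R).

Definition rect a b c d : set (R * R) := [set k | a <= k.1 <= b /\ c <= k.2 <= d].

Lemma rectE a b c d : rect a b c d = `[a, b] `*` `[c, d].
Proof.
by apply/seteqP; split=> -[s t]; rewrite /rect /= !in_itv /=.
Qed.

Lemma closed_rect a b c d : closed (rect a b c d).
Proof.
rewrite rectE (_ : _ `*` _ = (fst @^-1` `[a, b]) `&` (snd @^-1` `[c, d])) //.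
apply: closedI; apply: closed_comp => [k _|]; try exact: itv_closed.
  exact: cvg_fst.
exact: cvg_snd.
Qed.

Lemma connected_vertical b c d : connected (rect b b c d).
Proof.
have [cd|dc] := leP c d; last first.
  rewrite (_ : rect b b c d = set0); first exact: connected0.
  apply/seteqP; split=> // -[s t] [_ /= /andP[ct td]].
  by have := le_trans ct td; rewrite leNgt dc.
rewrite (_ : rect b b c d = (fun t : R => (b, t)) @` `[c, d]).
  apply: (connected_continuous_connected (@segment_connected R c d)).
  apply: continuous_subspaceT => t.
  exact: (cvg_pair (cvg_cst b) cvg_id).
apply/seteqP; split=> [[s t] [/= /andP[bs sb] td]|_ [t td <-]].
  by exists t; rewrite ?in_itv //; congr pair; apply/eqP; rewrite eq_le bs sb.
by rewrite /rect /= !lexx; split=> //; move: td; rewrite /= in_itv.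
Qed.

Lemma connected_horizontal a b c : connected (rect a b c c).
Proof.
have [ab|ba] := leP a b; last first.
  rewrite (_ : rect a b c c = set0); first exact: connected0.
  apply/seteqP; split=> // -[s t] [/= /andP[ct td] _].
  by have := le_trans ct td; rewrite leNgt ba.
rewrite (_ : rect a b c c = (fun s : R => (s, c)) @` `[a, b]).
  apply: (connected_continuous_connected (@segment_connected R a b)).
  apply: continuous_subspaceT => t.
  exact: (cvg_pair cvg_id (cvg_cst c)).
apply/seteqP; split=> [[s t] [/= td /andP[bs sb]]|_ [t td <-]].
  by exists s; rewrite ?in_itv //; congr pair; apply/eqP; rewrite eq_le bs sb.
by rewrite /rect /= !lexx; split=> //; move: td; rewrite /= in_itv.
Qed.

Definition liftable H a b c d := forall v, exists g : R * R -> V,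
  g (a, c) = v /\ forall k, rect a b c d k -> hor (rect a b c d) H g k.

(** The second lift is started at k2 with the value reached by the first. Since the overlap is
    connected, this single value makes the two lifts agree on all of it. *)
Lemma glue_liftable H (S1 S2 : set (R * R)) k1 k2 g1 :
  closed S1 -> closed S2 -> connected (S1 `&` S2) -> {within S1 `|` S2, continuous H} ->
  S1 k1 -> S1 k2 -> S2 k2 ->
  (forall k, S1 k -> hor S1 H g1 k) ->
  (forall v, exists g : R * R -> V, g k2 = v /\ forall k, S2 k -> hor S2 H g k) ->
  exists g : R * R -> V, g k1 = g1 k1 /\
    forall k, (S1 `|` S2) k -> hor (S1 `|` S2) H g k.
Proof.
move=> c1 c2 cI cH S11 S12 S22 h1 L2; have [g2 [e2 h2]] := L2 (g1 k2).
exists (fun k => if `[< S1 k >] then g1 k else g2 k); split; first by rewrite asboolT.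
apply: hor_glue => // k S1k S2k.
apply: (hor_unique (S := S1 `&` S2) (H := H) (k0 := k2)) => //.
- by apply: continuous_subspaceW cH => x [S1x _]; left.
- by move=> x [S1x _]; apply: hor_sub (h1 x S1x) => ? [].
- by move=> x [_ S2x]; apply: hor_sub (h2 x S2x) => ? [].
Qed.

Lemma liftable_glue1 H a b e c d : a <= b -> b <= e -> c <= d ->
  {within rect a e c d, continuous H} ->
  liftable H a b c d -> liftable H b e c d -> liftable H a e c d.
Proof.
move=> ab be cd cH L1 L2 v.
have U : rect a e c d = rect a b c d `|` rect b e c d.
  apply/seteqP; split=> [[s t] [/= /andP[h1 h2] h3]|[s t] [[/= /andP[h1 h2] h3]|[/= /andP[h1 h2] h3]]].
  - case/orP: (le_total s b) => h; [left|right]; split=> //=; exact/andP.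
  - by split=> //=; rewrite h1 (le_trans h2).
  - by split=> //=; rewrite h2 (le_trans ab).
have I : rect a b c d `&` rect b e c d = rect b b c d.
  apply/seteqP; split=> [[s t] [[/= /andP[h1 h2] h3] [/= /andP[h4 _] _]]|].
    by split=> //=; rewrite h4 h2.
  move=> [s t] [/= /andP[h1 h2] h3]; split; split=> //=.
    by rewrite h2 (le_trans ab).
  by rewrite h1 (le_trans h2).
have [g1 [<- h1]] := L1 v; rewrite U.
apply: (@glue_liftable H _ _ (a, c) (b, c)) => //.
- exact: closed_rect.
- exact: closed_rect.
- rewrite I; exact: connected_vertical.
- by rewrite -U.
- by split; rewrite /= !lexx.
- by split; rewrite /= ?ab !lexx.
- by split; rewrite /= ?be !lexx.
Qed.

Lemma liftable_glue2 H a b c d e : a <= b -> c <= d -> d <= e ->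
  {within rect a b c e, continuous H} ->
  liftable H a b c d -> liftable H a b d e -> liftable H a b c e.
Proof.
move=> ab cd de cH L1 L2 v.
have U : rect a b c e = rect a b c d `|` rect a b d e.
  apply/seteqP; split=> [[s t] [/= h3 /andP[h1 h2]]|[s t] [[/= h3 /andP[h1 h2]]|[/= h3 /andP[h1 h2]]]].
  - case/orP: (le_total t d) => h; [left|right]; split=> //=; exact/andP.
  - by split=> //=; rewrite h1 (le_trans h2).
  - by split=> //=; rewrite h2 (le_trans cd).
have I : rect a b c d `&` rect a b d e = rect a b d d.
  apply/seteqP; split=> [[s t] [[/= h3 /andP[h1 h2]] [/= _ /andP[h4 _]]]|].
    by split=> //=; rewrite h4 h2.
  move=> [s t] [/= h3 /andP[h1 h2]]; split; split=> //=.
    by rewrite h2 (le_trans cd).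
  by rewrite h1 (le_trans h2).
have [g1 [<- h1]] := L1 v; rewrite U.
apply: (@glue_liftable H _ _ (a, c) (a, d)) => //.
- exact: closed_rect.
- exact: closed_rect.
- rewrite I; exact: connected_horizontal.
- by rewrite -U.
- by split; rewrite /= ?lexx ?ab.
- by split; rewrite /= ?lexx ?ab ?cd.
- by split; rewrite /= ?lexx ?ab ?de.
Qed.

Lemma rect_sub a b c d : 0 <= a -> b <= 1 -> 0 <= c -> d <= 1 ->
  rect a b c d `<=` rect 0 1 0 1.
Proof.
move=> a0 b1 c0 d1 [s t] [/= /andP[h1 h2] /andP[h3 h4]]; split; apply/andP; split => /=.
- exact: le_trans h1.
- exact: le_trans b1.
- exact: le_trans h3.
- exact: le_trans d1.
Qed.

(** Cousin's lemma is applied twice: in the second variable it leaves thin horizontal strips around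
    a height t, and in the first it leaves small rectangles around (s, t), mapped into one
    trivializing set. The admissible height of the strip is quantified inside [P], so that gluing
    side by side merely takes the smaller of two heights. *)
Lemma square_lift H : {within rect 0 1 0 1, continuous H} -> liftable H 0 1 0 1.
Proof.
move=> cH.
have cS a b c d : 0 <= a -> b <= 1 -> 0 <= c -> d <= 1 -> {within rect a b c d, continuous H}.
  by move=> a0 b1 c0 d1; apply: continuous_subspaceW cH; exact: rect_sub.
apply: (cousin (P := fun c d => c <= d -> liftable H 0 1 c d)) => //.
  move=> c d e c0 cd de e1 L1 L2 _.
  by apply: (@liftable_glue2 H 0 1 c d e) => //; [exact: cS|exact: L1|exact: L2].
move=> t /andP[t0 t1].
pose P a b := exists2 e, 0 < e & forall c d, 0 <= c -> d <= 1 -> c <= t <= d ->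
  t - e < c -> d < t + e -> liftable H a b c d.
have [e e0 He] : P 0 1; last by exists e => // c d c0 d1 ctd c' d' _; exact: He.
apply: cousin => [a b c a0 ab bc c1 [e1 e10 H1] [e2 e20 H2]|s /andP[s0 s1]].
  exists (Num.min e1 e2); first by rewrite lt_min e10.
  move=> c' d c0 d1 /andP[ct td] h1 h2.
  have m1 : Num.min e1 e2 <= e1 by rewrite ge_min lexx.
  have m2 : Num.min e1 e2 <= e2 by rewrite ge_min lexx orbT.
  apply: (@liftable_glue1 H a b c c' d) => //.
  - exact: le_trans ct td.
  - exact: cS.
  - by apply: H1; rewrite ?ct //; lra.
  - by apply: H2; rewrite ?ct //; lra.
have Sst : rect 0 1 0 1 (s, t) by rewrite /rect /= s0 s1 t0 t1.
have := within_near cH Sst (open_nbhs_nbhs (conj (D_open (H (s, t))) (D_in (H (s, t))))).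
move=> /nbhs_ballP[e /= e0 He]; exists e => // a b a0 b1 /andP[as_ sb] ha hb.
exists e => // c d c0 d1 /andP[ct td] hc hd v.
have sub : rect a b c d `<=` rect 0 1 0 1 by exact: rect_sub.
have DR k : rect a b c d k -> D (H (s, t)) (H k).
  move=> Sk; apply: He (sub _ Sk); case: Sk => /andP[h1 h2] /andP[h3 h4].
  by split; rewrite /ball /= ltr_norml; apply/andP; split; lra.
exists (fun k => G (H (s, t)) (H k) (E (H (s, t)) (H (a, c)) v)); split.
  by rewrite GK //; apply: DR; split; rewrite /= ?lexx ?(le_trans as_) ?(le_trans ct).
by apply: local_lift => //; exact: cS.
Qed.

End Square.

(** * Parallel transport along paths and its independence of the path *)

Section Transport.
Context {R : realType}.
Local Notation I := [set` (`[0, 1]%R : interval R)].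
Local Notation horI := (hor I).

Definition transport (p : T) (v : V) (q : T) (w : V) :=
  exists (gamma : R -> T) (g : R -> V),
    [/\ {within I, continuous gamma}, forall s, I s -> horI gamma g s,
        gamma 0 = p /\ gamma 1 = q & g 0 = v /\ g 1 = w].

Let I0 : I 0. Proof. by rewrite /= in_itv /= lexx ler01. Qed.
Let I1 : I 1. Proof. by rewrite /= in_itv /= lexx ler01. Qed.

Lemma affine_within (S : set R) (u w : R) : {within S, continuous (fun s : R => u * s + w)}.
Proof.
apply: continuous_subspaceT => s; apply: cvgD; last exact: cvg_cst.
by apply: cvgM; [exact: cvg_cst|exact: cvg_id].
Qed.

(** A path is a square that is constant in the second variable: lift the square and restrict to its
    bottom edge. *)
Lemma path_lift (gamma : R -> T) v : {within I, continuous gamma} ->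
  exists g : R -> V, g 0 = v /\ forall s, I s -> horI gamma g s.
Proof.
move=> cg; have c1 : {within rect 0 1 0 1, continuous (fun k : R * R => gamma k.1)}.
  apply/subspace_continuousP => k Sk P nP.
  have k1 : I k.1 by case: Sk => + _; rewrite /= in_itv.
  have f1 : {within rect 0 1 0 1, continuous (@fst R R)}.
    by apply: continuous_subspaceT => x; exact: cvg_fst.
  have := within_near f1 Sk (within_near cg k1 nP).
  apply: filterS => k' h Sk'; apply: h => //.
  by case: Sk' => + _; rewrite /= in_itv.
have [g [g0 hg]] := square_lift c1 v.
pose j (s : R) : R * R := (s, 0).
have cj : {within I, continuous j}.
  by apply: continuous_subspaceT => t; exact: (cvg_pair cvg_id (cvg_cst 0)).
have jS s : I s -> rect 0 1 0 1 (j s).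
  by rewrite /= in_itv /rect /= => ->; rewrite lexx ler01.
exists (g \o j); split=> // s Is.
exact: (hor_comp cj jS Is (hg (j s) (jS s Is))).
Qed.

Lemma transport_sym p v q w : transport p v q w -> transport q w p v.
Proof.
move=> [gamma [g [cg hg [e1 e2] [e3 e4]]]].
pose j (s : R) := -1 * s + 1.
have jI s : I s -> I (j s).
  by rewrite /= !in_itv /= /j => /andP[h1 h2]; apply/andP; split; lra.
have j0 : j 0 = 1 by rewrite /j mulr0 add0r.
have j1 : j 1 = 0 by rewrite /j mulr1 addrC subrr.
have cj : {within I, continuous j} by exact: affine_within.
exists (gamma \o j), (g \o j); split; rewrite /= ?j0 ?j1 //.
  apply/subspace_continuousP => s Is P nP.
  have := within_near cj Is (within_near cg (jI s Is) nP).
  by apply: filterS => t h It; apply: h => //; exact: jI.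
by move=> s Is; exact: (hor_comp cj jI Is (hg _ (jI s Is))).
Qed.

Lemma transport_trans p v q w r u :
  transport p v q w -> transport q w r u -> transport p v r u.
Proof.
move=> [gamma1 [g1 [c1 h1 [p1 q1] [v1 w1]]]] [gamma2 [g2 [c2 h2 [p2 q2] [v2 w2]]]].
(* The summand 0 keeps [j1] in the shape u * s + w required by [affine_within]. *)
pose j1 (s : R) := 2 * s + 0; pose j2 (s : R) := 2 * s + (- 1).
pose S1 : set R := [set` `[0, 2^-1]%R]; pose S2 : set R := [set` `[2^-1, 1]%R].
have j1I s : S1 s -> I (j1 s).
  by rewrite /S1 /= !in_itv /= /j1 => /andP[a1 a2]; apply/andP; split; lra.
have j2I s : S2 s -> I (j2 s).
  by rewrite /S2 /= !in_itv /= /j2 => /andP[a1 a2]; apply/andP; split; lra.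
have IU : I = S1 `|` S2.
  apply/seteqP; split=> s; rewrite /S1 /S2 /= !in_itv /=.
    move=> /andP[a1 a2]; case/orP: (le_total s 2^-1) => a3; [left|right]; exact/andP.
  by move=> [] /andP[a1 a2]; apply/andP; split; lra.
have S12 s : S1 s -> S2 s -> s = 2^-1.
  rewrite /S1 /S2 /= !in_itv /= => /andP[_ a1] /andP[a2 _].
  by apply/eqP; rewrite eq_le a1 a2.
have cj1 : {within S1, continuous j1} by exact: affine_within.
have cj2 : {within S2, continuous j2} by exact: affine_within.
have half1 : j1 2^-1 = 1 by rewrite /j1 addr0 mulfV.
have half2 : j2 2^-1 = 0 by rewrite /j2 mulfV // subrr.
pose gamma s := if `[< S1 s >] then gamma1 (j1 s) else gamma2 (j2 s).
pose g s := if `[< S1 s >] then g1 (j1 s) else g2 (j2 s).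
have gE1 s : S1 s -> gamma s = gamma1 (j1 s) by move=> Ss; rewrite /gamma asboolT.
have gE2 s : S2 s -> gamma s = gamma2 (j2 s).
  move=> Ss; rewrite /gamma; case: asboolP => // S1s.
  by rewrite (S12 s S1s Ss) half1 half2 q1.
have S1c : closed S1 by exact: itv_closed.
have S2c : closed S2 by exact: itv_closed.
have cpiece (S : set R) jS (gi : R -> T) : {within S, continuous jS} ->
    (forall s, S s -> I (jS s)) -> {within I, continuous gi} ->
    (forall s, S s -> gamma s = gi (jS s)) -> {within S, continuous gamma}.
  move=> cj jI ci gE; apply/subspace_continuousP => s Ss P nP.
  have {}nP : nbhs (gi (jS s)) P by rewrite -gE.
  have := within_near cj Ss (within_near ci (jI s Ss) nP).
  apply: filterS => t h St; have := h St (jI t St).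
  by change (P (gi (jS t)) -> P (gamma t)); rewrite gE.
have cgamma : {within S1 `|` S2, continuous gamma}.
  apply: withinU_continuous => //.
    exact: (cpiece S1 j1 gamma1).
  exact: (cpiece S2 j2 gamma2).
rewrite -IU in cgamma.
have S10 : S1 0 by rewrite /S1 /= in_itv /=; apply/andP; split; lra.
have S11 : ~ S1 1 by rewrite /S1 /= in_itv /= => /andP[_]; lra.
exists gamma, g; split=> //.
- rewrite {1}IU => s Ss; rewrite IU.
  apply: (hor_glue (g1 := g1 \o j1) (g2 := g2 \o j2)) => // k Sk.
  + apply: (@hor_ext _ S1 (gamma1 \o j1) gamma (g1 \o j1)) => //.
      by move=> x /set_mem Sx /=; rewrite gE1.
    exact: (hor_comp cj1 j1I Sk (h1 _ (j1I k Sk))).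
  + apply: (@hor_ext _ S2 (gamma2 \o j2) gamma (g2 \o j2)) => //.
      by move=> x /set_mem Sx /=; rewrite gE2.
    exact: (hor_comp cj2 j2I Sk (h2 _ (j2I k Sk))).
  + by move=> Sk2 /=; rewrite (S12 k Sk Sk2) half1 half2 w1 v2.
- rewrite /gamma asboolT // asboolF // /j1 /j2 mulr0 addr0 mulr1.
  by rewrite (_ : 2 - 1 = 1) ?p1 ?q2 //; lra.
- rewrite /g asboolT // asboolF // /j1 /j2 mulr0 addr0 mulr1.
  by rewrite (_ : 2 - 1 = 1) ?v1 ?w2 //; lra.
Qed.

(** The lift of a null-homotopy restricts to the given lift on the bottom edge, by uniqueness. The
    other three edges are mapped to the base point, so the lift is constant along them, and going
    round by left, top and right joins the two ends of the bottom edge. *)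
Lemma transport_loop p v w : simply_connected R T -> transport p v p w -> w = v.
Proof.
move=> [_ sc] [gamma [g [cg hg [e1 e2] [e3 e4]]]].
have [H [cH H0 H1 Hs]] := sc gamma cg (etrans e1 (esym e2)).
have cH' : {within rect 0 1 0 1, continuous H} by rewrite rectE.
have [G' [G0 hG]] := square_lift cH' v.
have cI : connected I by exact: segment_connected.
have edge (j : R -> R * R) : {within I, continuous j} -> (forall s, I s -> rect 0 1 0 1 (j s)) ->
    (forall s, I s -> horI (H \o j) (G' \o j) s) /\ {within I, continuous (H \o j)}.
  move=> cj jS; split=> [s Is|].
    exact: (hor_comp cj jS Is (hG _ (jS s Is))).
  apply/subspace_continuousP => s Is P nP.
  have := within_near cj Is (within_near cH' (jS s Is) nP).
  by apply: filterS => t h It; apply: h => //; exact: jS.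
have cst_edge (j : R -> R * R) : {within I, continuous j} ->
    (forall s, I s -> rect 0 1 0 1 (j s)) -> (forall s, I s -> H (j s) = p) ->
    G' (j 1) = G' (j 0).
  move=> cj jS jp; have [hj cHj] := edge j cj jS.
  apply: (@hor_unique _ I (H \o j) (G' \o j) (fun=> G' (j 0)) 0) => // s Is.
  apply: (@hor_ext _ I (fun=> p) _ (fun=> G' (j 0))) => //; last exact: hor_cst.
  by move=> t /set_mem It; rewrite /= jp.
have cx (t : R) : {within I, continuous (fun s : R => (s, t))}.
  by apply: continuous_subspaceT => s; exact: (cvg_pair cvg_id (cvg_cst t)).
have cy (t : R) : {within I, continuous (fun s : R => (t, s))}.
  by apply: continuous_subspaceT => s; exact: (cvg_pair (cvg_cst t) cvg_id).
have Sx t : I t -> forall s, I s -> rect 0 1 0 1 (s, t).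
  by rewrite /= in_itv => It s; rewrite in_itv.
have Sy t : I t -> forall s, I s -> rect 0 1 0 1 (t, s).
  by rewrite /= in_itv => It s; rewrite in_itv.
have bottom : G' (1, 0) = w.
  rewrite -e4; have [hj cHj] := edge _ (cx 0) (Sx 0 I0).
  apply: (@hor_unique _ I _ (fun s => G' (s, 0)) g 0 cI cHj hj) => //; last by rewrite G0.
  move=> s Is; apply: (@hor_ext _ I gamma _ g) => //; last exact: hg.
  by move=> t /set_mem It; rewrite /= H0 //; move: It; rewrite /= in_itv.
have left : G' (0, 1) = v.
  rewrite -G0; apply: (cst_edge (fun t => (0, t)) (cy 0) (Sy 0 I0)) => t It.
  by have [-> _] := Hs t It; rewrite e1.
have right : G' (1, 1) = G' (1, 0).
  apply: (cst_edge (fun t => (1, t)) (cy 1) (Sy 1 I1)) => t It.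
  by have [_ ->] := Hs t It; rewrite e1.
rewrite -bottom -right -left.
apply: (cst_edge (fun s => (s, 1)) (cx 1) (Sx 1 I1)) => s Is.
by rewrite H1.
Qed.

(** The section is defined by transport from p0 along arbitrary paths. Near p it is compared with
    the local lift along a path that stays in [D p]: the two values at r are joined by a loop at r
    passing through p0, hence equal. *)
Theorem monodromy : simply_connected R T ->
  (forall p, \forall r \near p, exists gamma : R -> T,
    [/\ {within I, continuous gamma}, gamma 0 = p, gamma 1 = r &
        forall s, I s -> D p (gamma s)]) ->
  forall p0 v0, exists f : T -> V, f p0 = v0 /\
    forall p, \forall r \near p, f r = G p r (E p p (f p)).
Proof.
move=> sc loc p0 v0; have [pc _] := sc.
have ex p : exists w, transport p0 v0 p w.
  have [gamma [cg g0 g1]] := pc p0 p; have [g [e0 hg]] := path_lift v0 cg.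
  by exists (g 1), gamma, g.
have [f Hf] := choice ex.
exists f; split.
  exact: transport_loop sc (Hf p0).
move=> p; have := loc p; apply: filterS => r [gamma [cg g0 g1 gD]].
have Tr : transport p (f p) r (G p r (E p p (f p))).
  exists gamma, (fun s => G p (gamma s) (E p p (f p))); split=> //.
    exact: local_lift.
  by rewrite g0 g1 GK.
have := transport_trans (Hf p) Tr; move/(transport_trans (transport_sym (Hf r))).
by move/(transport_loop sc) => ->.
Qed.

End Transport.

End HorizontalLifts.

(** * Charts of a Riemann surface *)

Lemma near_comp (K T : topologicalType) (H : K -> T) k (P : set T) :
  {for k, continuous H} -> (\forall r \near H k, P r) -> \forall k' \near k, P (H k').
Proof. by move=> cH nP; have := cH _ nP. Qed.

Section ComplexPlane.
Context {R : realType}.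
Notation C := (R[i]^o).
Notation R2 := (R^o * R^o)%type.

Definition cplx (q : R2) : C := q.1 +i* q.2.
Definition uncplx (z : C) : R2 := (complex.Re z, complex.Im z).

Lemma cplxK : cancel cplx uncplx. Proof. by case. Qed.
Lemma uncplxK : cancel uncplx cplx. Proof. by case. Qed.

Lemma norm_complexE (z : C) :
  `|z| = (Num.sqrt ((complex.Re z) ^+ 2 + (complex.Im z) ^+ 2))%:C.
Proof. exact: normc_def. Qed.

Lemma norm_uncplx_le (z : C) : `|uncplx z|%:C <= `|z|.
Proof.
rewrite norm_complexE lecR prod_normE ge_max /= -!sqrtr_sqr.
by apply/andP; split; apply: ler_wsqrtr; rewrite ?lerDl ?lerDr sqr_ge0.
Qed.

Lemma norm_cplx_le (q : R2) : `|cplx q| <= (2 * `|q|)%:C.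
Proof.
rewrite norm_complexE lecR; have M_ge0 := normr_ge0 q; set M := `|q| in M_ge0 *.
have M0 : 0 <= 2 * M by rewrite mulr_ge0.
rewrite -(ger0_norm M0) -sqrtr_sqr ler_wsqrtr //=.
have h1 : `|q.1| <= M by rewrite /M prod_normE le_max lexx.
have h2 : `|q.2| <= M by rewrite /M prod_normE le_max lexx orbT.
have k1 : q.1 ^+ 2 <= M ^+ 2 by rewrite -[q.1 ^+ 2]real_normK ?num_real ?lerXn2r ?nnegrE.
have k2 : q.2 ^+ 2 <= M ^+ 2 by rewrite -[q.2 ^+ 2]real_normK ?num_real ?lerXn2r ?nnegrE.
rewrite exprMn; have := sqr_ge0 M; lra.
Qed.

Lemma gt0_complex (e : R[i]) : 0 < e -> exists2 r, 0 < r & e = r%:C.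
Proof.
case: e => a b; rewrite ltcE /= => /andP[/eqP -> a0]; by exists a.
Qed.

Lemma cplxB (p q : R2) : cplx p - cplx q = cplx (p - q).
Proof. by case: p; case: q. Qed.

Lemma uncplxB (p q : C) : uncplx p - uncplx q = uncplx (p - q).
Proof. by case: p; case: q. Qed.

Lemma cplx_continuous : continuous cplx.
Proof.
move=> q; apply/cvgrPdist_lt => _ /gt0_complex[e e0 ->].
have e2 : 0 < e / 2 by rewrite divr_gt0.
have : \forall p \near q, `|q - p| < e / 2.
  by have /cvgrPdist_lt := @cvg_id _ (nbhs q); exact.
apply: filterS => p qp; rewrite cplxB.
apply: le_lt_trans (norm_cplx_le _) _; rewrite ltcR; lra.
Qed.

Lemma uncplx_continuous : continuous uncplx.
Proof.
move=> z; apply: (proj2 (@cvgrPdist_lt _ _ _ _ (nbhs_filter z) uncplx (uncplx z))) => e e0.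
apply/nbhs_ballP; exists e%:C; first by rewrite /= ltcR.
move=> w; rewrite -ball_normE /= => zw.
rewrite uncplxB -ltcR; exact: le_lt_trans (norm_uncplx_le _) zw.
Qed.

Lemma complex_derivable_eps (f : C -> C) z : derivable f z 1 ->
  forall e : R, 0 < e -> \forall h \near (0 : C), `|f (h + z) - f z - h * 'D_1 f z| <= e%:C * `|h|.
Proof.
move=> /derivable_nbhsP /eqaddoP H e e0.
have := H e%:C (ltac:(by rewrite ltcR)); apply: filterS => h.
by rewrite !fctE /= opprD addrA /GRing.scale /= mulr1.
Qed.

Lemma is_diff_of_complex (f : C -> C) (q : R2) : derivable f (cplx q) 1 ->
  let D := 'D_1 f (cplx q) in
  is_diff q (fun p : R2 => uncplx (f (cplx p)))
    (lin2 (uncplx D) ((- complex.Im D, complex.Re D) : R2)).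
Proof.
move=> df D; apply: is_diff_eps; first exact: lin2_continuous.
(* The factor 1/2 compensates the constant 2 of [norm_cplx_le], since the plane carries the maximum
   norm and the complex line the modulus. *)
move=> e e0; have e2 : 0 < e / 2 by rewrite divr_gt0.
have := near_comp (@cplx_continuous 0) (complex_derivable_eps df e2); apply: filterS => h /=.
have -> : cplx h + cplx q = cplx (h + q) by case: h; case: (q).
have e2c : 0 <= (e / 2)%:C :> R[i] by rewrite ler0c ltW.
move=> H; have := le_trans (norm_uncplx_le _) (le_trans H (ler_wpM2l e2c (norm_cplx_le h))).
rewrite -rmorphM /= lecR mulrA divfK // => {}H.
have -> : uncplx (f (cplx (h + q))) - uncplx (f (cplx q)) -
   lin2 (uncplx D) ((- complex.Im D, complex.Re D) : R2) h =
   uncplx (f (cplx (h + q)) - f (cplx q) - cplx h * D).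
  rewrite uncplxB; apply: etrans (uncplxB _ (cplx h * D)); congr (_ - _).
  by case: h {H} => h1 h2; rewrite /lin2 /cplx /uncplx /=; case: (D) => d1 d2 /=;
    congr pair; rewrite /= /GRing.scale /=; ring.
exact: H.
Qed.

Lemma complex_of_diff (a b : R2 -> R^o) (q : R2) :
  differentiable a q -> differentiable b q ->
  'D_(1, 0) a q = 'D_(0, 1) b q -> 'D_(0, 1) a q = - 'D_(1, 0) b q ->
  let f := (fun z : C => a (uncplx z) +i* b (uncplx z)) : C -> C in
  derivable f (cplx q) 1 /\ 'D_1 f (cplx q) = 'D_(1, 0) a q +i* 'D_(1, 0) b q.
Proof.
move=> da db cr1 cr2 f.
set D : C := _ +i* _.
have E (e : R) : 0 < e ->
    \forall h \near (0 : C), `|f (h + cplx q) - f (cplx q) - h * D| <= e%:C * `|h|.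
  move=> e0.
  have e2 : 0 < e / 2 by rewrite divr_gt0.
  have na := differentiable_eps da e2; have nb := differentiable_eps db e2.
  have : \forall h \near (0 : R2), `|a (h + q) - a q - 'd a q h| <= e / 2 * `|h| /\
      `|b (h + q) - b q - 'd b q h| <= e / 2 * `|h|.
    by move: na nb; apply: filterS2 => h h1 h2; split; [exact: h1|exact: h2].
  move=> H; have := near_comp (@uncplx_continuous 0) H; apply: filterS => h [/= Ha Hb].
  have dlin (g : R2 -> R^o) : differentiable g q ->
      'd g q (uncplx h) = complex.Re h * 'D_(1, 0) g q + complex.Im h * 'D_(0, 1) g q.
    move=> dg; rewrite !deriveE //.
    have -> : uncplx h = complex.Re h *: ((1, 0) : R2) + complex.Im h *: ((0, 1) : R2).
      by rewrite /uncplx; congr pair; rewrite /= /GRing.scale /= ?mulr1 ?mulr0 ?addr0 ?add0r.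
    by rewrite linearD !linearZ.
  rewrite dlin // in Ha; rewrite dlin // in Hb.
  have -> : f (h + cplx q) - f (cplx q) - h * D =
    cplx (a (uncplx h + q) - a q - (complex.Re h * 'D_(1, 0) a q + complex.Im h * 'D_(0, 1) a q),
          b (uncplx h + q) - b q - (complex.Re h * 'D_(1, 0) b q + complex.Im h * 'D_(0, 1) b q)).
    rewrite /f /D cplxK; have -> : uncplx (h + cplx q) = uncplx h + q.
      by case: (h); case: (q).
    rewrite cr2 -cr1; case: (h) => h1 h2; rewrite /cplx /=.
    by congr (_ +i* _); ring.
  apply: le_trans (norm_cplx_le _) _.
  apply: le_trans (ler_wpM2l _ (norm_uncplx_le h)); last by rewrite ler0c ltW.
  rewrite -rmorphM lecR prod_normE /=.
  have : Num.max `|a (uncplx h + q) - a q - (complex.Re h * 'D_(1, 0) a q + complex.Im h * 'D_(0, 1) a q)|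
     `|b (uncplx h + q) - b q - (complex.Re h * 'D_(1, 0) b q + complex.Im h * 'D_(0, 1) b q)|
     <= e / 2 * `|uncplx h| by rewrite ge_max Ha Hb.
  set M := Num.max _ _ => HM.
  by apply: le_trans (ler_wpM2l (ler0n _ 2) HM) _; rewrite mulrA mulrCA mulfV // mulr1.
have cvD : (fun h : C => h^-1 *: ((f \o shift (cplx q)) (h *: (1 : C)) - f (cplx q))) @ 0^' --> D.
  apply/cvgrPdist_le => _ /gt0_complex[e e0 ->].
  have He := E e e0.
  have h0 : \forall h \near (0 : C)^', h != 0 by exact: nbhs_dnbhs_neq.
  near=> h.
  have hn : h != 0 by near: h.
  have Hh : `|f (h + cplx q) - f (cplx q) - h * D| <= e%:C * `|h|.
    by near: h; move: He; exact: nbhs_dnbhs.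
  rewrite [h *: 1]mulr1 /= -[D in X in X <= _](mulKf hn) -mulrBr normrM normfV.
  by rewrite ler_pdivrMl ?normr_gt0 // distrC [X in _ <= X]mulrC.
split; first by apply/cvg_ex; exists D.
exact: cvg_lim cvD.
Unshelve. all: by end_near. Qed.
End ComplexPlane.

Section Charts.
Context {R : realType} {T : topologicalType}.
Notation C := (R[i]^o).
Notation R2 := (R^o * R^o)%type.
Implicit Types c : chart R T.

Notation crangeR c := [set q : R2 | crange c (q.1 +i* q.2)].

Section OneChart.
Variables (c : chart R T) (hc : chart_axioms c).

Lemma open_crangeR : open (crangeR c).
Proof.
have oc := crange_open hc.
by apply: open_comp oc => q _; exact: cplx_continuous.
Qed.

Lemma cmapK_at p : cdom c p -> cinv c (cmap c p) = p.
Proof. by move=> cp; apply: (cmapK hc); exact: mem_set. Qed.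

Lemma pt_crange p : cdom c p -> crangeR c (pt c p).
Proof. by move=> cp; exists p => //; rewrite /pt /=; case: (cmap c p). Qed.

Lemma cplx_pt p : cplx (pt c p) = cmap c p.
Proof. exact: uncplxK. Qed.

Lemma crangeR_pt q : crangeR c q -> exists2 p, cdom c p & q = pt c p.
Proof. by case=> p cp e; exists p => //; rewrite -[LHS]cplxK /cplx -e. Qed.

Lemma loc_pt (V : Type) (f : T -> V) p : cdom c p -> f (cinv c (cplx (pt c p))) = f p.
Proof. by move=> cp; rewrite cplx_pt cmapK_at. Qed.

Lemma pt_continuous p : cdom c p -> {for p, continuous (pt c)}.
Proof.
move=> cp; have cc := cmap_continuous hc (mem_set cp).
exact: (continuous_comp cc (@uncplx_continuous _ (cmap c p))).
Qed.

Lemma cinv_cplx_continuous q : crangeR c q ->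
  {for q, continuous (fun q : R2 => cinv c (cplx q))}.
Proof.
move=> cq; have cc := cinv_continuous hc (mem_set cq).
exact: (continuous_comp (@cplx_continuous _ q) cc).
Qed.

Lemma near_pt p (P : set T) : cdom c p -> (\forall s \near p, P s) ->
  \forall q \near pt c p, P (cinv c (cplx q)).
Proof.
move=> cp nP; apply: near_comp; first exact/cinv_cplx_continuous/pt_crange.
by rewrite cplx_pt cmapK_at.
Qed.

Lemma near_cdom p : cdom c p -> \forall s \near p, cdom c s.
Proof. by move=> cp; apply: open_nbhs_nbhs; split => //; exact: cdom_open. Qed.

End OneChart.

(* [r + i s] is the derivative at p of the change of charts. *)
Definition jac c1 c2 p (r s : R) := forall (V : normedModType R) (f : T -> V),
  differentiable (loc c2 f) (pt c2 p) ->
  [/\ differentiable (loc c1 f) (pt c1 p),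
      dx c1 f p = r *: dx c2 f p + s *: dy c2 f p &
      dy c1 f p = - s *: dx c2 f p + r *: dy c2 f p].

(** Near p the function read in c1 is the function read in c2 composed with the transition map,
    whose real differential is multiplication by a complex number. The pair (r, s) is fixed before
    the function, so the same pair transforms all the data at p. *)
Lemma chain_rule c1 c2 p : chart_axioms c1 -> chart_axioms c2 ->
  cdom c1 p -> cdom c2 p ->
  derivable (cmap c2 \o cinv c1 : C -> C) (cmap c1 p : C) (1 : C) ->
  exists r s, jac c1 c2 p r s.
Proof.
move=> h1 h2 p1 p2; rewrite -cplx_pt => /is_diff_of_complex.
set D := 'D_(1 : C) _ _; set tau := (fun q : R2 => _) => Dtau.
exists (complex.Re D), (complex.Im D) => V f df.
have tau_p : tau (pt c1 p) = pt c2 p by rewrite /tau /= cplx_pt cmapK_at.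
have E : \forall q \near pt c1 p, (loc c2 f \o tau) q = loc c1 f q.
  have := near_pt h1 p1 (near_cdom h2 p2); apply: filterS => q cq.
  by rewrite /= /loc /tau; congr f; rewrite [_ +i* _]uncplxK /= cmapK_at.
have d2 : differentiable (loc c2 f) (tau (pt c1 p)) by rewrite tau_p.
have dtau : differentiable tau (pt c1 p) by exact: ex_diff.
have dc : differentiable (loc c2 f \o tau) (pt c1 p) by exact: differentiable_comp.
have [d1 dE] := near_eq_is_diff E dc.
have dv v : 'd (loc c1 f) (pt c1 p) v =
    'd (loc c2 f) (pt c2 p) (lin2 (uncplx D) ((- complex.Im D, complex.Re D) : R2) v).
  have tau_v := congr1 (@^~ v) (@diff_val _ _ _ _ _ _ _ Dtau).
  apply: etrans (congr1 (@^~ v) dE) _.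
  apply: etrans (congr1 (@^~ v) (diff_comp dtau d2)) _.
  by rewrite -tau_p -tau_v.
have lin (u w : R) : 'd (loc c2 f) (pt c2 p) ((u, w) : R2) = u *: dx c2 f p + w *: dy c2 f p.
  rewrite /dx /dy !(deriveE _ df).
  have -> : ((u, w) : R2) = u *: ((1, 0) : R2) + w *: ((0, 1) : R2).
    by congr pair; rewrite /= /GRing.scale /= ?mulr1 ?mulr0 ?addr0 ?add0r.
  by rewrite linearD !linearZ.
split=> //.
  apply: etrans (deriveE _ d1) _; apply: etrans (dv _) _.
  rewrite lin2_10; exact: lin.
apply: etrans (deriveE _ d1) _; apply: etrans (dv _) _.
rewrite lin2_01; exact: lin.
Qed.

End Charts.

Lemma unitmx_near {R : realType} (V : topologicalType) n (F : V -> 'M[R]_n) q0 :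
  {for q0, continuous F} -> F q0 = 1%:M -> \forall q \near q0, F q \in unitmx.
Proof.
move=> cF F1.
have cij i j : {for q0, continuous (fun q => F q i j : R)}.
  exact: (continuous_comp cF (@coord_continuous _ _ _ i j _)).
have cdet : {for q0, continuous (fun q => \det (F q) : R)}.
  apply: cvg_big => [|s _]; first exact: add_continuous.
  apply: cvgM; first exact: cvg_cst.
  apply: cvg_big => [|i _]; first exact: mul_continuous.
  exact: cij.
have : \det (F q) @[q --> q0] --> (\det (F q0) : R) by exact: cdet.
rewrite F1 det1 => /cvgrPdist_lt/(_ 1 ltr01).
apply: filterS => q; rewrite unitmxE unitfE => H.
by apply: contraTneq H => ->; rewrite subr0 normr1 ltxx.
Qed.

(** * Global solutions of flat systems on a simply connected surface *)

Section GlobalSolutions.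
Context {R : realType} {T : topologicalType} {n : nat}.
Notation R2 := (R^o * R^o)%type.
Variables (A : set (chart R T)) (hS : riemann_surface A).
Variables (ax ay : chart R T -> T -> 'M[R]_n).
Notation crangeR c := [set q : R2 | crange c (q.1 +i* q.2)].
Hypothesis sax : forall c, A c -> smooth_on (crangeR c) (loc c (ax c)).
Hypothesis say : forall c, A c -> smooth_on (crangeR c) (loc c (ay c)).
Hypothesis flat : forall c p, A c -> cdom c p ->
  ay c p *m ax c p + dy c (ax c) p = ax c p *m ay c p + dx c (ay c) p.
Hypothesis compat : forall c1 c2 p r s, A c1 -> A c2 -> cdom c1 p -> cdom c2 p ->
  jac c1 c2 p r s -> ax c1 p = r *: ax c2 p + s *: ay c2 p /\
                     ay c1 p = - s *: ax c2 p + r *: ay c2 p.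

Definition is_sol m c (F : T -> 'M[R]_(m, n)) p :=
  [/\ differentiable (loc c F) (pt c p), dx c F p = F p *m ax c p &
      dy c F p = F p *m ay c p].

Lemma is_solP m c (F : T -> 'M[R]_(m, n)) p : A c -> cdom c p ->
  is_sol c F p <-> flat_sol (loc c (ax c)) (loc c (ay c)) (loc c F) (pt c p).
Proof.
move=> Ac cp; have hc := rs_chart hS Ac.
have e1 : loc c F (pt c p) = F p := loc_pt hc F cp.
have e2 : loc c (ax c) (pt c p) = ax c p := loc_pt hc (ax c) cp.
have e3 : loc c (ay c) (pt c p) = ay c p := loc_pt hc (ay c) cp.
by rewrite /flat_sol e1 e2 e3.
Qed.

Lemma is_sol_chart m c1 c2 (F : T -> 'M[R]_(m, n)) p : A c1 -> A c2 ->
  cdom c1 p -> cdom c2 p -> is_sol c2 F p -> is_sol c1 F p.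
Proof.
move=> A1 A2 p1 p2 [dF Fx Fy].
have [r [s J]] := chain_rule (rs_chart hS A1) (rs_chart hS A2) p1 p2
  (rs_holomorphic hS A1 A2 p1 p2).
have [e1 e2] := compat A1 A2 p1 p2 J.
have [d1 x1 y1] := J _ F dF.
split=> //; rewrite ?x1 ?y1 Fx Fy ?e1 ?e2 mulmxDr -!scalemxAr //.
Qed.

Lemma mulmx_continuous m k (M : 'M[R]_(m, k)) : continuous (mulmx M : 'M[R]_(k, n) -> _).
Proof.
by move=> B; apply: continuous_mulmx; [exact: cst_continuous|exact: cvg_id].
Qed.

Lemma is_sol_mull m k c (M : 'M[R]_(m, k)) (F : T -> 'M[R]_(k, n)) p :
  is_sol c F p -> is_sol c (fun s => M *m F s) p.
Proof.
move=> [dF Fx Fy].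
have D v := derive_linear v (@mulmx_continuous _ _ M) dF.
have [h1 e1] := D ((1, 0) : R2); have [_ e2] := D ((0, 1) : R2).
split; first exact: h1.
  rewrite -mulmxA -Fx. exact: e1.
rewrite -mulmxA -Fy; exact: e2.
Qed.

Lemma is_solB m c (F G : T -> 'M[R]_(m, n)) p :
  is_sol c F p -> is_sol c G p -> is_sol c (fun s => F s - G s) p.
Proof.
move=> [dF Fx Fy] [dG Gx Gy].
split; first exact: (differentiableB dF dG).
  rewrite mulmxBl -Fx -Gx; apply: deriveB; exact: diff_derivable.
rewrite mulmxBl -Fy -Gy; apply: deriveB; exact: diff_derivable.
Qed.

Lemma flat_loc c q : A c -> crangeR c q ->
  loc c (ay c) q *m loc c (ax c) q + 'D_(0, 1) (loc c (ax c)) q =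
  loc c (ax c) q *m loc c (ay c) q + 'D_(1, 0) (loc c (ay c)) q.
Proof.
move=> Ac /crangeR_pt[p cp ->]; have hc := rs_chart hS Ac.
have e2 : loc c (ax c) (pt c p) = ax c p := loc_pt hc (ax c) cp.
have e3 : loc c (ay c) (pt c p) = ay c p := loc_pt hc (ay c) cp.
by rewrite e2 e3; exact: flat.
Qed.

Lemma sol_germ_unique m c (F : T -> 'M[R]_(m, n)) p : A c -> cdom c p -> F p = 0 ->
  (\forall r \near p, is_sol c F r) -> \forall r \near p, F r = 0.
Proof.
move=> Ac cp Fp nF; have hc := rs_chart hS Ac.
have oU := open_crangeR hc; have Up := pt_crange cp.
have [d [d0 _ _ uniq]] := flat_local oU (sax Ac) (say Ac) (fun q => flat_loc Ac) Up.
have F0 : loc c F (pt c p) = 0 by rewrite -[RHS]Fp; exact: loc_pt.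
have sF : \forall q \near pt c p, flat_sol (loc c (ax c)) (loc c (ay c)) (loc c F) q.
  move: (open_near oU Up) (near_pt hc cp nF); apply: filterS2 => q /crangeR_pt[r cr ->].
  by rewrite loc_pt // => /is_solP; exact.
have nZ := near_comp (pt_continuous hc cp) (uniq _ _ F0 sF).
move: (near_cdom hc cp) nZ; apply: filterS2 => r cr.
by rewrite /loc [cinv c _](loc_pt hc id cr).
Qed.

(** A fundamental matrix normalized at p, invertible nearby because its determinant is continuous.
    [D] is the preimage of a ball in a chart, so that straight segments in the chart supply the
    paths required by [monodromy]. *)
Lemma local_frame p : exists c (D : set T) (Phi : T -> 'M[R]_n),
  [/\ A c, open D, D p, D `<=` cdom c & [/\ Phi p = 1%:M,
     forall r, D r -> Phi r \in unitmx, forall r, D r -> is_sol c Phi r &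
     forall r, D r -> exists gamma : R -> T,
       [/\ {within `[0, 1], continuous gamma}, gamma 0 = p, gamma 1 = r &
           forall s, `[0, 1]%classic s -> D (gamma s)]]].
Proof.
have [c Ac cp] := rs_cover hS p; have hc := rs_chart hS Ac.
have oU := open_crangeR hc; have Up := pt_crange cp.
have [d [d0 dU sol _]] := flat_local oU (sax Ac) (say Ac) (fun q => flat_loc Ac) Up.
have [F [F1 sF]] := sol _ (1%:M : 'M[R]_n).
have cF : {for pt c p, continuous F}.
  have [dF _ _] := sF (pt c p) (ballxx _ d0); exact: differentiable_continuous.
have /nbhs_ballP[e /= e0 He] := unitmx_near cF F1.
pose r0 := Num.min d e.
have r00 : 0 < r0 by rewrite lt_min d0.
have rd : r0 <= d by rewrite ge_min lexx.
have re : r0 <= e by rewrite ge_min lexx orbT.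
pose B := ball (pt c p) r0.
have Bd q : B q -> ball (pt c p) d q by exact: le_ball.
have Be q : B q -> ball (pt c p) e q by exact: le_ball.
pose D := [set s | cdom c s /\ B (pt c s)].
exists c, D, (F \o pt c); split=> //.
- rewrite openE => s [cs Bs].
  have oB : open B by exact: ball_open.
  move: (near_cdom hc cs) (near_comp (pt_continuous hc cs) (open_near oB Bs)).
  by apply: filterS2.
- by split=> //; exact: ballxx.
- by move=> s [].
split=> //.
- by move=> r [cr Br]; exact/He/Be.
- move=> r [cr Br]; apply/is_solP => //.
  have nE : \forall q \near pt c r, F q = loc c (F \o pt c) q.
    apply: filterS (open_near oU (pt_crange cr)) => q /crangeR_pt[s cs ->].
    by rewrite /loc /= [cinv c _](loc_pt hc id cs).
  have [dF Fx Fy] := sF _ (Bd _ Br).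
  have [dF' _] := near_eq_is_diff nE dF.
  split=> //.
    by rewrite -(near_eq_derive _ nE) Fx; congr (_ *m _); exact: nbhs_singleton nE.
  by rewrite -(near_eq_derive _ nE) Fy; congr (_ *m _); exact: nbhs_singleton nE.
move=> r [cr Br].
pose l (s : R) : R2 := pt c p + s *: (pt c r - pt c p).
have lB s : 0 <= s <= 1 -> B (l s).
  move=> /andP[s0 s1]; case: Br => B1 B2.
  have H (u w : R) : ball (u : R^o) r0 w -> ball (u : R^o) r0 (u + s * (w - u)).
    rewrite /ball /= opprD addNKr normrN normrM ger0_norm // distrC => uw.
    by apply: le_lt_trans uw; rewrite ler_piMl.
  by split; exact: H.
exists (fun s => cinv c (cplx (l s))); split.
- apply: continuous_in_subspaceT => s /set_mem /=; rewrite in_itv /= => s01.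
  have cl : {for s, continuous l}.
    apply: cvgD; first exact: cvg_cst.
    by apply: cvgZr_tmp; exact: cvg_id.
  exact: (continuous_comp cl (cinv_cplx_continuous hc (dU _ (Bd _ (lB s s01))))).
- by rewrite /l scale0r addr0 cplx_pt cmapK_at.
- by rewrite /l scale1r addrC subrK cplx_pt cmapK_at.
- move=> s; rewrite /= in_itv /= => s01; have Bl := lB s s01.
  have /crangeR_pt[t ct e1] := dU _ (Bd _ Bl).
  by rewrite e1 loc_pt //; split=> //; rewrite -e1.
Qed.

(** Reading vectors through the local fundamental matrices turns solutions into constants, so
    solutions are horizontal sections and [monodromy] applies. *)
Theorem global_solution (p0 : T) (v0 : 'rV[R]_n) : simply_connected R T ->
  exists f : T -> 'rV[R]_n, f p0 = v0 /\ forall c p, A c -> cdom c p -> is_sol c f p.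
Proof.
move=> sc.
have [ch H1] := choice local_frame; have [D H2] := choice H1; have [Phi H] := choice H2.
have Ach p : A (ch p) by have [] := H p.
have Dop p : open (D p) by have [] := H p.
have Dp p : D p p by have [] := H p.
have Dc p r : D p r -> cdom (ch p) r by have [_ _ _ h _] := H p; exact: h.
have Phi1 p : Phi p p = 1%:M by have [_ _ _ _ []] := H p.
have PhiU p r : D p r -> Phi p r \in unitmx by have [_ _ _ _ [_ h _ _]] := H p; exact: h.
have PhiS p r : D p r -> is_sol (ch p) (Phi p) r by have [_ _ _ _ [_ _ h _]] := H p; exact: h.
pose E p r (v : 'rV[R]_n) := v *m invmx (Phi p r); pose G p r (v : 'rV[R]_n) := v *m Phi p r.
have GK p r v : D p r -> G p r (E p r v) = v by move=> Dr; rewrite /E /G mulmxKV // PhiU.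
have cmp p p' r : D p r -> D p' r ->
    \forall s \near r, forall v, E p' s (G p s v) = E p' r (G p r v).
  (* M is the constant matrix relating the two frames: [Phi p - M *m Phi p'] solves the system and
     vanishes at r, hence near r by uniqueness of germs. *)
  move=> Dr Dr'; pose M := Phi p r *m invmx (Phi p' r).
  have W0 : Phi p r - M *m Phi p' r = 0 by rewrite /M mulmxKV ?PhiU // subrr.
  have nW : \forall s \near r, is_sol (ch p) (fun s => Phi p s - M *m Phi p' s) s.
    move: (open_near (Dop p) Dr) (open_near (Dop p') Dr'); apply: filterS2 => s Ds Ds'.
    apply: is_solB; first exact: PhiS.
    apply: is_sol_mull; apply: (is_sol_chart (c2 := ch p')) (PhiS _ _ Ds') => //.
      exact: Dc.
    exact: Dc.
  move: (open_near (Dop p') Dr') (sol_germ_unique (Ach p) (Dc _ _ Dr) W0 nW).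
  apply: filterS2 => s Ds' /subr0_eq e v.
  by rewrite /E /G e -mulmxA mulmxK ?PhiU // /M !mulmxA.
have [|f [f0 Hf]] := monodromy Dop Dp GK cmp sc _ p0 v0.
  move=> p; have := open_near (Dop p) (Dp p); apply: filterS.
  by have [_ _ _ _ [_ _ _ h]] := H p; exact: h.
exists f; split=> // c p Ac cp.
apply: (is_sol_chart (c2 := ch p)) => //; first exact: Dc.
have hc := rs_chart hS (Ach p).
have [d1 x1 y1] := is_sol_mull (f p) (PhiS _ _ (Dp p)).
have nE : \forall r \near p, f p *m Phi p r = f r.
  by have := Hf p; apply: filterS => r ->; rewrite /G /E Phi1 invmx1 mulmx1.
have nE' := near_pt hc (Dc _ _ (Dp p)) nE.
have [d2 _] := near_eq_is_diff nE' d1.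
have fp : f p *m Phi p p = f p by rewrite Phi1 mulmx1.
split=> //; rewrite -[in RHS]fp.
  by rewrite -x1; apply/esym/near_eq_derive.
by rewrite -y1; apply/esym/near_eq_derive.
Qed.

(* The zero set of a solution is open and closed. *)
Lemma global_sol_unique m (f : T -> 'M[R]_(m, n)) p0 :
  (forall c p, A c -> cdom c p -> is_sol c f p) -> f p0 = 0 -> forall p, f p = 0.
Proof.
move=> sf f0.
have op p : f p = 0 -> \forall r \near p, f r = 0.
  move=> fp; have [c Ac cp] := rs_cover hS p; have hc := rs_chart hS Ac.
  apply: (sol_germ_unique Ac cp fp).
  by apply: filterS (near_cdom hc cp) => r; exact: sf.
have cf p : {for p, continuous f}.
  have [c Ac cp] := rs_cover hS p; have hc := rs_chart hS Ac.
  have [/differentiable_continuous df _ _] := sf c p Ac cp.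
  have cc : loc c f (pt c r) @[r --> p] --> loc c f (pt c p).
    exact: (continuous_comp (pt_continuous hc cp) df).
  have e : loc c f (pt c p) = f p := loc_pt hc f cp.
  rewrite e in cc; apply: cvg_trans cc; apply: near_eq_cvg.
  by apply: filterS (near_cdom hc cp) => r cr; exact: (loc_pt hc f cr).
have -> : f = cst 0; last by [].
have BT : [set p | f p = 0] = setT.
  apply: (rs_connected hS); first by exists p0.
    by exists [set p | f p = 0]; rewrite ?setTI // openE => p; exact: op.
  exists [set p | f p = 0]; rewrite ?setTI // -[X in closed X]setCK.
  apply: open_closedC; rewrite openE => p /eqP fp.
  rewrite -normr_gt0 in fp.
  have /cvgrPdist_lt/(_ _ fp) := cf p; apply: filterS => r h fr.
  by move: h; rewrite fr subr0 ltxx.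
by apply/funext => p; have : [set p | f p = 0] p by rewrite BT.
Qed.

End GlobalSolutions.

(** * Symmetry of second derivatives *)

Section Schwarz.
Context {R : realType}.
Notation R2 := (R^o * R^o)%type.

(** The mean value theorem in x and then in y. The same second difference treated in the opposite
    order yields the other mixed derivative, and [schwarz] compares the two as the square
    shrinks. *)
Lemma second_difference (f : R2 -> R^o) (U : set R2) (q0 : R2) (s : R) : 0 < s ->
  smooth_on U f -> (forall x y, 0 <= x <= s -> 0 <= y <= s -> U (at_ q0 x y)) ->
  exists x y, [/\ 0 <= x <= s, 0 <= y <= s &
    f (at_ q0 s s) - f (at_ q0 s 0) - f (at_ q0 0 s) + f (at_ q0 0 0) =
    s ^+ 2 * 'D_(0, 1) ('D_(1, 0) f) (at_ q0 x y)].
Proof.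
move=> s0 sf HU; have s0' := ltW s0.
have Is : 0 <= s <= s by rewrite s0' lexx.
have I0 : 0 <= (0 : R) <= s by rewrite lexx s0'.
have dfx := smooth_derive ((1, 0) : R2) sf.
pose g (t : R) : R := f (at_ q0 t s) - f (at_ q0 t 0).
have Dg (t : R) : 0 <= t <= s ->
    is_derive t (1 : R) g ('D_(1, 0) f (at_ q0 t s) - 'D_(1, 0) f (at_ q0 t 0)).
  move=> ts; apply: is_deriveB; apply: is_derive_at1.
    exact: (smooth_differentiable sf (HU _ _ ts Is)).
  exact: (smooth_differentiable sf (HU _ _ ts I0)).
have [|//|t1 t1s E1] := @MVT_segment R g
    (fun t => 'D_(1, 0) f (at_ q0 t s) - 'D_(1, 0) f (at_ q0 t 0)) 0 s s0'.
    by move=> t; rewrite in_itv /= => /andP[h1 h2]; apply: Dg; rewrite !ltW.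
  apply: continuous_in_subspaceT => t /set_mem /=; rewrite in_itv /= => ts.
  exact: is_derive_continuous (Dg t ts).
rewrite in_itv /= in t1s.
have Dk (t : R) : 0 <= t <= s -> is_derive t (1 : R) (fun t => 'D_(1, 0) f (at_ q0 t1 t))
    ('D_(0, 1) ('D_(1, 0) f) (at_ q0 t1 t)).
  move=> ts; apply: is_derive_at2.
  exact: (smooth_differentiable dfx (HU _ _ t1s ts)).
have [|//|t2 t2s E2] := @MVT_segment R (fun t => 'D_(1, 0) f (at_ q0 t1 t))
    (fun t => 'D_(0, 1) ('D_(1, 0) f) (at_ q0 t1 t)) 0 s s0'.
    by move=> t; rewrite in_itv /= => /andP[h1 h2]; apply: Dk; rewrite !ltW.
  apply: continuous_in_subspaceT => t /set_mem /=; rewrite in_itv /= => ts.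
  exact: is_derive_continuous (Dk t ts).
rewrite in_itv /= in t2s.
exists t1, t2; split=> //.
move: E1; rewrite E2 /g subr0 => E1.
transitivity (f (at_ q0 s s) - f (at_ q0 s 0) - (f (at_ q0 0 s) - f (at_ q0 0 0))).
  by ring.
by rewrite E1; ring.
Qed.

Lemma second_difference' (f : R2 -> R^o) (U : set R2) (q0 : R2) (s : R) : 0 < s ->
  smooth_on U f -> (forall x y, 0 <= x <= s -> 0 <= y <= s -> U (at_ q0 x y)) ->
  exists x y, [/\ 0 <= x <= s, 0 <= y <= s &
    f (at_ q0 s s) - f (at_ q0 s 0) - f (at_ q0 0 s) + f (at_ q0 0 0) =
    s ^+ 2 * 'D_(1, 0) ('D_(0, 1) f) (at_ q0 x y)].
Proof.
move=> s0 sf HU; have s0' := ltW s0.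
have Is : 0 <= s <= s by rewrite s0' lexx.
have I0 : 0 <= (0 : R) <= s by rewrite lexx s0'.
have dfy := smooth_derive ((0, 1) : R2) sf.
pose g (t : R) : R := f (at_ q0 s t) - f (at_ q0 0 t).
have Dg (t : R) : 0 <= t <= s ->
    is_derive t (1 : R) g ('D_(0, 1) f (at_ q0 s t) - 'D_(0, 1) f (at_ q0 0 t)).
  move=> ts; apply: is_deriveB; apply: is_derive_at2.
    exact: (smooth_differentiable sf (HU _ _ Is ts)).
  exact: (smooth_differentiable sf (HU _ _ I0 ts)).
have [|//|t1 t1s E1] := @MVT_segment R g
    (fun t => 'D_(0, 1) f (at_ q0 s t) - 'D_(0, 1) f (at_ q0 0 t)) 0 s s0'.
    by move=> t; rewrite in_itv /= => /andP[h1 h2]; apply: Dg; rewrite !ltW.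
  apply: continuous_in_subspaceT => t /set_mem /=; rewrite in_itv /= => ts.
  exact: is_derive_continuous (Dg t ts).
rewrite in_itv /= in t1s.
have Dk (t : R) : 0 <= t <= s -> is_derive t (1 : R) (fun t => 'D_(0, 1) f (at_ q0 t t1))
    ('D_(1, 0) ('D_(0, 1) f) (at_ q0 t t1)).
  move=> ts; apply: is_derive_at1.
  exact: (smooth_differentiable dfy (HU _ _ ts t1s)).
have [|//|t2 t2s E2] := @MVT_segment R (fun t => 'D_(0, 1) f (at_ q0 t t1))
    (fun t => 'D_(1, 0) ('D_(0, 1) f) (at_ q0 t t1)) 0 s s0'.
    by move=> t; rewrite in_itv /= => /andP[h1 h2]; apply: Dk; rewrite !ltW.
  apply: continuous_in_subspaceT => t /set_mem /=; rewrite in_itv /= => ts.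
  exact: is_derive_continuous (Dk t ts).
rewrite in_itv /= in t2s.
exists t2, t1; split=> //.
move: E1; rewrite E2 /g subr0 => E1.
transitivity (f (at_ q0 s s) - f (at_ q0 0 s) - (f (at_ q0 s 0) - f (at_ q0 0 0))).
  by ring.
by rewrite E1; ring.
Qed.

Lemma schwarz (f : R2 -> R^o) (U : set R2) (q : R2) : open U -> U q -> smooth_on U f ->
  'D_(1, 0) ('D_(0, 1) f) q = 'D_(0, 1) ('D_(1, 0) f) q.
Proof.
move=> oU Uq sf; set u := LHS; set v := RHS.
apply/eqP; rewrite -subr_eq0 -normr_le0; apply/ler_addgt0Pr => e e0; rewrite add0r.
have e2 : 0 < e / 2 by rewrite divr_gt0.
have s1 := smooth_derive ((1, 0) : R2) (smooth_derive ((0, 1) : R2) sf).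
have s2 := smooth_derive ((0, 1) : R2) (smooth_derive ((1, 0) : R2) sf).
have c1 := differentiable_continuous (smooth_differentiable s1 Uq).
have c2 := differentiable_continuous (smooth_differentiable s2 Uq).
have n1 : \forall p \near q, `|u - 'D_(1, 0) ('D_(0, 1) f) p| < e / 2.
  by have /cvgrPdist_lt/(_ _ e2) := c1.
have n2 : \forall p \near q, `|v - 'D_(0, 1) ('D_(1, 0) f) p| < e / 2.
  by have /cvgrPdist_lt/(_ _ e2) := c2.
have : \forall p \near q, [/\ U p, `|u - 'D_(1, 0) ('D_(0, 1) f) p| < e / 2 &
    `|v - 'D_(0, 1) ('D_(1, 0) f) p| < e / 2].
  by move: (open_near oU Uq) n1 n2; apply: filterS3 => p h1 h2 h3; split;
    [exact: h1|exact: h2|exact: h3].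
move=> /nbhs_ballP[r /= r0 H].
pose s := r / 2; have s0 : 0 < s by rewrite divr_gt0.
have Hb x y : 0 <= x <= s -> 0 <= y <= s -> ball q r (at_ q x y).
  move=> /andP[x0 xs] /andP[y0 ys]; rewrite /s in xs ys.
  by split; rewrite /= /ball /= opprD addNKr normrN ger0_norm //; lra.
have HU x y : 0 <= x <= s -> 0 <= y <= s -> U (at_ q x y).
  by move=> xs ys; have [] := H _ (Hb _ _ xs ys).
have [x [y [xs ys E1]]] := second_difference s0 sf HU.
have [x' [y' [xs' ys' E2]]] := second_difference' s0 sf HU.
have E : 'D_(1, 0) ('D_(0, 1) f) (at_ q x' y') = 'D_(0, 1) ('D_(1, 0) f) (at_ q x y).
  have s2n : s ^+ 2 != 0 by rewrite expf_neq0 // gt_eqF.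
  by apply: (mulfI s2n); exact: etrans (esym E2) E1.
have [_ h1 _] := H _ (Hb _ _ xs' ys'); have [_ _ h2] := H _ (Hb _ _ xs ys).
rewrite E in h1; set w := 'D_(0, 1) ('D_(1, 0) f) (at_ q x y) in h1 h2.
have -> : u - v = (u - w) - (v - w) by rewrite opprB addrA subrK.
by apply: le_trans (ler_normB _ _) _; rewrite [e]splitr; exact: lerD (ltW h1) (ltW h2).
Qed.

End Schwarz.

(** * Minkowski 3-space and the structure equations in an adapted frame *)

Section PForm.
Context {R : realType} {n : nat}.
Implicit Types u v w : 'rV[R]_n.

Lemma pformC u v : pform u v = pform v u.
Proof. by apply: eq_bigr => i _; rewrite -!mulrA; congr (_ * _); rewrite mulrC. Qed.

Lemma pformDl u v w : pform (u + v) w = pform u w + pform v w.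
Proof. by rewrite /pform -big_split; apply: eq_bigr => i _ /=; rewrite mxE mulrDr mulrDl. Qed.

Lemma pformZl (k : R) u v : pform (k *: u) v = k * pform u v.
Proof. by rewrite /pform mulr_sumr; apply: eq_bigr => i _ /=; rewrite mxE; ring. Qed.

Lemma pformDr u v w : pform w (u + v) = pform w u + pform w v.
Proof. by rewrite pformC pformDl !(pformC w). Qed.

Lemma pformZr (k : R) u v : pform v (k *: u) = k * pform v u.
Proof. by rewrite pformC pformZl pformC. Qed.

Lemma pformNl u v : pform (- u) v = - pform u v.
Proof. by rewrite -scaleN1r pformZl mulN1r. Qed.

Lemma pformNr u v : pform v (- u) = - pform v u.
Proof. by rewrite pformC pformNl pformC. Qed.

Lemma pformBl u v w : pform (u - v) w = pform u w - pform v w.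
Proof. by rewrite pformDl pformNl. Qed.

Lemma pformBr u v w : pform w (u - v) = pform w u - pform w v.
Proof. by rewrite pformDr pformNr. Qed.

Lemma pform0l v : pform 0 v = 0.
Proof. by rewrite -(scale0r v) pformZl mul0r. Qed.

Definition pformE := (pformDl, pformDr, pformBl, pformBr, pformZl, pformZr, pformNl, pformNr).
End PForm.

Section Cross.
Context {R : realType}.
Implicit Types a b c v X n : 'rV[R]_3.

(* In Minkowski 3-space: [pform (cross a b) c] is the determinant of (a, b, c). *)
Definition cross a b : 'rV[R]_3 := \row_k nth 0
  [:: a 0 1 * b 0 2 - a 0 2 * b 0 1; a 0 2 * b 0 0 - a 0 0 * b 0 2;
      a 0 1 * b 0 0 - a 0 0 * b 0 1] k.

Lemma row3P a b : a 0 0 = b 0 0 -> a 0 1 = b 0 1 -> a 0 2 = b 0 2 -> a = b.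
Proof.
move=> h0 h1 h2; apply/rowP => -[[|[|[|//]]] i].
- by rewrite (_ : Ordinal i = 0) //; exact: val_inj.
- by rewrite (_ : Ordinal i = 1) //; exact: val_inj.
- by rewrite (_ : Ordinal i = 2) //; exact: val_inj.
Qed.

Lemma crossDl a b c : cross (a + b) c = cross a c + cross b c.
Proof. by apply: row3P; rewrite !mxE /=; ring. Qed.

Lemma crossDr a b c : cross c (a + b) = cross c a + cross c b.
Proof. by apply: row3P; rewrite !mxE /=; ring. Qed.

Lemma crossZl (k : R) a b : cross (k *: a) b = k *: cross a b.
Proof. by apply: row3P; rewrite !mxE /=; ring. Qed.

Lemma crossZr (k : R) a b : cross b (k *: a) = k *: cross b a.
Proof. by apply: row3P; rewrite !mxE /=; ring. Qed.

Lemma crossC a b : cross a b = - cross b a.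
Proof. by apply: row3P; rewrite !mxE /=; ring. Qed.

Lemma crossvv a : cross a a = 0.
Proof. by apply: row3P; rewrite !mxE /=; ring. Qed.

Lemma crossNl a b : cross (- a) b = - cross a b.
Proof. by rewrite -scaleN1r crossZl scaleN1r. Qed.

Lemma crossNr a b : cross b (- a) = - cross b a.
Proof. by rewrite -scaleN1r crossZr scaleN1r. Qed.

Definition crossE := (crossDl, crossDr, crossNl, crossNr, crossZl, crossZr).

Lemma cross_cross a b c : cross a (cross b c) = pform a b *: c - pform a c *: b.
Proof. by apply: row3P; rewrite !mxE !pform3E /=; ring. Qed.

Lemma pform_cross_l a b : pform (cross a b) a = 0.
Proof. by rewrite pform3E !mxE /=; ring. Qed.

Lemma pform_cross_r a b : pform (cross a b) b = 0.
Proof. by rewrite pform3E !mxE /=; ring. Qed.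

Lemma pform_cross_cross a b :
  pform (cross a b) (cross a b) = pform a b ^+ 2 - pform a a * pform b b.
Proof. by rewrite !pform3E !mxE /=; ring. Qed.

Lemma cramer a b c v : pform (cross a b) c *: v =
  pform v (cross b c) *: a + pform v (cross c a) *: b + pform v (cross a b) *: c.
Proof. by apply: row3P; rewrite !mxE !pform3E !mxE /=; ring. Qed.

Section Frame.
Variables (X n : 'rV[R]_3) (w : R).
Hypothesis XX : pform X X = -1.
Hypothesis Xn : pform X n = 0.
Hypothesis nn : pform n n = w.
Let C := cross n X.

Lemma cross_XC : cross X C = n.
Proof. by rewrite /C cross_cross Xn XX scale0r sub0r scaleN1r opprK. Qed.

Lemma cross_nC : cross n C = w *: X.
Proof. by rewrite /C cross_cross nn pformC Xn scale0r subr0. Qed.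

Lemma pform_CC : pform C C = w.
Proof. by rewrite /C pform_cross_cross nn XX pformC Xn; ring. Qed.

Lemma pform_CX : pform C X = 0. Proof. exact: pform_cross_r. Qed.
Lemma pform_Cn : pform C n = 0. Proof. exact: pform_cross_l. Qed.

(** Expansion in the orthogonal frame (X, n, C), of squares -1, w, w, multiplied by w so that no
    division occurs. *)
Lemma frame_expand v :
  w *: v = - (w * pform v X) *: X + pform v n *: n + pform v C *: C.
Proof.
have := cramer n X C v; rewrite -/C cross_XC pform_CC => ->.
rewrite (crossC C) cross_nC pformNr pformZr -/C; congr (_ + _); exact: addrC.
Qed.

Variable nu : R.
Hypothesis wE : w = 1 - nu ^+ 2.
Hypothesis w0 : w != 0.
Variables (hx hy : R) (Xx Xy : 'rV[R]_3).
Hypothesis XxX : pform Xx X = 0.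
Hypothesis XyX : pform Xy X = 0.
Hypothesis Xxn : pform Xx n = - (hx * nu).
Hypothesis Xyn : pform Xy n = - (hy * nu).
Hypothesis conf1 : pform Xx Xx + hx ^+ 2 = pform Xy Xy + hy ^+ 2.
Hypothesis conf2 : pform Xx Xy + hx * hy = 0.

Lemma frame_pform u v : w * pform u v =
  - (w * pform v X) * pform u X + pform v n * pform u n + pform v C * pform u C.
Proof. by rewrite -pformZr (frame_expand v) !pformE. Qed.

(* (pform Xx C, pform Xy C) and (hy, - hx) have the same complex square. *)
Lemma orientation_alternative :
  (pform Xx C = hy /\ pform Xy C = - hx) \/ (pform Xx C = - hy /\ pform Xy C = hx).
Proof.
have e11 := frame_pform Xx Xx; have e22 := frame_pform Xy Xy.
have e12 := frame_pform Xx Xy.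
rewrite !XxX !Xxn in e11; rewrite !XyX !Xyn in e22; rewrite XxX XyX Xxn Xyn in e12.
move: e11 e22 e12; set b1 := pform Xx C; set b2 := pform Xy C => e11 e22 e12.
have q1 : b1 ^+ 2 - b2 ^+ 2 = hy ^+ 2 - hx ^+ 2.
  have := congr1 ( *%R w) conf1; rewrite !mulrDr e11 e22 wE; lra.
have q2 : b1 * b2 + hx * hy = 0.
  have := congr1 ( *%R w) conf2; rewrite mulrDr e12 mulr0 wE; lra.
have : ((b1 - hy) ^+ 2 + (b2 + hx) ^+ 2) * ((b1 + hy) ^+ 2 + (b2 - hx) ^+ 2) = 0.
  transitivity ((b1 ^+ 2 - b2 ^+ 2 - (hy ^+ 2 - hx ^+ 2)) ^+ 2
    + 4 * (b1 * b2 + hx * hy) ^+ 2); first by ring.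
  by rewrite q1 q2 subrr !expr0n /= mulr0 addr0.
move/eqP; rewrite mulf_eq0 => /orP[].
  rewrite paddr_eq0 ?sqr_ge0 // !sqrf_eq0 => /andP[/eqP h1 /eqP h2]; left; split; lra.
rewrite paddr_eq0 ?sqr_ge0 // !sqrf_eq0 => /andP[/eqP h1 /eqP h2]; right; split; lra.
Qed.

(** By the alternative the quantity is h_x^2 + h_y^2 up to sign. If the gradient of h vanished, X_x
    would be orthogonal to X, n and C, hence have square zero, and phi would not be an immersion. *)
Lemma orientation_neq0 : 0 < pform Xx Xx + hx ^+ 2 ->
  hy * pform Xx C - hx * pform Xy C != 0.
Proof.
move=> E0; have e11 := frame_pform Xx Xx; rewrite !XxX !Xxn in e11.
have a := orientation_alternative.
have g0 : hx ^+ 2 + hy ^+ 2 != 0.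
  apply/eqP => /eqP; rewrite paddr_eq0 ?sqr_ge0 // !sqrf_eq0 => /andP[/eqP x0 /eqP y0].
  have b0 : pform Xx C = 0 by case: a => -[-> _]; rewrite y0 ?oppr0.
  move: e11; rewrite x0 b0 !(mulr0, mul0r, addr0, oppr0) => /eqP.
  by rewrite mulf_eq0 (negbTE w0) /= => /eqP e; move: E0; rewrite e x0 expr0n addr0 ltxx.
apply: contra_neq g0; case: a => -[-> ->] e.
  by apply: etrans e; ring.
by apply: oppr_inj; rewrite oppr0; apply: etrans e; ring.
Qed.

Hypothesis orient : hy * pform Xx C - hx * pform Xy C < 0.

Lemma XxC_XyC : pform Xx C = - hy /\ pform Xy C = hx.
Proof.
case: orientation_alternative => // -[h1 h2]; move: orient; rewrite h1 h2.
by have := sqr_ge0 hx; have := sqr_ge0 hy; lra.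
Qed.

Lemma grad_gt0 : 0 < hx ^+ 2 + hy ^+ 2.
Proof. by have [h1 h2] := XxC_XyC; move: orient; rewrite h1 h2; lra. Qed.

Lemma XxE : w *: Xx = - (nu * hx) *: n - hy *: C.
Proof.
rewrite frame_expand XxX Xxn mulr0 oppr0 scale0r add0r (XxC_XyC).1.
by rewrite [nu * _]mulrC [- hy *: _]scaleNr.
Qed.

Lemma XyE : w *: Xy = hx *: C - (nu * hy) *: n.
Proof.
rewrite frame_expand XyX Xyn mulr0 oppr0 scale0r add0r (XxC_XyC).2.
by rewrite [nu * _]mulrC addrC scaleNr.
Qed.

(** Here (L, s) will be the Laplacian of phi = (X, h). Being orthogonal to N, phi_x and phi_y it is
    normal to the product H^2 x R, hence proportional to (X, 0), so its height component vanishes: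
    this is why h is harmonic. *)
Lemma lap_h0 (L : 'rV[R]_3) s : pform L n + s * nu = 0 -> pform L Xx + s * hx = 0 ->
  pform L Xy + s * hy = 0 -> s = 0.
Proof.
move=> Ln Lx Ly.
have ex : w * pform L Xx = - (nu * hx) * pform L n - hy * pform L C.
  by rewrite -pformZr XxE !pformE.
have ey : w * pform L Xy = hx * pform L C - (nu * hy) * pform L n.
  by rewrite -pformZr XyE !pformE.
have {}Ln : pform L n = - (s * nu) by lra.
rewrite Ln in ex ey; set q := pform L C in ex ey.
have f1 : s * hx = hy * q.
  have := congr1 ( *%R w) Lx; rewrite mulrDr ex mulr0 wE; lra.
have f2 : s * hy = - (hx * q).
  have := congr1 ( *%R w) Ly; rewrite mulrDr ey mulr0 wE; lra.
have : s * (hx ^+ 2 + hy ^+ 2) = 0.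
  transitivity ((s * hx) * hx + (s * hy) * hy); first by ring.
  by rewrite f1 f2; ring.
have h0 : hx ^+ 2 + hy ^+ 2 != 0 by rewrite gt_eqF ?grad_gt0.
by move/eqP; rewrite mulf_eq0 (negbTE h0) orbF => /eqP.
Qed.

Variables (nux nuy : R) (nx ny : 'rV[R]_3).
Hypothesis nxX : pform nx X = hx * nu.
Hypothesis nyX : pform ny X = hy * nu.
Hypothesis nxn : pform nx n = - (nu * nux).
Hypothesis nyn : pform ny n = - (nu * nuy).
Hypothesis symm : pform nx Xy + nux * hy = pform ny Xx + nuy * hx.
Hypothesis minim : pform nx Xx + nux * hx + (pform ny Xy + nuy * hy) = 0.

(** Symmetry and vanishing trace of the second fundamental form become a homogeneous linear system
    in [p1 - nuy] and [p2 + nux], with determinant h_x^2 + h_y^2. *)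
Lemma nxC_nyC : pform nx C = nuy /\ pform ny C = - nux.
Proof.
have exx : w * pform nx Xx = - (nu * hx) * pform nx n - hy * pform nx C.
  by rewrite -pformZr XxE !pformE.
have exy : w * pform nx Xy = hx * pform nx C - (nu * hy) * pform nx n.
  by rewrite -pformZr XyE !pformE.
have eyx : w * pform ny Xx = - (nu * hx) * pform ny n - hy * pform ny C.
  by rewrite -pformZr XxE !pformE.
have eyy : w * pform ny Xy = hx * pform ny C - (nu * hy) * pform ny n.
  by rewrite -pformZr XyE !pformE.
move: exx exy eyx eyy; rewrite nxn nyn; set p1 := pform nx C; set p2 := pform ny C.
move=> exx exy eyx eyy.
have f1 : hx * (p1 - nuy) + hy * (p2 + nux) = 0.
  have := congr1 ( *%R w) symm; rewrite !mulrDr exy eyx wE; lra.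
have f2 : hx * (p2 + nux) - hy * (p1 - nuy) = 0.
  have := congr1 ( *%R w) minim; rewrite !mulrDr exx eyy mulr0 wE; lra.
have g1 : (hx ^+ 2 + hy ^+ 2) * (p1 - nuy) = 0.
  transitivity (hx * (hx * (p1 - nuy) + hy * (p2 + nux))
    - hy * (hx * (p2 + nux) - hy * (p1 - nuy))); first by ring.
  by rewrite f1 f2; ring.
have g2 : (hx ^+ 2 + hy ^+ 2) * (p2 + nux) = 0.
  transitivity (hy * (hx * (p1 - nuy) + hy * (p2 + nux))
    + hx * (hx * (p2 + nux) - hy * (p1 - nuy))); first by ring.
  by rewrite f1 f2; ring.
have h0 : hx ^+ 2 + hy ^+ 2 != 0 by rewrite gt_eqF ?grad_gt0.
move/eqP: g1; rewrite mulf_eq0 (negbTE h0) /= => /eqP g1.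
move/eqP: g2; rewrite mulf_eq0 (negbTE h0) /= => /eqP g2.
by split; lra.
Qed.

Lemma nxE : w *: nx = - (w * (hx * nu)) *: X + (nuy *: C - (nu * nux) *: n).
Proof.
rewrite frame_expand nxX nxn (nxC_nyC).1 -addrA; congr (_ + _).
by rewrite addrC scaleNr.
Qed.

Lemma nyE : w *: ny = - (w * (hy * nu)) *: X - (nux *: C + (nu * nuy) *: n).
Proof.
rewrite frame_expand nyX nyn (nxC_nyC).2 -addrA; congr (_ + _).
by rewrite !scaleNr -opprD addrC.
Qed.

Let Cx := cross nx X + cross n Xx.
Let Cy := cross ny X + cross n Xy.

Lemma CxE : w *: Cx = - (nuy *: n + (nu * nux) *: C) - (w * hy) *: X.
Proof.
rewrite /Cx scalerDr -crossZl -crossZr XxE nxE !crossE crossvv [cross C X]crossC cross_XC cross_nC.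
rewrite -/C crossvv; apply/rowP => k; rewrite !mxE.
by move: (C 0 k) (X 0 k) (n 0 k) => *; ring.
Qed.

Lemma CyE : w *: Cy = (nux *: n - (nu * nuy) *: C) + (w * hx) *: X.
Proof.
rewrite /Cy scalerDr -crossZl -crossZr XyE nyE !crossE crossvv [cross C X]crossC cross_XC cross_nC.
rewrite -/C crossvv; apply/rowP => k; rewrite !mxE.
by move: (C 0 k) (X 0 k) (n 0 k) => *; ring.
Qed.

Hypothesis nu1 : 1 - nu != 0.
Variables (hxx hxy hyy : R).
Hypothesis lap0 : hxx + hyy = 0.
Let D := (2 * (1 - nu))^-1.

Let nx' : nx = w^-1 *: (- (w * (hx * nu)) *: X + (nuy *: C - (nu * nux) *: n)).
Proof. by rewrite -nxE scalerA mulVf // scale1r. Qed.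
Let ny' : ny = w^-1 *: (- (w * (hy * nu)) *: X - (nux *: C + (nu * nuy) *: n)).
Proof. by rewrite -nyE scalerA mulVf // scale1r. Qed.
Let Cx' : Cx = w^-1 *: (- (nuy *: n + (nu * nux) *: C) - (w * hy) *: X).
Proof. by rewrite -CxE scalerA mulVf // scale1r. Qed.
Let Cy' : Cy = w^-1 *: ((nux *: n - (nu * nuy) *: C) + (w * hx) *: X).
Proof. by rewrite -CyE scalerA mulVf // scale1r. Qed.

(* The form [alpha1 dx + alpha2 dy] is recovered from (X, n) and the gradient of h by
   asking that d psi = psi J(alpha) have Gauss map X and Hopf differential (i/2) dz^2
   with Im z = h / 2. *)
Definition alpha1 D hx hy C n : 'rV[R]_3 := D *: (hx *: C - hy *: n).
Definition alpha2 D hx hy C n : 'rV[R]_3 := D *: (hy *: C + hx *: n).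

(** The left side is the y-component of alpha differentiated in x minus the x-component
    differentiated in y; the terms with 2 D^2 come from the derivative of the weight D. Second
    derivatives of h enter only through h_xx + h_yy, and once all vectors are expanded in (X, n, C)
    the coefficients agree as rational functions of nu. *)
Lemma alpha_curl :
  ((2 * D ^+ 2 * nux) *: (hy *: C + hx *: n) +
    D *: ((hxy *: C + hy *: Cx) + (hxx *: n + hx *: nx))) -
  ((2 * D ^+ 2 * nuy) *: (hx *: C - hy *: n) +
    D *: ((hxy *: C + hx *: Cy) - (hyy *: n + hy *: ny))) =
  - 2 *: cross (alpha2 D hx hy C n) (alpha1 D hx hy C n).
Proof.
have -> : cross (alpha2 D hx hy C n) (alpha1 D hx hy C n) =
    (D ^+ 2 * (hx ^+ 2 + hy ^+ 2)) *: (w *: X).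
  rewrite /alpha1 /alpha2 !crossE (crossC C n) !cross_nC !crossvv.
  apply/rowP => k; rewrite !mxE; move: (X 0 k) => *; ring.
have -> : hyy = - hxx by apply/eqP; rewrite -addr_eq0 addrC lap0.
rewrite Cx' Cy' nx' ny'; apply/rowP => k; rewrite !mxE.
move: (C 0 k) (X 0 k) (n 0 k) => Ck Xk nk; rewrite /D.
have w' : 1 - nu ^+ 2 != 0 by rewrite -wE.
by rewrite wE; field; rewrite ?nu1 ?w'.
Qed.

Lemma alpha_div :
  ((2 * D ^+ 2 * nux) *: (hx *: C - hy *: n) +
    D *: ((hxx *: C + hx *: Cx) - (hxy *: n + hy *: nx))) +
  ((2 * D ^+ 2 * nuy) *: (hy *: C + hx *: n) +
    D *: ((hyy *: C + hy *: Cy) + (hxy *: n + hx *: ny))) = 0.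
Proof.
have -> : hyy = - hxx by apply/eqP; rewrite -addr_eq0 addrC lap0.
rewrite Cx' Cy' nx' ny'; apply/rowP => k; rewrite !mxE.
move: (C 0 k) (X 0 k) (n 0 k) => Ck Xk nk; rewrite /D.
have w' : 1 - nu ^+ 2 != 0 by rewrite -wE.
by rewrite wE; field; rewrite ?nu1 ?w'.
Qed.

(** On the plane orthogonal to X, [cross X] is the rotation by a right angle, so this relation is
    the conformality of alpha. *)
Lemma cross_alpha1 : cross X (alpha1 D hx hy C n) = alpha2 D hx hy C n.
Proof.
rewrite /alpha1 /alpha2 !crossE cross_XC (crossC X n) -/C; congr (_ *: _).
by rewrite scalerN opprK addrC.
Qed.

Lemma alpha1_X : pform (alpha1 D hx hy C n) X = 0.
Proof. by rewrite /alpha1 !pformE pform_CX (pformC n) Xn; ring. Qed.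

Lemma alpha1_alpha1 : pform (alpha1 D hx hy C n) (alpha1 D hx hy C n) =
  D ^+ 2 * w * (hx ^+ 2 + hy ^+ 2).
Proof. by rewrite /alpha1 !pformE pform_CC nn (pformC n C) pform_Cn; ring. Qed.

Lemma alpha1_gt0 : 0 < w -> 0 < pform (alpha1 D hx hy C n) (alpha1 D hx hy C n).
Proof.
move=> w_gt0; rewrite alpha1_alpha1; apply: mulr_gt0; last exact: grad_gt0.
apply: mulr_gt0 => //; rewrite exprn_even_gt0 //= invr_eq0.
by rewrite mulf_eq0 pnatr_eq0.
Qed.

Let Xx' : Xx = w^-1 *: (- (nu * hx) *: n - hy *: C).
Proof. by rewrite -XxE scalerA mulVf // scale1r. Qed.
Let Xy' : Xy = w^-1 *: (hx *: C - (nu * hy) *: n).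
Proof. by rewrite -XyE scalerA mulVf // scale1r. Qed.

(** In view of [hopf_J] and [wirtinger_pform], these are 4 times the real part and -4 times the
    imaginary part of the Hopf coefficient of psi. They are the two equations that determine the
    weight D and the combination of C and n in alpha. *)
Lemma alpha_hopf :
  pform (alpha1 D hx hy C n) Xx - pform (alpha2 D hx hy C n) Xy = - hx * hy /\
  pform (alpha1 D hx hy C n) Xy + pform (alpha2 D hx hy C n) Xx = (hx ^+ 2 - hy ^+ 2) / 2.
Proof.
have w' : 1 - nu ^+ 2 != 0 by rewrite -wE.
rewrite Xx' Xy' /alpha1 /alpha2 !pformE pform_CC nn (pformC n C) pform_Cn wE /D.
by split; field; rewrite ?nu1 ?w'.
Qed.

End Frame.
End Cross.

(** * Self-dual bivectors *)

Section SelfDual.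
Context {R : realType}.
Implicit Types (a b c : 'rV[R]_3) (u v psi : 'rV[R]_4).

(** Up to the factor sqrt 2, the self-dual bivector with coordinates a (see [coord_plus_Omega]). The
    matrix J(a) is [eta *m Omega a]: its last two rows have the opposite sign. *)
Definition Omega a : 'M[R]_4 := \matrix_(i, j) nth 0 (nth [::]
  [:: [:: 0; a 0 2; a 0 0; a 0 1]; [:: - a 0 2; 0; a 0 1; - a 0 0];
      [:: - a 0 0; - a 0 1; 0; - a 0 2]; [:: - a 0 1; a 0 0; a 0 2; 0]] i) j.

(* The bivector [Omega a] acting on row vectors through the metric. *)
Definition J a : 'M[R]_4 := \matrix_(i, j) nth 0 (nth [::]
  [:: [:: 0; a 0 2; a 0 0; a 0 1]; [:: - a 0 2; 0; a 0 1; - a 0 0];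
      [:: a 0 0; a 0 1; 0; a 0 2]; [:: a 0 1; - a 0 0; - a 0 2; 0]] i) j.

Lemma ord4P (P : 'I_4 -> Prop) : P 0 -> P 1 -> P 2 -> P 3 -> forall i, P i.
Proof.
move=> h0 h1 h2 h3 [[|[|[|[|//]]]] i].
- by rewrite (_ : Ordinal i = 0) //; exact: val_inj.
- by rewrite (_ : Ordinal i = 1) //; exact: val_inj.
- by rewrite (_ : Ordinal i = 2) //; exact: val_inj.
- by rewrite (_ : Ordinal i = 3) //; exact: val_inj.
Qed.

Lemma J_is_linear : linear J.
Proof.
by move=> k a b; apply/matrixP => i j; elim/ord4P: i; elim/ord4P: j; rewrite !mxE /=; ring.
Qed.
HB.instance Definition _ := GRing.isLinear.Build R 'rV[R]_3 'M[R]_4 *:%R J J_is_linear.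

Lemma J_continuous : continuous J.
Proof.
move=> a; apply: continuous_mx => i j.
have ca k : {for a, continuous (fun b : 'rV[R]_3 => b 0 k : R)} by exact: coord_continuous.
have cNa k : {for a, continuous (fun b : 'rV[R]_3 => - b 0 k : R)}.
  by apply: continuousN; exact: ca.
rewrite (_ : (fun b => J b i j) = fun b => nth 0 (nth [::]
  [:: [:: 0; b 0 2; b 0 0; b 0 1]; [:: - b 0 2; 0; b 0 1; - b 0 0];
      [:: b 0 0; b 0 1; 0; b 0 2]; [:: b 0 1; - b 0 0; - b 0 2; 0]] i) j); last first.
  by apply/funext => b; rewrite mxE.
by elim/ord4P: i; elim/ord4P: j; do ?[exact: ca|exact: cNa|exact: cst_continuous].
Qed.

Lemma mulJE u a : [/\ (u *m J a) 0 0 = - u 0 1 * a 0 2 + u 0 2 * a 0 0 + u 0 3 * a 0 1,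
  (u *m J a) 0 1 = u 0 0 * a 0 2 + u 0 2 * a 0 1 - u 0 3 * a 0 0,
  (u *m J a) 0 2 = u 0 0 * a 0 0 + u 0 1 * a 0 1 - u 0 3 * a 0 2 &
  (u *m J a) 0 3 = u 0 0 * a 0 1 - u 0 1 * a 0 0 + u 0 2 * a 0 2].
Proof. by split; rewrite !mxE sum4 !mxE /=; ring. Qed.

(** The J(a) multiply like imaginary split quaternions. The symmetric part makes u |-> u J(a)
    isometric up to scale, and the antisymmetric part gives the commutator -2 J(a x b), the source
    of the constant in [alpha_curl]. *)
Lemma mulJ_mulJ u a b : u *m J a *m J b = pform a b *: u - u *m J (cross a b).
Proof.
have [e0 e1 e2 e3] := mulJE u a; have [f0 f1 f2 f3] := mulJE (u *m J a) b.
have [g0 g1 g2 g3] := mulJE u (cross a b).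
have E (k : 'I_4) M : (pform a b *: u - M) 0 k = pform a b * u 0 k - M 0 k by rewrite !mxE.
apply/matrixP => i j; rewrite (ord1 i) E; elim/ord4P: j; rewrite ?f0 ?f1 ?f2 ?f3 ?e0 ?e1 ?e2 ?e3 ?g0 ?g1 ?g2 ?g3.
all: by rewrite pform3E !mxE /=; ring.
Qed.

Lemma J_J a b : J a *m J b = (pform a b)%:M - J (cross a b).
Proof.
by apply/row_matrixP => i; rewrite !rowE mulmxA mulJ_mulJ mulmxBr mul_mx_scalar.
Qed.

Lemma pform_J_skew u v a : pform (u *m J a) v = - pform u (v *m J a).
Proof.
have [e0 e1 e2 e3] := mulJE u a; have [f0 f1 f2 f3] := mulJE v a.
by rewrite !pform4E e0 e1 e2 e3 f0 f1 f2 f3; ring.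
Qed.

Lemma pform_J_self u a : pform (u *m J a) u = 0.
Proof. by have := pform_J_skew u u a; rewrite [pform u _]pformC; lra. Qed.

Lemma pform_JJ u a b : pform (u *m J a) (u *m J b) = - pform a b * pform u u.
Proof.
by rewrite pform_J_skew mulJ_mulJ pformBr pformZr (pformC u (_ *m _)) pform_J_self (pformC b); ring.
Qed.

(** For an oriented orthonormal tangent basis the cross product is -X. Then the last term cancels
    the bivector of the normal and psi in the Gauss map, and what is left is [Omega] of X. *)
Lemma wedge_JJ psi a b : wedge (psi *m J a) (psi *m J b) =
  pform psi psi *: Omega (cross a b) + wedge (psi *m J (cross a b)) psi.
Proof.
have [e0 e1 e2 e3] := mulJE psi a; have [f0 f1 f2 f3] := mulJE psi b.
have [g0 g1 g2 g3] := mulJE psi (cross a b).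
apply/matrixP => i j; rewrite [RHS]mxE [X in X + _]mxE !wedgeE.
elim/ord4P: i; elim/ord4P: j.
all: rewrite ?f0 ?f1 ?f2 ?f3 ?e0 ?e1 ?e2 ?e3 ?g0 ?g1 ?g2 ?g3 pform4E !mxE /=; ring.
Qed.

Lemma Omega_skew a : (Omega a)^T = - Omega a.
Proof. by apply/matrixP => i j; elim/ord4P: i; elim/ord4P: j; rewrite !mxE /=; ring. Qed.

Lemma ord3P (P : 'I_3 -> Prop) : P 0 -> P 1 -> P 2 -> forall i, P i.
Proof.
move=> h0 h1 h2 [[|[|[|//]]] i].
- by rewrite (_ : Ordinal i = 0) //; exact: val_inj.
- by rewrite (_ : Ordinal i = 1) //; exact: val_inj.
- by rewrite (_ : Ordinal i = 2) //; exact: val_inj.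
Qed.

Lemma coord_plus_Omega a : coord_plus ((Num.sqrt 2)^-1 *: Omega a) = a.
Proof.
have s2 : (Num.sqrt 2 : R) ^+ 2 = 2 by rewrite sqr_sqrtr.
have s0 : (Num.sqrt 2 : R) != 0 by rewrite sqrtr_eq0 -ltNge.
have q2 : (Num.sqrt 2 : R)^-1 ^+ 2 * 2 = 1 by rewrite exprVn s2 mulVf.
have sk : ((Num.sqrt 2)^-1 *: Omega a)^T = - ((Num.sqrt 2)^-1 *: Omega a).
  by rewrite linearZ /= Omega_skew scalerN.
apply/rowP; elim/ord3P; rewrite mxE (gLambda_skewE sk (basis_plus_skew _)).
all: rewrite /basis_plus /= !(mxE, big_ord1) /=; move: (Num.sqrt 2)^-1 q2 => q q2.
- by transitivity ((q ^+ 2 * 2) * a 0 0); [ring|rewrite q2 mul1r].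
- by transitivity ((q ^+ 2 * 2) * a 0 1); [ring|rewrite q2 mul1r].
- by transitivity ((q ^+ 2 * 2) * a 0 2); [ring|rewrite q2 mul1r].
Qed.

Lemma det4_J psi a b c : det4 (psi *m J a) (psi *m J b) psi (psi *m J c) =
  pform psi psi ^+ 2 * pform (cross a b) c.
Proof.
rewrite -wedge4_wedge wedge_JJ; set d := cross a b.
have [e0 e1 e2 e3] := mulJE psi c; have [g0 g1 g2 g3] := mulJE psi d.
have E i j : (pform psi psi *: Omega d + wedge (psi *m J d) psi) i j =
    pform psi psi * Omega d i j + ((psi *m J d) 0 i * psi 0 j - psi 0 i * (psi *m J d) 0 j).
  by rewrite mxE [X in X + _]mxE wedgeE.
have O i j : Omega d i j = nth 0 (nth [::] [:: [:: 0; d 0 2; d 0 0; d 0 1];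
    [:: - d 0 2; 0; d 0 1; - d 0 0]; [:: - d 0 0; - d 0 1; 0; - d 0 2];
    [:: - d 0 1; d 0 0; d 0 2; 0]] i) j by rewrite mxE.
rewrite /wedge4 !E !wedgeE g0 g1 g2 g3 e0 e1 e2 e3 pform4E pform3E !O /=; clearbody d.
by ring.
Qed.

End SelfDual.

(** * Calculus in a chart *)

Section DeriveRules.
Context {R : realType} {V : normedModType R}.
Implicit Types (q v : V).

Lemma is_derive_pform n (F G : V -> 'rV[R]_n) q v dF dG :
  is_derive q v F dF -> is_derive q v G dG ->
  is_derive q v (fun x => pform (F x) (G x) : R^o) (pform dF (G q) + pform (F q) dG).
Proof.
move=> /is_derive_mx HF /is_derive_mx HG.
pose e (i : 'I_n) : R := if (i < 2)%N then 1 else -1.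
rewrite (_ : (fun x => _) = \sum_i (fun x => e i * (F x 0 i * G x 0 i) : R^o)); last first.
  by apply/funext => y; rewrite fct_sumE; apply: eq_bigr => i _; rewrite mulrA.
have H i : is_derive q v (fun x => e i * (F x 0 i * G x 0 i) : R^o)
    (e i * (dF 0 i * G q 0 i + F q 0 i * dG 0 i)).
  apply: is_derive_eq (is_deriveZ (e i) (is_deriveM (HF 0 i) (HG 0 i))) _.
  by rewrite /GRing.scale /= addrC; congr (_ * (_ + _)); rewrite mulrC.
apply: is_derive_eq (is_derive_sum H) _.
rewrite /pform -big_split; apply: eq_bigr => i _.
by rewrite /e /= mulrDr !mulrA.
Qed.

Lemma is_derive_scale m n (f : V -> R^o) (F : V -> 'M[R]_(m, n)) q v df dF :
  is_derive q v f df -> is_derive q v F dF ->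
  is_derive q v (fun x => f x *: F x) (df *: F q + f q *: dF).
Proof.
move=> Hf /is_derive_mx HF; apply/is_derive_mx => i j.
rewrite (_ : (fun x => _) = (fun x => f x * F x i j : R^o)); last first.
  by apply/funext => y; rewrite mxE.
apply: is_derive_eq (is_deriveM Hf (HF i j)) _.
by rewrite !mxE /GRing.scale /= addrC; congr (_ + _); rewrite mulrC.
Qed.

Lemma is_derive_cross (F G : V -> 'rV[R]_3) q v dF dG :
  is_derive q v F dF -> is_derive q v G dG ->
  is_derive q v (fun x => cross (F x) (G x)) (cross dF (G q) + cross (F q) dG).
Proof.
move=> /is_derive_mx HF /is_derive_mx HG; apply/is_derive_mx => i j; rewrite (ord1 i).
pose P (a b : 'I_3) := is_deriveB (is_deriveM (HF 0 a) (HG 0 b)) (is_deriveM (HF 0 b) (HG 0 a)).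
elim/ord3P: j.
- rewrite (_ : (fun x => _) = (fun x => F x 0 1) * (fun x => G x 0 2)
    - (fun x => F x 0 2) * (fun x => G x 0 1)); last first.
    by apply/funext => y; rewrite mxE.
  apply: is_derive_eq (P 1 2) _; rewrite !mxE /= /GRing.scale /=; ring.
- rewrite (_ : (fun x => _) = (fun x => F x 0 2) * (fun x => G x 0 0)
    - (fun x => F x 0 0) * (fun x => G x 0 2)); last first.
    by apply/funext => y; rewrite mxE.
  apply: is_derive_eq (P 2 0) _; rewrite !mxE /= /GRing.scale /=; ring.
- rewrite (_ : (fun x => _) = (fun x => F x 0 1) * (fun x => G x 0 0)
    - (fun x => F x 0 0) * (fun x => G x 0 1)); last first.
    by apply/funext => y; rewrite mxE.
  apply: is_derive_eq (P 1 0) _; rewrite !mxE /= /GRing.scale /=; ring.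
Qed.

Lemma is_derive_linear (W W' : normedModType R) (L : {linear W -> W'}) (f : V -> W) q v df :
  continuous L -> differentiable f q -> is_derive q v f df ->
  is_derive q v (fun x => L (f x)) (L df).
Proof.
move=> cL Df [_ <-]; have [D E] := derive_linear v cL Df.
by apply: DeriveDef; [exact: diff_derivable|exact: E].
Qed.

End DeriveRules.

Section SmoothMatrix.
Context {R : realType}.

Definition entry m n (i : 'I_m) (j : 'I_n) (M : 'M[R]_(m, n)) : R^o := M i j.
Lemma entry_is_linear m n i j : linear (@entry m n i j).
Proof. by move=> k M N; rewrite /entry !mxE. Qed.
HB.instance Definition _ m n i j :=
  GRing.isLinear.Build R 'M[R]_(m, n) R^o *:%R (@entry m n i j) (@entry_is_linear m n i j).

Definition along (W : lmodType R) (w : W) (r : R^o) : W := r *: w.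
Lemma along_is_linear (W : lmodType R) (w : W) : linear (along w).
Proof. by move=> k r s; rewrite /along scalerDl scalerA. Qed.
HB.instance Definition _ (W : lmodType R) (w : W) :=
  GRing.isLinear.Build R R^o W *:%R (along w) (along_is_linear w).

Lemma along_continuous (W : normedModType R) (w : W) : continuous (along w).
Proof. by move=> r; apply: cvgZr_tmp; exact: cvg_id. Qed.

Context {V : normedModType R} (U : set V) (oU : open U).

Lemma Ck_entry m n k (F : V -> 'M[R]_(m, n)) i j :
  Ck k U F -> Ck k U (fun x => F x i j : R^o).
Proof.
move=> cF; have := Ck_linear (L := @entry m n i j) _ oU cF; apply.
exact: coord_continuous.
Qed.

Lemma Ck_mx m n k (F : V -> 'M[R]_(m, n)) :
  (forall i j, Ck k U (fun x => F x i j : R^o)) -> Ck k U F.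
Proof.
move=> cF.
have E : (fun x => \sum_i \sum_j along (delta_mx i j) (F x i j)) = F.
  by apply/funext => x; rewrite [RHS]matrix_sum_delta.
rewrite -E; apply: (Ck_sum oU) => i; apply: (Ck_sum oU) => j.
exact: (Ck_linear (L := along (delta_mx i j)) (@along_continuous _ _) oU (cF i j)).
Qed.

Lemma Ck_mulmx m n l k (F : V -> 'M[R]_(m, n)) (G : V -> 'M[R]_(n, l)) :
  Ck k U F -> Ck k U G -> Ck k U (fun x => F x *m G x).
Proof.
move=> cF cG; apply: Ck_mx => i j.
have P a := CkM oU (Ck_entry i a cF) (Ck_entry a j cG).
apply: (Ck_ext oU _ (Ck_sum oU P)).
by move=> x _ /=; rewrite mxE.
Qed.

Lemma smooth_entry m n (F : V -> 'M[R]_(m, n)) i j :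
  smooth_on U F -> smooth_on U (fun x => F x i j : R^o).
Proof. by move=> sF k; exact: Ck_entry. Qed.

Lemma smooth_mx m n (F : V -> 'M[R]_(m, n)) :
  (forall i j, smooth_on U (fun x => F x i j : R^o)) -> smooth_on U F.
Proof. by move=> sF k; apply: Ck_mx => i j; exact: sF. Qed.

Lemma smooth_scale m n (f : V -> R^o) (F : V -> 'M[R]_(m, n)) :
  smooth_on U f -> smooth_on U F -> smooth_on U (fun x => f x *: F x).
Proof.
move=> sf sF; apply: smooth_mx => i j.
apply: (smooth_ext oU _ (smoothM oU sf (smooth_entry i j sF))).
by move=> x _ /=; rewrite mxE.
Qed.

Lemma smooth_cross (F G : V -> 'rV[R]_3) :
  smooth_on U F -> smooth_on U G -> smooth_on U (fun x => cross (F x) (G x)).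
Proof.
move=> sF sG; apply: smooth_mx => i j.
have f k := smooth_entry 0 k sF; have g k := smooth_entry 0 k sG.
have P a b := smoothB oU (smoothM oU (f a) (g b)) (smoothM oU (f b) (g a)).
elim/ord3P: j; [apply: (smooth_ext oU _ (P 1 2))|apply: (smooth_ext oU _ (P 2 0))|
  apply: (smooth_ext oU _ (P 1 0))]; by move=> x _ /=; rewrite mxE.
Qed.

Lemma smooth_pform n (F G : V -> 'rV[R]_n) :
  smooth_on U F -> smooth_on U G -> smooth_on U (fun x => pform (F x) (G x) : R^o).
Proof.
move=> sF sG; pose e (i : 'I_n) : R^o := if (i < 2)%N then 1 else -1.
have P i := smoothM oU (smoothM oU (smooth_cst U (e i)) (smooth_entry 0 i sF))
  (smooth_entry 0 i sG).
exact: (smooth_sum oU P).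
Qed.

Lemma smooth_mulmx m n l (F : V -> 'M[R]_(m, n)) (G : V -> 'M[R]_(n, l)) :
  smooth_on U F -> smooth_on U G -> smooth_on U (fun x => F x *m G x).
Proof. by move=> sF sG k; exact: Ck_mulmx. Qed.

End SmoothMatrix.

Section ChartCalculus.
Context {R : realType} {T : topologicalType}.
Notation R2 := (R^o * R^o)%type.
Notation crangeR c := [set q : R2 | crange c (q.1 +i* q.2)].
Variables (c : chart R T) (hc : chart_axioms c).
Implicit Types (W : normedModType R) (p : T).

Notation csmooth f := (smooth_on (crangeR c) (loc c f)).

Lemma csmooth_diff W (f : T -> W) p : csmooth f -> cdom c p ->
  differentiable (loc c f) (pt c p).
Proof. by move=> sf cp; exact: (smooth_differentiable sf (pt_crange cp)). Qed.

Lemma dx_is_derive W (f : T -> W) p : csmooth f -> cdom c p ->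
  is_derive (pt c p) ((1, 0) : R2) (loc c f) (dx c f p).
Proof. by move=> sf cp; apply: DeriveDef => //; exact/diff_derivable/csmooth_diff. Qed.

Lemma dy_is_derive W (f : T -> W) p : csmooth f -> cdom c p ->
  is_derive (pt c p) ((0, 1) : R2) (loc c f) (dy c f p).
Proof. by move=> sf cp; apply: DeriveDef => //; exact/diff_derivable/csmooth_diff. Qed.

Lemma loc_dx W (f : T -> W) : {in crangeR c, 'D_((1, 0) : R2) (loc c f) =1 loc c (dx c f)}.
Proof.
move=> q /set_mem /(crangeR_pt)[p cp ->]; rewrite [RHS](loc_pt hc _ cp) //.
Qed.

Lemma loc_dy W (f : T -> W) : {in crangeR c, 'D_((0, 1) : R2) (loc c f) =1 loc c (dy c f)}.
Proof.
move=> q /set_mem /(crangeR_pt)[p cp ->]; rewrite [RHS](loc_pt hc _ cp) //.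
Qed.

Lemma csmooth_dx W (f : T -> W) : csmooth f -> csmooth (dx c f).
Proof.
move=> sf; apply: (smooth_ext (open_crangeR hc) (@loc_dx _ f)).
exact: (smooth_derive ((1, 0) : R2) sf).
Qed.

Lemma csmooth_dy W (f : T -> W) : csmooth f -> csmooth (dy c f).
Proof.
move=> sf; apply: (smooth_ext (open_crangeR hc) (@loc_dy _ f)).
exact: (smooth_derive ((0, 1) : R2) sf).
Qed.

Lemma near_crange p (P : set R2) : cdom c p -> (forall q, crangeR c q -> P q) ->
  \forall q \near pt c p, P q.
Proof.
move=> cp H; have := open_near (open_crangeR hc) (pt_crange cp); apply: filterS.
exact: H.
Qed.

Lemma dxxE W (f : T -> W) p : cdom c p -> dxx c f p = dx c (dx c f) p.
Proof.
move=> cp; apply: near_eq_derive; apply: near_crange => // q /mem_set; exact: loc_dx.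
Qed.

Lemma dxyE W (f : T -> W) p : cdom c p -> dxy c f p = dx c (dy c f) p.
Proof.
move=> cp; apply: near_eq_derive; apply: near_crange => // q /mem_set; exact: loc_dy.
Qed.

Lemma dyyE W (f : T -> W) p : cdom c p -> dyy c f p = dy c (dy c f) p.
Proof.
move=> cp; apply: near_eq_derive; apply: near_crange => // q /mem_set; exact: loc_dy.
Qed.

Lemma dyx_dxy (f : T -> R^o) p : csmooth f -> cdom c p -> dy c (dx c f) p = dx c (dy c f) p.
Proof.
move=> sf cp; apply: etrans (dxyE f cp).
apply: etrans (esym (schwarz (open_crangeR hc) (pt_crange cp) sf)).
apply/esym; apply: near_eq_derive; apply: near_crange => // q /mem_set; exact: loc_dx.
Qed.

Lemma dx_entry m n (F : T -> 'M[R]_(m, n)) i j p : csmooth F -> cdom c p ->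
  dx c F p i j = dx c (fun s => F s i j : R^o) p.
Proof.
by move=> sF cp; have /is_derive_mx/(_ i j)[_ <-] := dx_is_derive sF cp.
Qed.

Lemma dy_entry m n (F : T -> 'M[R]_(m, n)) i j p : csmooth F -> cdom c p ->
  dy c F p i j = dy c (fun s => F s i j : R^o) p.
Proof.
by move=> sF cp; have /is_derive_mx/(_ i j)[_ <-] := dy_is_derive sF cp.
Qed.

Lemma d_ext W (f g : T -> W) v p : cdom c p -> (forall s, cdom c s -> f s = g s) ->
  'D_v (loc c f) (pt c p) = 'D_v (loc c g) (pt c p).
Proof.
move=> cp fg; apply: near_eq_derive; apply: near_crange => // q /(crangeR_pt)[s cs ->].
by rewrite [LHS](loc_pt hc f cs) [RHS](loc_pt hc g cs) fg.
Qed.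

Lemma dyx_dxy_mx m n (F : T -> 'M[R]_(m, n)) p : csmooth F -> cdom c p ->
  dy c (dx c F) p = dx c (dy c F) p.
Proof.
move=> sF cp; apply/matrixP => i j.
have se : csmooth (fun s => F s i j : R^o) := smooth_entry (open_crangeR hc) i j sF.
apply: (etrans (dy_entry i j (csmooth_dx sF) cp)).
apply: etrans (esym (dx_entry i j (csmooth_dy sF) cp)).
apply: (etrans (d_ext ((0, 1) : R2) cp (fun s cs => dx_entry i j sF cs))).
apply: (etrans (dyx_dxy se cp)).
by apply: (d_ext ((1, 0) : R2) cp) => s cs; rewrite (dy_entry i j sF cs).
Qed.

Definition der c p (v : R2) W (f : T -> W) (d : W) := is_derive (pt c p) v (loc c f) d.

Variables (p : T) (cp : cdom c p) (v : R2).

Lemma locE W (f : T -> W) : loc c f (pt c p) = f p.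
Proof. exact: (loc_pt hc f cp). Qed.

Lemma der_eq W (f : T -> W) d d' : der c p v f d -> d = d' -> der c p v f d'.
Proof. by move=> H <-. Qed.

Lemma der_ext W (f g : T -> W) d : (forall s, cdom c s -> f s = g s) ->
  der c p v f d -> der c p v g d.
Proof.
move=> fg; apply: near_eq_is_derive; apply: (near_crange cp) => q /(crangeR_pt)[s cs ->].
by rewrite [LHS](loc_pt hc f cs) [RHS](loc_pt hc g cs) fg.
Qed.

(** The way an identity valid on a chart is differentiated: the Leibniz rules compute d, and
    constancy makes it zero. All structure equations arise in this manner. *)
Lemma der_cst W (f : T -> W) k d : (forall s, cdom c s -> f s = k) -> der c p v f d -> d = 0.
Proof. by move=> fk /(der_ext fk) [_ <-]; exact: derive_cst. Qed.

Lemma derD W (f g : T -> W) d e : der c p v f d -> der c p v g e ->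
  der c p v (fun s => f s + g s) (d + e).
Proof. by move=> Hf Hg; exact: is_deriveD. Qed.

Lemma derB W (f g : T -> W) d e : der c p v f d -> der c p v g e ->
  der c p v (fun s => f s - g s) (d - e).
Proof. by move=> Hf Hg; exact: is_deriveB. Qed.

Lemma derM (f g : T -> R^o) d e : der c p v f d -> der c p v g e ->
  der c p v (fun s => f s * g s : R^o) (d * g p + f p * e).
Proof.
move=> Hf Hg; apply: is_derive_eq (is_deriveM Hf Hg) _.
by rewrite !locE addrC; congr (_ + _); rewrite /GRing.scale /= mulrC.
Qed.

(** Obtained by differentiating f g = 1, which is legitimate because g is assumed differentiable. *)
Lemma derV (f g : T -> R^o) d : (forall s, cdom c s -> f s * g s = 1) ->
  differentiable (loc c g) (pt c p) -> der c p v f d -> der c p v g (- (g p ^+ 2 * d)).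
Proof.
move=> fg Dg Hf; have Hg : der c p v g ('D_v (loc c g) (pt c p)).
  by apply: DeriveDef => //; exact: diff_derivable.
move: ('D_v _ _) Hg => e Hg; apply: (der_eq Hg).
have := der_cst fg (derM Hf Hg) => /(congr1 ( *%R (g p))).
rewrite mulr0 mulrDr (mulrA (g p) (f p)) (mulrC (g p) (f p)) (fg p cp) mul1r.
by move/eqP; rewrite addrC addr_eq0 => /eqP ->; congr (- _); ring.
Qed.

Lemma der_pform n (F G : T -> 'rV[R]_n) d e : der c p v F d -> der c p v G e ->
  der c p v (fun s => pform (F s) (G s) : R^o) (pform d (G p) + pform (F p) e).
Proof.
by move=> HF HG; apply: is_derive_eq (is_derive_pform HF HG) _; rewrite !locE.
Qed.

Lemma der_scale m n (f : T -> R^o) (F : T -> 'M[R]_(m, n)) d e :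
  der c p v f d -> der c p v F e ->
  der c p v (fun s => f s *: F s) (d *: F p + f p *: e).
Proof.
by move=> HF HG; apply: is_derive_eq (is_derive_scale HF HG) _; rewrite !locE.
Qed.

Lemma der_cross (F G : T -> 'rV[R]_3) d e : der c p v F d -> der c p v G e ->
  der c p v (fun s => cross (F s) (G s)) (cross d (G p) + cross (F p) e).
Proof.
by move=> HF HG; apply: is_derive_eq (is_derive_cross HF HG) _; rewrite !locE.
Qed.

Lemma der_mulmx m n l (F : T -> 'M[R]_(m, n)) (G : T -> 'M[R]_(n, l)) d e :
  der c p v F d -> der c p v G e ->
  der c p v (fun s => F s *m G s) (d *m G p + F p *m e).
Proof.
by move=> HF HG; apply: is_derive_eq (is_derive_mulmx HF HG) _; rewrite !locE.
Qed.

Lemma der_linear W W' (L : {linear W -> W'}) (f : T -> W) d : continuous L ->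
  differentiable (loc c f) (pt c p) -> der c p v f d -> der c p v (fun s => L (f s)) (L d).
Proof. by move=> cL Df Hf; exact: is_derive_linear. Qed.

End ChartCalculus.

(** * The structure equations of a minimal immersion *)

Lemma conformal_trace_eq0 (R : realType) (a b d E F G : R) : E = G -> F = 0 -> 0 < E ->
  (a * G - 2 * b * F + d * E) / (2 * (E * G - F ^+ 2)) = 0 -> a + d = 0.
Proof.
move=> <- -> E0; rewrite mulr0 subr0 expr0n /= subr0 -mulrDl => /eqP.
rewrite mulf_eq0 invr_eq0 !mulf_eq0 pnatr_eq0 (gt_eqF E0) /= !orbF.
by move/eqP.
Qed.

Section Linear.
Context {R : realType}.
Implicit Types a b k l m : R.

(** The linear parts of the structure equations are isolated over plain reals, so that [lra] treats
    every derivative as an atom. *)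
Lemma codazzi_symm a b b' m k l k' l' :
  a + b + (m + k * l) = 0 -> a + b' + (m + k' * l') = 0 -> b + l * k = b' + l' * k'.
Proof. lra. Qed.

Lemma codazzi_trace a a' b b' m m' n k l k' l' :
  a + b + (m * n + k * l) = 0 -> a' + b' + (m' * n + k' * l') = 0 ->
  a + a' + (m + m') * n = 0 -> b + l * k + (b' + l' * k') = 0.
Proof. lra. Qed.

Lemma conf_derivative a b k l k' l' :
  a + a + (k * l + l * k) - (b + b + (k' * l' + l' * k')) = 0 -> a + k * l = b + k' * l'.
Proof. lra. Qed.

Lemma tension_fst a b b' k l m m' n :
  a + m * k = b + n * l -> b + b' + (n * l + m' * k) = 0 ->
  a + b' + (m + m') * k = 0.
Proof. lra. Qed.

Lemma tension_snd a b b' k l m m' n :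
  a + m * k = b + n * l -> b' + a + (m' * l + m * k) = 0 ->
  b' + b + (m' + n) * l = 0.
Proof. lra. Qed.

End Linear.

Section StructureEquations.
Context {R : realType} {T : topologicalType}.
Notation R2 := (R^o * R^o)%type.
Notation L3R := ('rV[R]_3 * R^o)%type.
Notation crangeR c := [set q : R2 | crange c (q.1 +i* q.2)].
Variables (A : set (chart R T)) (hS : riemann_surface A) (phi N : T -> L3R).
Hypothesis hphi : conformal_immersion A (@H2R R) (@gH2R R) phi.
Hypothesis hmin : zero_mean_curvature A (@TH2R R) (@gH2R R) 1 phi.
Hypothesis hN : unit_normal_field A (@TH2R R) (@gH2R R) 1 phi N.
Hypothesis hnu : forall p, gH2R (N p) (@dt R) ^+ 2 < 1.

Definition hyp_part p : 'rV[R]_3 := (phi p).1.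
Definition height p : R^o := (phi p).2.
Definition normal_hyp p : 'rV[R]_3 := (N p).1.
Definition angle p : R^o := (N p).2.
Definition conormal p := cross (normal_hyp p) (hyp_part p).
Notation X := hyp_part.
Notation h := height.
Notation nv := normal_hyp.
Notation nu := angle.

Lemma X_X p : pform (X p) (X p) = -1.
Proof. by have [_ H _] := hphi; have [] := H p. Qed.

Lemma X_nv p : pform (X p) (nv p) = 0.
Proof. by have [_ H] := hN; have [] := H p. Qed.

Lemma nv_nv p : pform (nv p) (nv p) = 1 - nu p ^+ 2.
Proof. by have [_ H] := hN; have [_ E _] := H p; rewrite -E /gH2R /angle; ring. Qed.

Lemma nu2_lt1 p : nu p ^+ 2 < 1.
Proof. by have := hnu p; rewrite /gH2R /dt /= pformC pform0l add0r mulr1. Qed.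

Lemma w_gt0 p : 0 < 1 - nu p ^+ 2. Proof. by rewrite subr_gt0 nu2_lt1. Qed.

Lemma one_sub_nu p : 1 - nu p != 0.
Proof.
apply/eqP => e; have := nu2_lt1 p; have -> : nu p = 1 by move: e; lra.
by rewrite expr1n ltxx.
Qed.

Section AtPoint.
Variables (c : chart R T) (Ac : A c).
Let hc := rs_chart hS Ac.
Notation csmooth f := (smooth_on (crangeR c) (loc c f : R2 -> _)).

Lemma smooth_phi : csmooth phi. Proof. by have [H _ _] := hphi; exact: H. Qed.
Lemma smooth_N : csmooth N. Proof. by have [H _] := hN; exact: H. Qed.

Lemma fst_cts : continuous (fst : L3R -> 'rV[R]_3). Proof. by move=> x; exact: cvg_fst. Qed.
Lemma snd_cts : continuous (snd : L3R -> R^o). Proof. by move=> x; exact: cvg_snd. Qed.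

Lemma smooth_X : csmooth X.
Proof. exact: (smooth_linear (L := fst) (open_crangeR hc) fst_cts smooth_phi). Qed.
Lemma smooth_h : csmooth h.
Proof. exact: (smooth_linear (L := snd) (open_crangeR hc) snd_cts smooth_phi). Qed.
Lemma smooth_nv : csmooth nv.
Proof. exact: (smooth_linear (L := fst) (open_crangeR hc) fst_cts smooth_N). Qed.
Lemma smooth_nu : csmooth nu.
Proof. exact: (smooth_linear (L := snd) (open_crangeR hc) snd_cts smooth_N). Qed.

Lemma D_split (f : T -> L3R) v p : csmooth f -> cdom c p ->
  'D_v (loc c f) (pt c p) = ('D_v (loc c (fun s => (f s).1)) (pt c p),
                             'D_v (loc c (fun s => (f s).2)) (pt c p)).
Proof.
move=> sf cp; have df := csmooth_diff sf cp.
have [_ e1] := derive_linear (L := fst) v fst_cts df.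
have [_ e2] := derive_linear (L := snd) v snd_cts df.
have -> : 'D_v (loc c (fun s => (f s).1)) (pt c p) = ('D_v (loc c f) (pt c p)).1 by exact: e1.
have -> : 'D_v (loc c (fun s => (f s).2)) (pt c p) = ('D_v (loc c f) (pt c p)).2 by exact: e2.
by case: ('D_v _ _).
Qed.

Variables (p : T) (cp : cdom c p).
Lemma X_derive v d : der c p v X d -> pform d (X p) = 0.
Proof.
move=> Dd; have := der_cst hc cp (fun s _ => X_X s) (der_pform hc cp Dd Dd).
by rewrite [pform (X p) d]pformC; lra.
Qed.

Lemma nv_derive_nv v d dnu : der c p v nv d -> der c p v nu dnu ->
  pform d (nv p) = - (nu p * dnu).
Proof.
move=> Dd Dnu.
have H : forall s, cdom c s -> pform (nv s) (nv s) + nu s * nu s = 1 :> R^o.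
  by move=> s _; rewrite nv_nv; ring.
have := der_cst hc cp H (derD (der_pform hc cp Dd Dd) (derM hc cp Dnu Dnu)).
by rewrite [pform (nv p) d]pformC; lra.
Qed.

Lemma nv_derive_X v dX dn : der c p v X dX -> der c p v nv dn ->
  pform dn (X p) = - pform dX (nv p).
Proof.
move=> DX Dn; have := der_cst hc cp (fun s _ => X_nv s) (der_pform hc cp DX Dn).
by rewrite [pform (X p) dn]pformC; lra.
Qed.

Lemma dxX_nv s : cdom c s -> pform (dx c X s) (nv s) + dx c h s * nu s = 0.
Proof.
move=> cs; have [_ H] := hN; have [_ _ /(_ c Ac cs)[e _]] := H s.
by move: e; rewrite /gH2R /dx (D_split _ smooth_phi cs).
Qed.

Lemma dyX_nv s : cdom c s -> pform (dy c X s) (nv s) + dy c h s * nu s = 0.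
Proof.
move=> cs; have [_ H] := hN; have [_ _ /(_ c Ac cs)[_ e]] := H s.
by move: e; rewrite /gH2R /dy (D_split _ smooth_phi cs).
Qed.

Lemma conf_eq s : cdom c s ->
  pform (dx c X s) (dx c X s) + dx c h s * dx c h s =
  pform (dy c X s) (dy c X s) + dy c h s * dy c h s.
Proof.
move=> cs; have [_ _ H] := hphi; have [e _ _] := H c s Ac cs.
by move: e; rewrite /gH2R /dx /dy !(D_split _ smooth_phi cs).
Qed.

Lemma conf_orth s : cdom c s ->
  pform (dx c X s) (dy c X s) + dx c h s * dy c h s = 0.
Proof.
move=> cs; have [_ _ H] := hphi; have [_ e _] := H c s Ac cs.
by move: e; rewrite /gH2R /dx /dy !(D_split _ smooth_phi cs).
Qed.

Lemma conf_gt0 s : cdom c s -> 0 < pform (dx c X s) (dx c X s) + dx c h s * dx c h s.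
Proof.
move=> cs; have [_ _ H] := hphi; have [_ _ e] := H c s Ac cs.
by move: e; rewrite /gH2R /dx !(D_split _ smooth_phi cs).
Qed.

Lemma normal_laplacian : pform (dx c (dx c X) p + dy c (dy c X) p) (nv p)
  + (dx c (dx c h) p + dy c (dy c h) p) * nu p = 0.
Proof.
have un : unit_normal_at A (@TH2R R) (@gH2R R) 1 phi p (N p) by have [_ H] := hN.
have [_ _ H] := hphi; have [e1 e2 e3] := H c p Ac cp.
have := conformal_trace_eq0 e1 e2 e3 (hmin Ac cp un).
have dxxp : dxx c phi p = (dx c (dx c X) p, dx c (dx c h) p).
  apply: etrans (dxxE hc phi cp) _; apply: etrans (D_split _ (csmooth_dx hc smooth_phi) cp) _.
  by congr (_, _); apply: (d_ext hc _ cp) => s cs; rewrite /dx (D_split _ smooth_phi cs).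
have dyyp : dyy c phi p = (dy c (dy c X) p, dy c (dy c h) p).
  apply: etrans (dyyE hc phi cp) _; apply: etrans (D_split _ (csmooth_dy hc smooth_phi) cp) _.
  by congr (_, _); apply: (d_ext hc _ cp) => s cs; rewrite /dy (D_split _ smooth_phi cs).
rewrite dxxp dyyp /gH2R => E; apply: etrans E.
by rewrite pformDl mulrDl addrACA.
Qed.

Let sX := smooth_X. Let sh := smooth_h. Let sn := smooth_nv. Let snu := smooth_nu.
Let sXx := csmooth_dx hc sX. Let sXy := csmooth_dy hc sX.
Let shx := csmooth_dx hc sh. Let shy := csmooth_dy hc sh.

Lemma dxX_X : pform (dx c X p) (X p) = 0. Proof. exact: X_derive (dx_is_derive sX cp). Qed.
Lemma dyX_X : pform (dy c X p) (X p) = 0. Proof. exact: X_derive (dy_is_derive sX cp). Qed.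

Lemma dxnv_nv : pform (dx c nv p) (nv p) = - (nu p * dx c nu p).
Proof. exact: nv_derive_nv (dx_is_derive sn cp) (dx_is_derive snu cp). Qed.
Lemma dynv_nv : pform (dy c nv p) (nv p) = - (nu p * dy c nu p).
Proof. exact: nv_derive_nv (dy_is_derive sn cp) (dy_is_derive snu cp). Qed.

Lemma dxnv_X : pform (dx c nv p) (X p) = dx c h p * nu p.
Proof.
rewrite (nv_derive_X (dx_is_derive sX cp) (dx_is_derive sn cp)).
by have := dxX_nv cp; lra.
Qed.
Lemma dynv_X : pform (dy c nv p) (X p) = dy c h p * nu p.
Proof.
rewrite (nv_derive_X (dy_is_derive sX cp) (dy_is_derive sn cp)).
by have := dyX_nv cp; lra.
Qed.

Lemma dxX_nv_derive v dXx dn dhx dnu :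
  der c p v (dx c X) dXx -> der c p v nv dn -> der c p v (dx c h) dhx -> der c p v nu dnu ->
  pform dXx (nv p) + pform dn (dx c X p) + (dhx * nu p + dx c h p * dnu) = 0.
Proof.
move=> D1 D2 D3 D4; rewrite (pformC dn).
exact: (der_cst hc cp dxX_nv (derD (der_pform hc cp D1 D2) (derM hc cp D3 D4))).
Qed.

Lemma dyX_nv_derive v dXy dn dhy dnu :
  der c p v (dy c X) dXy -> der c p v nv dn -> der c p v (dy c h) dhy -> der c p v nu dnu ->
  pform dXy (nv p) + pform dn (dy c X p) + (dhy * nu p + dy c h p * dnu) = 0.
Proof.
move=> D1 D2 D3 D4; rewrite (pformC dn).
exact: (der_cst hc cp dyX_nv (derD (der_pform hc cp D1 D2) (derM hc cp D3 D4))).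
Qed.

(** Differentiate the orthogonality of N to phi_y in x and to phi_x in y; the terms with second
    derivatives of phi coincide by Schwarz. *)
Lemma second_form_symm : pform (dx c nv p) (dy c X p) + dx c nu p * dy c h p =
  pform (dy c nv p) (dx c X p) + dy c nu p * dx c h p.
Proof.
have e1 := dyX_nv_derive (dx_is_derive sXy cp) (dx_is_derive sn cp)
  (dx_is_derive shy cp) (dx_is_derive snu cp).
have e2 := dxX_nv_derive (dy_is_derive sXx cp) (dy_is_derive sn cp)
  (dy_is_derive shx cp) (dy_is_derive snu cp).
rewrite (dyx_dxy_mx hc sX cp) (dyx_dxy hc sh cp) in e2.
exact: (codazzi_symm e1 e2).
Qed.

Lemma second_form_trace : pform (dx c nv p) (dx c X p) + dx c nu p * dx c h p +
  (pform (dy c nv p) (dy c X p) + dy c nu p * dy c h p) = 0.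
Proof.
have e1 := dxX_nv_derive (dx_is_derive sXx cp) (dx_is_derive sn cp)
  (dx_is_derive shx cp) (dx_is_derive snu cp).
have e2 := dyX_nv_derive (dy_is_derive sXy cp) (dy_is_derive sn cp)
  (dy_is_derive shy cp) (dy_is_derive snu cp).
have e3 := normal_laplacian; rewrite pformDl in e3.
exact: (codazzi_trace e1 e2 e3).
Qed.

(** A consequence of conformality alone: differentiating |phi_x|^2 = |phi_y|^2 and the orthogonality
    of phi_x and phi_y shows that the Laplacian of phi has no tangential part. *)
Lemma tangent_laplacian :
  pform (dx c (dx c X) p + dy c (dy c X) p) (dx c X p)
    + (dx c (dx c h) p + dy c (dy c h) p) * dx c h p = 0 /\
  pform (dx c (dx c X) p + dy c (dy c X) p) (dy c X p)
    + (dx c (dx c h) p + dy c (dy c h) p) * dy c h p = 0.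
Proof.
have conf0 s : cdom c s -> (pform (dx c X s) (dx c X s) + dx c h s * dx c h s) -
    (pform (dy c X s) (dy c X s) + dy c h s * dy c h s) = 0 :> R^o.
  by move=> cs; apply/eqP; rewrite subr_eq0; apply/eqP; exact: conf_eq.
have conf_d v xx xy hx hy : der c p v (dx c X) xx -> der c p v (dy c X) xy ->
    der c p v (dx c h) hx -> der c p v (dy c h) hy ->
    pform xx (dx c X p) + hx * dx c h p = pform xy (dy c X p) + hy * dy c h p.
  move=> D1 D2 D3 D4; apply: conf_derivative.
  have := der_cst hc cp conf0 (derB
    (derD (der_pform hc cp D1 D1) (derM hc cp D3 D3))
    (derD (der_pform hc cp D2 D2) (derM hc cp D4 D4))).
  by rewrite (pformC _ xx) (pformC _ xy).
have orth_d v xx xy hx hy : der c p v (dx c X) xx -> der c p v (dy c X) xy ->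
    der c p v (dx c h) hx -> der c p v (dy c h) hy ->
    pform xx (dy c X p) + pform xy (dx c X p) + (hx * dy c h p + hy * dx c h p) = 0.
  move=> D1 D2 D3 D4; rewrite (pformC xy) (mulrC hy).
  exact: (der_cst hc cp conf_orth (derD (der_pform hc cp D1 D2) (derM hc cp D3 D4))).
have Dyx : der c p ((0, 1) : R2) (dx c X) (dx c (dy c X) p).
  by rewrite -(dyx_dxy_mx hc sX cp); exact: dy_is_derive.
have dyx : der c p ((0, 1) : R2) (dx c h) (dx c (dy c h) p).
  by rewrite -(dyx_dxy hc sh cp); exact: dy_is_derive.
have Dx := dx_is_derive sXx cp; have Dxy := dx_is_derive sXy cp; have Dy := dy_is_derive sXy cp.
have dx := dx_is_derive shx cp; have dxy := dx_is_derive shy cp; have dy := dy_is_derive shy cp.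
have c1 := conf_d _ _ _ _ _ Dx Dxy dx dxy; have c2 := conf_d _ _ _ _ _ Dyx Dy dyx dy.
have o1 := orth_d _ _ _ _ _ Dx Dxy dx dxy; have o2 := orth_d _ _ _ _ _ Dyx Dy dyx dy.
by rewrite !pformDl; split; [exact: (tension_fst c1 o2)|exact: (tension_snd c2 o1)].
Qed.

End AtPoint.
End StructureEquations.

Lemma chart_continuous {R : realType} {T : topologicalType} (c : chart R T)
  (W : normedModType R) (f : T -> W) p : chart_axioms c -> cdom c p ->
  differentiable (loc c f) (pt c p) -> {for p, continuous f}.
Proof.
move=> hc cp /differentiable_continuous df.
have cc : loc c f (pt c r) @[r --> p] --> loc c f (pt c p).
  exact: (continuous_comp (pt_continuous hc cp) df).
rewrite (locE hc cp) in cc; apply: cvg_trans cc; apply: near_eq_cvg.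
by apply: filterS (near_cdom hc cp) => r cr; exact: (loc_pt hc f cr).
Qed.

Lemma orient_comb (R : realType) n (r s : R) (hx hy : R^o) (u v w : 'rV[R]_n) :
  (- s *: hx + r *: hy) * pform (r *: u + s *: v) w -
  (r *: hx + s *: hy) * pform (- s *: u + r *: v) w =
  (r ^+ 2 + s ^+ 2) * (hy * pform u w - hx * pform v w).
Proof. by rewrite !pformE /GRing.scale /=; ring. Qed.

(** * A coherent choice of the unit normal *)

Section Orientation.
Context {R : realType} {T : topologicalType}.
Notation R2 := (R^o * R^o)%type.
Notation L3R := ('rV[R]_3 * R^o)%type.
Notation crangeR c := [set q : R2 | crange c (q.1 +i* q.2)].
Variables (A : set (chart R T)) (hS : riemann_surface A) (phi N : T -> L3R).
Hypothesis hphi : conformal_immersion A (@H2R R) (@gH2R R) phi.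
Hypothesis hN : unit_normal_field A (@TH2R R) (@gH2R R) 1 phi N.
Hypothesis hnu : forall p, gH2R (N p) (@dt R) ^+ 2 < 1.
Let X := hyp_part phi. Let h := height phi. Let nv := normal_hyp N. Let nu := angle N. Let C := conormal phi N.

(* By [orientation_alternative] this is h_x^2 + h_y^2 up to sign; the sign tells which
   case of the alternative holds. *)
Definition orient c p : R^o :=
  dy c h p * pform (dx c X p) (C p) - dx c h p * pform (dy c X p) (C p).

Lemma dxX_nvE c p : A c -> cdom c p -> pform (dx c X p) (nv p) = - (dx c h p * nu p).
Proof. by move=> Ac cp; apply/eqP; rewrite -addr_eq0; apply/eqP; exact: (dxX_nv hphi hN Ac cp). Qed.

Lemma dyX_nvE c p : A c -> cdom c p -> pform (dy c X p) (nv p) = - (dy c h p * nu p).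
Proof. by move=> Ac cp; apply/eqP; rewrite -addr_eq0; apply/eqP; exact: (dyX_nv hphi hN Ac cp). Qed.

Lemma orient_neq0 c p : A c -> cdom c p -> orient c p != 0.
Proof.
move=> Ac cp; exact: (orientation_neq0 (X_X hphi p) (X_nv hN p) (nv_nv hN p) (erefl _)
  (lt0r_neq0 (w_gt0 hnu p)) (dxX_X hS hphi Ac cp) (dyX_X hS hphi Ac cp)
  (dxX_nvE Ac cp) (dyX_nvE Ac cp) (conf_eq hphi Ac cp) (conf_orth hphi Ac cp)
  (conf_gt0 hphi Ac cp)).
Qed.

Lemma smooth_C c : A c -> smooth_on (crangeR c) (loc c C).
Proof.
move=> Ac; have oU := open_crangeR (rs_chart hS Ac).
exact: (smooth_cross oU (smooth_nv hS hN Ac) (smooth_X hS hphi Ac)).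
Qed.

Lemma smooth_orient c : A c -> smooth_on (crangeR c) (loc c (orient c)).
Proof.
move=> Ac; have hc := rs_chart hS Ac; have oU := open_crangeR hc.
have sX := smooth_X hS hphi Ac; have sh := smooth_h hS hphi Ac; have sC := smooth_C Ac.
have P1 := smoothM oU (csmooth_dy hc sh) (smooth_pform oU (csmooth_dx hc sX) sC).
have P2 := smoothM oU (csmooth_dx hc sh) (smooth_pform oU (csmooth_dy hc sX) sC).
exact: (smoothB oU P1 P2).
Qed.

(** The factor is r^2 + s^2, the squared modulus of the derivative of the change of charts, since
    [orient] is a determinant in the two partial derivatives. *)
Lemma orient_jac c1 c2 p : A c1 -> A c2 -> cdom c1 p -> cdom c2 p ->
  exists2 k : R, 0 <= k & orient c1 p = k * orient c2 p.
Proof.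
move=> A1 A2 p1 p2.
have [r [s J]] := chain_rule (rs_chart hS A1) (rs_chart hS A2) p1 p2
  (rs_holomorphic hS A1 A2 p1 p2).
have [_ Xx Xy] := J _ X (csmooth_diff (smooth_X hS hphi A2) p2).
have [_ hx hy] := J _ h (csmooth_diff (smooth_h hS hphi A2) p2).
exists (r ^+ 2 + s ^+ 2); first by rewrite addr_ge0 ?sqr_ge0.
rewrite /orient Xx Xy hx hy; exact: orient_comb.
Qed.

(** The sign of [orient] is independent of the chart and locally constant because it never vanishes,
    hence constant on the connected surface. *)
Lemma orientation : (forall c p, A c -> cdom c p -> orient c p < 0) \/
  (forall c p, A c -> cdom c p -> 0 < orient c p).
Proof.
pose B := [set p | exists c, [/\ A c, cdom c p & orient c p < 0]].
have negB c p : A c -> cdom c p -> B p -> orient c p < 0.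
  move=> Ac cp [c' [Ac' cp' o']]; have [k k0 e] := orient_jac Ac Ac' cp cp'.
  by rewrite lt_neqAle (orient_neq0 Ac cp) andTb e; exact: mulr_ge0_le0 k0 (ltW o').
have cts c p : A c -> cdom c p -> {for p, continuous (orient c)}.
  move=> Ac cp; exact: (chart_continuous (rs_chart hS Ac) cp (csmooth_diff (smooth_orient Ac) cp)).
case: (pselect (B !=set0)) => [B0|nB]; [left|right].
  suff BT : B = setT by move=> c p Ac cp; apply: negB => //; rewrite BT.
  apply: (rs_connected hS) => //.
    exists B; rewrite ?setTI // openE => p [c [Ac cp o0]].
    have /cvgrPdist_lt/(_ `|orient c p|) := cts c p Ac cp.
    rewrite normr_gt0 lt_eqF // => /(_ isT) n1.
    move: n1 (near_cdom (rs_chart hS Ac) cp); apply: filterS2 => s d cs.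
    exists c; split=> //; move: d; rewrite (ltr0_norm o0) ltr_norml => /andP[d1 d2].
    by move: d1; rewrite opprK; lra.
  exists B; rewrite ?setTI // -[X in closed X]setCK.
  apply: open_closedC; rewrite openE => p nBp.
  have [c Ac cp] := rs_cover hS p.
  have o0 : 0 < orient c p.
    rewrite lt_neqAle eq_sym orient_neq0 //= leNgt; apply/negP => o0; apply: nBp.
    by exists c.
  have /cvgrPdist_lt/(_ _ o0) := cts c p Ac cp => n1.
  move: n1 (near_cdom (rs_chart hS Ac) cp); apply: filterS2 => s d cs /(negB _ _ Ac cs) o1.
  by move: d; rewrite ltr_norml => /andP[d1 d2]; move: d2; lra.
move=> c p Ac cp; rewrite lt_neqAle eq_sym orient_neq0 //= leNgt.
by apply/negP => o0; apply: nB; exists p, c.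
Qed.

End Orientation.

Lemma pform_comb_oppr (R : realType) n (a b : R) (u v w : 'rV[R]_n) :
  - (a * pform u (- w) - b * pform v (- w)) = a * pform u w - b * pform v w.
Proof. by rewrite !pformNr !mulrN opprB opprK addrC. Qed.

Lemma oriented_normal (R : realType) (T : topologicalType) (A : set (chart R T))
    (phi N : T -> ('rV[R]_3 * R^o)%type) :
  riemann_surface A -> conformal_immersion A (@H2R R) (@gH2R R) phi ->
  unit_normal_field A (@TH2R R) (@gH2R R) 1 phi N ->
  (forall p, gH2R (N p) (@dt R) ^+ 2 < 1) ->
  exists N', [/\ unit_normal_field A (@TH2R R) (@gH2R R) 1 phi N',
    forall p, gH2R (N' p) (@dt R) ^+ 2 < 1 &
    forall c p, A c -> cdom c p -> orient phi N' c p < 0].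
Proof.
move=> hS hphi hN hnu; case: (orientation hS hphi hN hnu) => o; first by exists N.
have gN (v w : ('rV[R]_3 * R^o)%type) : gH2R v (- w) = - gH2R v w.
  by rewrite /gH2R /= pformNr mulrN opprD.
have gNl (v w : ('rV[R]_3 * R^o)%type) : gH2R (- v) w = - gH2R v w.
  by rewrite /gH2R /= pformNl mulNr opprD.
exists (fun p => - N p); split.
- have [sN uN] := hN; split=> [c Ac|p].
    have oU := open_crangeR (rs_chart hS Ac).
    have cN : continuous (-%R : _ -> ('rV[R]_3 * R^o)%type) by move=> x; exact: opp_continuous.
    exact: (smooth_linear (L := -%R) oU cN (sN c Ac)).
  have [t1 t2 t3] := uN p; split.
  + by move: t1; rewrite /TH2R /= pformNr => ->; rewrite oppr0.
  + by rewrite gN gNl opprK.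
  + move=> c Ac cp; have [e1 e2] := t3 c Ac cp; split;
      [exact: etrans (gN _ _) (etrans (congr1 -%R e1) (oppr0 _))|
       exact: etrans (gN _ _) (etrans (congr1 -%R e2) (oppr0 _))].
- by move=> p; rewrite gNl sqrrN; exact: hnu.
- move=> c p Ac cp; rewrite -oppr_gt0; apply: etrans (o c p Ac cp); congr (0 < _).
  rewrite /orient; have -> : conormal phi (fun s => - N s) p = - conormal phi N p.
    by rewrite /conormal /normal_hyp /= -crossNl.
  exact: pform_comb_oppr.
Qed.

Lemma alpha_jac (R : realType) (r s D : R) (hx hy : R^o) (C n : 'rV[R]_3) :
  alpha1 D (r *: hx + s *: hy) (- s *: hx + r *: hy) C n =
    r *: alpha1 D hx hy C n + s *: alpha2 D hx hy C n /\
  alpha2 D (r *: hx + s *: hy) (- s *: hx + r *: hy) C n =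
    - s *: alpha1 D hx hy C n + r *: alpha2 D hx hy C n.
Proof.
by split; apply/rowP => i; rewrite /alpha1 /alpha2 !mxE /GRing.scale /=; ring.
Qed.

(** * The form alpha and its integrability *)

Section AlphaForm.
Context {R : realType} {T : topologicalType}.
Notation R2 := (R^o * R^o)%type.
Notation L3R := ('rV[R]_3 * R^o)%type.
Notation crangeR c := [set q : R2 | crange c (q.1 +i* q.2)].
Variables (A : set (chart R T)) (hS : riemann_surface A) (phi N : T -> L3R).
Hypothesis hphi : conformal_immersion A (@H2R R) (@gH2R R) phi.
Hypothesis hmin : zero_mean_curvature A (@TH2R R) (@gH2R R) 1 phi.
Hypothesis hN : unit_normal_field A (@TH2R R) (@gH2R R) 1 phi N.
Hypothesis hnu : forall p, gH2R (N p) (@dt R) ^+ 2 < 1.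
Hypothesis ho : forall c p, A c -> cdom c p -> orient phi N c p < 0.
Let X := hyp_part phi. Let h := height phi. Let nv := normal_hyp N. Let nu := angle N. Let C := conormal phi N.

Definition weight p : R^o := (2 * (1 - nu p))^-1.
Definition alpha_x c p := alpha1 (weight p) (dx c h p) (dy c h p) (C p) (nv p).
Definition alpha_y c p := alpha2 (weight p) (dx c h p) (dy c h p) (C p) (nv p).
Notation D := weight.
Notation a1 := alpha_x.
Notation a2 := alpha_y.

Lemma two_sub_nu p : (1 - nu p) + (1 - nu p) != 0 :> R^o.
Proof.
rewrite -mulr2n -mulr_natl mulf_eq0 pnatr_eq0; exact: one_sub_nu hnu p.
Qed.

Lemma D_inv p : ((1 - nu p) + (1 - nu p)) * D p = 1.
Proof.
rewrite /weight -[X in X * _]mulr2n -[X in X * _]mulr_natl divff //.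
rewrite mulf_eq0 pnatr_eq0; exact: one_sub_nu hnu p.
Qed.

Section AtChart.
Variables (c : chart R T) (Ac : A c).
Let hc := rs_chart hS Ac.
Let oU := open_crangeR hc.
Let sX := smooth_X hS hphi Ac. Let sh := smooth_h hS hphi Ac.
Let sn := smooth_nv hS hN Ac. Let snu := smooth_nu hS hN Ac.
Let sC := smooth_C hS hphi hN Ac.
Let shx := csmooth_dx hc sh. Let shy := csmooth_dy hc sh.
Notation csmooth f := (smooth_on (crangeR c) (loc c f : R2 -> _)).

Lemma smooth_D : csmooth D.
Proof.
have s1 : csmooth (fun p => 1 - nu p : R^o) := smoothB oU (smooth_cst _ (1 : R^o)) snu.
have s2 : csmooth (fun p => (1 - nu p) + (1 - nu p) : R^o) := smoothD oU s1 s1.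
apply: (smooth_ext oU _ (smoothV oU _ s2)) => q Uq; last exact: two_sub_nu.
apply: (mulfI (two_sub_nu _)); apply: etrans (esym (D_inv _)).
exact: divff (two_sub_nu _).
Qed.

Lemma smooth_alpha_x : csmooth (a1 c).
Proof.
have s1 := smooth_scale oU shx sC; have s2 := smooth_scale oU shy sn.
have cN : continuous (-%R : _ -> 'rV[R]_3) by move=> x; exact: opp_continuous.
have s3 := smooth_linear (L := -%R) oU cN s2.
exact: (smooth_scale oU smooth_D (smoothD oU s1 s3)).
Qed.

Lemma smooth_alpha_y : csmooth (a2 c).
Proof.
have s1 := smooth_scale oU shy sC; have s2 := smooth_scale oU shx sn.
exact: (smooth_scale oU smooth_D (smoothD oU s1 s2)).
Qed.

Variables (p : T) (cp : cdom c p).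

Lemma der_Dinv v dnu : der c p v nu dnu -> der c p v D (2 * D p ^+ 2 * dnu).
Proof.
move=> Hnu.
have H1 : der c p v (fun s => 1 - nu s : R^o) (0 - dnu).
  by apply: derB => //; exact: is_derive_cst.
have H := derV hc cp (fun s _ => D_inv s) (csmooth_diff smooth_D cp) (derD H1 H1).
apply: (der_eq H); ring.
Qed.

Variables (v : R2) (dhx dhy dnu : R^o) (dC dn : 'rV[R]_3).
Hypotheses (Hhx : der c p v (dx c h) dhx) (Hhy : der c p v (dy c h) dhy).
Hypotheses (HC : der c p v C dC) (Hn : der c p v nv dn) (Hnu : der c p v nu dnu).

Lemma der_alpha_x : der c p v (a1 c)
  ((2 * D p ^+ 2 * dnu) *: (dx c h p *: C p - dy c h p *: nv p) +
   D p *: ((dhx *: C p + dx c h p *: dC) - (dhy *: nv p + dy c h p *: dn))).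
Proof.
exact: (der_scale hc cp (der_Dinv Hnu)
  (derB (der_scale hc cp Hhx HC) (der_scale hc cp Hhy Hn))).
Qed.

Lemma der_alpha_y : der c p v (a2 c)
  ((2 * D p ^+ 2 * dnu) *: (dy c h p *: C p + dx c h p *: nv p) +
   D p *: ((dhy *: C p + dy c h p *: dC) + (dhx *: nv p + dx c h p *: dn))).
Proof.
exact: (der_scale hc cp (der_Dinv Hnu)
  (derD (der_scale hc cp Hhy HC) (der_scale hc cp Hhx Hn))).
Qed.

End AtChart.

Section AtPoint.
Variables (c : chart R T) (Ac : A c) (p : T) (cp : cdom c p).
Let hc := rs_chart hS Ac.
Let sX := smooth_X hS hphi Ac. Let sh := smooth_h hS hphi Ac.
Let sn := smooth_nv hS hN Ac. Let snu := smooth_nu hS hN Ac.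
Let sC := smooth_C hS hphi hN Ac.
Let shx := csmooth_dx hc sh. Let shy := csmooth_dy hc sh.
Let XX := X_X hphi p. Let Xn := X_nv hN p. Let nn := nv_nv hN p.
Let w0 := lt0r_neq0 (w_gt0 hnu p).
Let XxX := dxX_X hS hphi Ac cp. Let XyX := dyX_X hS hphi Ac cp.
Let Xxn := dxX_nvE hphi hN Ac cp. Let Xyn := dyX_nvE hphi hN Ac cp.
Let cf1 := conf_eq hphi Ac cp. Let cf2 := conf_orth hphi Ac cp.
Let nu1 := one_sub_nu hnu p.

Lemma laplacian_h : dx c (dx c h) p + dy c (dy c h) p = 0.
Proof.
have L1 := normal_laplacian hS hphi hmin hN Ac cp.
have [L2 L3] := tangent_laplacian hS hphi Ac cp.
exact: (lap_h0 XX Xn nn (erefl _) XxX XyX Xxn Xyn cf1 cf2 (ho Ac cp) L1 L2 L3).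
Qed.

Let nxX := dxnv_X hS hphi hN Ac cp. Let nyX := dynv_X hS hphi hN Ac cp.
Let nxn := dxnv_nv hS hN Ac cp. Let nyn := dynv_nv hS hN Ac cp.
Let symm := second_form_symm hS hphi hN Ac cp.
Let minim := second_form_trace hS hphi hmin hN Ac cp.

Lemma dx_C : der c p ((1, 0) : R2) C (cross (dx c nv p) (X p) + cross (nv p) (dx c X p)).
Proof. exact: (der_cross hc cp (dx_is_derive sn cp) (dx_is_derive sX cp)). Qed.

Lemma dy_C : der c p ((0, 1) : R2) C (cross (dy c nv p) (X p) + cross (nv p) (dy c X p)).
Proof. exact: (der_cross hc cp (dy_is_derive sn cp) (dy_is_derive sX cp)). Qed.

Let dyhx : der c p ((0, 1) : R2) (dx c h) (dx c (dy c h) p).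
Proof. by rewrite -(dyx_dxy hc sh cp); exact: (dy_is_derive shx cp). Qed.

Lemma dx_alpha_x : dx c (a1 c) p =
  (2 * D p ^+ 2 * dx c nu p) *: (dx c h p *: C p - dy c h p *: nv p) +
   D p *: ((dx c (dx c h) p *: C p + dx c h p *: (cross (dx c nv p) (X p) + cross (nv p) (dx c X p)))
   - (dx c (dy c h) p *: nv p + dy c h p *: dx c nv p)).
Proof.
by case: (der_alpha_x Ac cp (dx_is_derive shx cp) (dx_is_derive shy cp) dx_C
  (dx_is_derive sn cp) (dx_is_derive snu cp)).
Qed.

Lemma dy_alpha_x : dy c (a1 c) p =
  (2 * D p ^+ 2 * dy c nu p) *: (dx c h p *: C p - dy c h p *: nv p) +
   D p *: ((dx c (dy c h) p *: C p + dx c h p *: (cross (dy c nv p) (X p) + cross (nv p) (dy c X p)))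
   - (dy c (dy c h) p *: nv p + dy c h p *: dy c nv p)).
Proof.
by case: (der_alpha_x Ac cp dyhx (dy_is_derive shy cp) dy_C
  (dy_is_derive sn cp) (dy_is_derive snu cp)).
Qed.

Lemma dx_alpha_y : dx c (a2 c) p =
  (2 * D p ^+ 2 * dx c nu p) *: (dy c h p *: C p + dx c h p *: nv p) +
   D p *: ((dx c (dy c h) p *: C p + dy c h p *: (cross (dx c nv p) (X p) + cross (nv p) (dx c X p)))
   + (dx c (dx c h) p *: nv p + dx c h p *: dx c nv p)).
Proof.
by case: (der_alpha_y Ac cp (dx_is_derive shx cp) (dx_is_derive shy cp) dx_C
  (dx_is_derive sn cp) (dx_is_derive snu cp)).
Qed.

Lemma dy_alpha_y : dy c (a2 c) p =
  (2 * D p ^+ 2 * dy c nu p) *: (dy c h p *: C p + dx c h p *: nv p) +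
   D p *: ((dy c (dy c h) p *: C p + dy c h p *: (cross (dy c nv p) (X p) + cross (nv p) (dy c X p)))
   + (dx c (dy c h) p *: nv p + dx c h p *: dy c nv p)).
Proof.
by case: (der_alpha_y Ac cp dyhx (dy_is_derive shy cp) dy_C
  (dy_is_derive sn cp) (dy_is_derive snu cp)).
Qed.

(** By [J_J] the commutator of J(a2) and J(a1) is J of the right side, so this is flatness of the
    system before J is applied. *)
Lemma d_alpha : dx c (a2 c) p - dy c (a1 c) p = - 2 *: cross (a2 c p) (a1 c p).
Proof.
rewrite dx_alpha_y dy_alpha_x.
exact: (alpha_curl XX Xn nn (erefl _) w0 XxX XyX Xxn Xyn cf1 cf2 (ho Ac cp)
  nxX nyX nxn nyn symm minim nu1 _ laplacian_h).
Qed.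

Lemma div_alpha : dx c (a1 c) p + dy c (a2 c) p = 0.
Proof.
rewrite dx_alpha_x dy_alpha_y.
exact: (alpha_div XX Xn nn (erefl _) w0 XxX XyX Xxn Xyn cf1 cf2 (ho Ac cp)
  nxX nyX nxn nyn symm minim nu1 _ laplacian_h).
Qed.

Lemma cross_X_alpha_x : cross (X p) (a1 c p) = a2 c p.
Proof. exact: (cross_alpha1 XX Xn). Qed.

Lemma alpha_x_X : pform (a1 c p) (X p) = 0.
Proof. exact: (alpha1_X Xn). Qed.

Lemma alpha_x_gt0 : 0 < pform (a1 c p) (a1 c p).
Proof.
exact: (alpha1_gt0 XX Xn nn (erefl _) XxX XyX Xxn Xyn cf1 cf2 (ho Ac cp) nu1 (w_gt0 hnu p)).
Qed.

Lemma grad_h_gt0 : 0 < dx c h p ^+ 2 + dy c h p ^+ 2.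
Proof.
exact: (grad_gt0 XX Xn nn (erefl _) XxX XyX Xxn Xyn cf1 cf2 (ho Ac cp)).
Qed.

Lemma hopf_alpha :
  pform (a1 c p) (dx c X p) - pform (a2 c p) (dy c X p) = - dx c h p * dy c h p /\
  pform (a1 c p) (dy c X p) + pform (a2 c p) (dx c X p) = (dx c h p ^+ 2 - dy c h p ^+ 2) / 2.
Proof.
exact: (alpha_hopf XX Xn nn (erefl _) w0 XxX XyX Xxn Xyn cf1 cf2 (ho Ac cp) nu1).
Qed.

End AtPoint.
End AlphaForm.

(** * Primitives on simply connected surfaces *)

Section Primitives.
Context {R : realType} {T : topologicalType}.
Notation R2 := (R^o * R^o)%type.
Notation crangeR c := [set q : R2 | crange c (q.1 +i* q.2)].

(* The system expresses the derivatives of [F] through [F], so that C^k bootstraps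
   to C^(k+1). *)
Lemma flat_sol_smooth m n (U : set R2) (a b : R2 -> 'M[R]_n) (F : R2 -> 'M[R]_(m, n)) :
  open U -> smooth_on U a -> smooth_on U b -> (forall q, U q -> flat_sol a b F q) ->
  smooth_on U F.
Proof.
move=> oU sa sb sF k; elim: k => [|k IH].
  move=> q /set_mem Uq; have [dF _ _] := sF q Uq; exact: differentiable_continuous.
split=> [q Uq|v]; first by have [] := sF q Uq.
have H1 := Ck_mulmx oU IH (sa k); have H2 := Ck_mulmx oU IH (sb k).
have cl (w : R) : continuous ( *:%R w : 'M[R]_(m, n) -> 'M[R]_(m, n)).
  exact: scaler_continuous.
have G1 := Ck_linear (L := ( *:%R v.1 : 'M[R]_(m, n) -> 'M[R]_(m, n))) (cl v.1) oU H1.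
have G2 := Ck_linear (L := ( *:%R v.2 : 'M[R]_(m, n) -> 'M[R]_(m, n))) (cl v.2) oU H2.
apply: (Ck_ext oU _ (CkD oU G1 G2)) => q /set_mem Uq /=.
have [dF <- <-] := sF q Uq; rewrite !(deriveE _ dF) -!linearZ -linearD.
congr ('d F q _); case: v {G1 G2} => v1 v2.
by congr pair; rewrite /= /GRing.scale /= ?mulr1 ?mulr0 ?addr0 ?add0r.
Qed.

Variables (A : set (chart R T)) (hS : riemann_surface A).

(** The difference g - g p0, seen as a 1 by 1 matrix, solves the system with zero coefficients and
    vanishes at p0, so global uniqueness applies. *)
Lemma constant_of_derivatives (g : T -> R^o) p0 : (forall c p, A c -> cdom c p ->
    [/\ differentiable (loc c g) (pt c p), dx c g p = 0 & dy c g p = 0]) ->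
  forall p, g p = g p0.
Proof.
move=> Hg p; pose z (c : chart R T) (s : T) : 'M[R]_1 := 0.
have sz c : A c -> smooth_on (crangeR c) (loc c (z c)).
  by move=> Ac; exact: smooth_cst.
have flatz c s : A c -> cdom c s -> z c s *m z c s + dy c (z c) s = z c s *m z c s + dx c (z c) s.
  by move=> Ac cs; congr (_ + _); apply: etrans (derive_cst _ _ _) (esym (derive_cst _ _ _)).
pose f s := along (1%:M : 'M[R]_1) (g s - g p0).
have sf c s : A c -> cdom c s -> is_sol z z c f s.
  move=> Ac cs; have [dg gx gy] := Hg c s Ac cs.
  have dB : differentiable (loc c (fun s => g s - g p0)) (pt c s).
    exact: (differentiableB dg (differentiable_cst _ _)).
  have Dg v : der c s v g ('D_v (loc c g) (pt c s)).
    by apply: DeriveDef => //; exact: diff_derivable.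
  have c1 := @along_continuous R _ (1%:M : 'M[R]_1).
  have Df v : der c s v f (along 1%:M ('D_v (loc c g) (pt c s) - 0)).
    have Dc : der c s v (fun=> g p0) 0 by exact: is_derive_cst.
    exact: (der_linear (L := along 1%:M) c1 dB (derB (Dg v) Dc)).
  have [h1 _] := derive_linear (0 : R2) c1 dB; split; first exact: h1.
    by rewrite /z mulmx0; have [_ e] := Df (1, 0); apply: etrans e _; rewrite [X in X - 0]gx subrr linear0.
  by rewrite /z mulmx0; have [_ e] := Df (0, 1); apply: etrans e _; rewrite [X in X - 0]gy subrr linear0.
have f0 : f p0 = 0 by rewrite /f subrr linear0.
have /matrixP/(_ 0 0) := global_sol_unique hS sz sz flatz sf f0 p.
by rewrite !mxE mulr1 => /subr0_eq.
Qed.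

(** Integration is a linear system with nilpotent coefficients u E and v E: since E^2 = 0, flatness
    reduces to closedness of the form. The solution starting from (0, 1) keeps its second component
    equal to 1, and its first component is then a primitive. *)
Theorem closed_form_primitive (u v : chart R T -> T -> R^o) :
  (forall c, A c -> smooth_on (crangeR c) (loc c (u c))) ->
  (forall c, A c -> smooth_on (crangeR c) (loc c (v c))) ->
  (forall c p, A c -> cdom c p -> dy c (u c) p = dx c (v c) p) ->
  (forall c1 c2 p r s, A c1 -> A c2 -> cdom c1 p -> cdom c2 p -> jac c1 c2 p r s ->
     u c1 p = r * u c2 p + s * v c2 p /\ v c1 p = - s * u c2 p + r * v c2 p) ->
  simply_connected R T -> T ->
  exists a : T -> R^o, forall c p, A c -> cdom c p ->
    [/\ differentiable (loc c a) (pt c p), dx c a p = u c p & dy c a p = v c p].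
Proof.
move=> su sv closed compat sc p0.
pose E : 'M[R]_2 := delta_mx 1 0; pose L := along E.
have E2 : E *m E = 0 by rewrite /E mul_delta_mx_0.
have cL : continuous L by exact: along_continuous.
have sL (w : chart R T -> T -> R^o) : (forall c, A c -> smooth_on (crangeR c) (loc c (w c))) ->
    forall c, A c -> smooth_on (crangeR c) (loc c (fun p => L (w c p))).
  by move=> sw c Ac; exact: (smooth_linear (L := L) (open_crangeR (rs_chart hS Ac)) cL (sw c Ac)).
have L0 (x y : R) : L x *m L y = 0 by rewrite /L /along -scalemxAl -scalemxAr E2 !scaler0.
have dL (w : chart R T -> T -> R^o) (e : R2) c p :
    (forall c, A c -> smooth_on (crangeR c) (loc c (w c))) -> A c -> cdom c p ->
    'D_e (loc c (fun p => L (w c p))) (pt c p) = L ('D_e (loc c (w c)) (pt c p)).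
  by move=> sw Ac cp; have [_ ->] := derive_linear e cL (csmooth_diff (sw c Ac) cp).
have [||f [f0 sf]] := global_solution hS (sL u su) (sL v sv) _ _ p0 (delta_mx 0 1) sc.
- move=> c p Ac cp; rewrite !L0 !add0r; apply: etrans (dL u _ c p su Ac cp) _.
  apply: etrans (esym (dL v _ c p sv Ac cp)); congr (L _); exact: closed.
- move=> c1 c2 p r s A1 A2 p1 p2 J; have [-> ->] := compat _ _ _ _ _ A1 A2 p1 p2 J.
  by rewrite /L /along !scalerDl !scalerA.
have fE p (w : R) (i : 'I_2) : (f p *m L w) 0 i = w * f p 0 1 * (i == 0)%:R.
  rewrite /L /along -scalemxAr mxE -mulrA; congr (_ * _).
  rewrite mxE (bigD1 1) //= big1 ?addr0 => [|j /negbTE j1]; rewrite !mxE ?eqxx //=.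
  by rewrite j1 mulr0.
have de (i : 'I_2) c p : A c -> cdom c p -> [/\ differentiable (loc c (fun s => f s 0 i : R^o)) (pt c p),
    dx c (fun s => f s 0 i : R^o) p = u c p * f p 0 1 * (i == 0)%:R &
    dy c (fun s => f s 0 i : R^o) p = v c p * f p 0 1 * (i == 0)%:R].
  move=> Ac cp; have [df fx fy] := sf c p Ac cp.
  have D e := derive_linear (L := @entry _ _ _ 0 i) e (@coord_continuous _ _ _ 0 i) df.
  have [h1 e1] := D ((1, 0) : R2); have [_ e2] := D ((0, 1) : R2).
  split; first exact: h1.
    apply: etrans e1 _; rewrite -fE -fx //.
  by apply: etrans e2 _; rewrite -fE -fy.
have f1 p : f p 0 1 = 1.
  apply: etrans (constant_of_derivatives (g := fun s => f s 0 1 : R^o) p0 _ p) _.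
    move=> c s Ac cs; have [h1 h2 h3] := de 1 c s Ac cs.
    by split; rewrite ?h2 ?h3 ?mulr0.
  by rewrite f0 mxE !eqxx.
exists (fun s => f s 0 0) => c p Ac cp; have [h1 h2 h3] := de 0 c p Ac cp.
by split; rewrite ?h2 ?h3 ?f1 ?mulr1.
Qed.

End Primitives.

(** * The maximal surface *)

Section Algebra.
Context {R : realType}.
Implicit Types (X a b u v : 'rV[R]_3).

Lemma mean_curvature_conformal (a b d E F G : R) : E = G -> F = 0 -> a + d = 0 ->
  (a * G - 2 * b * F + d * E) / (2 * (E * G - F ^+ 2)) = 0.
Proof. by move=> -> -> ad; rewrite mulr0 subr0 -mulrDl ad !mul0r. Qed.

Section Conformal.
Variables (X a b : 'rV[R]_3).
Hypothesis XX : pform X X = -1.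
Hypothesis aX : pform a X = 0.
Hypothesis Xa : cross X a = b.

Lemma conformal_X : pform b X = 0. Proof. by rewrite -Xa pform_cross_l. Qed.
Lemma conformal_orth : pform a b = 0. Proof. by rewrite pformC -Xa pform_cross_r. Qed.
Lemma conformal_norm : pform b b = pform a a.
Proof. by rewrite -Xa pform_cross_cross (pformC X) aX XX; ring. Qed.
Lemma conformal_cross : cross a b = - pform a a *: X.
Proof. by rewrite -Xa cross_cross aX scale0r sub0r scaleNr. Qed.

(** The Gram determinant of an orthonormal pair is 1 and equals (d E)^2, with d the determinant of
    the change of basis and E the conformal factor; orientation selects d E = 1. *)
Lemma oriented_onb_cross (a11 a12 a21 a22 : R) :
  let u := a11 *: a + a12 *: b in let v := a21 *: a + a22 *: b in
  0 < pform a a -> pform u u = 1 -> pform u v = 0 -> pform v v = 1 ->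
  0 < a11 * a22 - a12 * a21 -> cross u v = - X.
Proof.
move=> u v E0; rewrite !(pformDl, pformDr, pformZl, pformZr) (pformC b a).
rewrite conformal_orth conformal_norm => u1 uv v1 det0.
have -> : cross u v = (a11 * a22 - a12 * a21) *: cross a b.
  rewrite /u /v !(crossDl, crossDr, crossZl, crossZr) !crossvv (crossC b a).
  by apply/rowP => k; rewrite !mxE; ring.
rewrite conformal_cross scalerA; transitivity (-1 *: X); last by rewrite scaleN1r.
congr (_ *: _); rewrite mulrN; congr (- _).
move: det0 E0 u1 uv v1; set d := a11 * a22 - a12 * a21; set E := pform a a => d0 E0 u1 uv v1.
have dE0 : 0 < d * E by rewrite mulr_gt0.
have : (d * E - 1) * (d * E + 1) = 0.
  transitivity ((a11 * (a11 * E) + a12 * (a12 * E)) * (a21 * (a21 * E) + a22 * (a22 * E))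
    - (a11 * (a21 * E) + a12 * (a22 * E)) ^+ 2 - 1); first by rewrite /d; ring.
  have -> : a11 * (a11 * E) + a12 * (a12 * E) = 1 by move: u1; rewrite !mulr0 addr0 add0r.
  have -> : a21 * (a21 * E) + a22 * (a22 * E) = 1 by move: v1; rewrite !mulr0 addr0 add0r.
  have -> : a11 * (a21 * E) + a12 * (a22 * E) = 0 by move: uv; rewrite !mulr0 addr0 add0r.
  by ring.
by move/eqP; rewrite mulf_eq0 => /orP[] /eqP; lra.
Qed.

End Conformal.

Variables (psi : 'rV[R]_4) (psi1 : pform psi psi = -1).

Lemma pform_J1 a b : pform (psi *m J a) (psi *m J b) = pform a b.
Proof. by rewrite pform_JJ psi1; ring. Qed.

Lemma pform_J_normal a X b Xb : pform a X = 0 -> pform b X = 0 ->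
  pform (psi *m J a) (psi *m J b *m J X + psi *m J Xb) = pform a Xb - pform a (cross b X).
Proof.
move=> aX bX; rewrite pformDr mulJ_mulJ bX scale0r sub0r pformNr !pform_J1.
by rewrite addrC.
Qed.

(** The part of dN that comes from d psi contributes triple products with X, which vanish for equal
    arguments and are antisymmetric otherwise. So the Hopf differential sees alpha only through its
    products with dX. *)
Lemma hopf_J X a b Xx Xy : pform a X = 0 -> pform b X = 0 ->
  let Nx := psi *m J a *m J X + psi *m J Xx in
  let Ny := psi *m J b *m J X + psi *m J Xy in
  pform (psi *m J a) Nx - pform (psi *m J b) Ny = pform a Xx - pform b Xy /\
  pform (psi *m J a) Ny + pform (psi *m J b) Nx = pform a Xy + pform b Xx.
Proof.
move=> aX bX Nx Ny.
have tr u v : pform u (cross v X) = - pform v (cross u X).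
  by rewrite !pform3E !mxE /=; ring.
have tr0 u : pform u (cross u X) = 0 by rewrite !pform3E !mxE /=; ring.
rewrite (pform_J_normal _ aX aX) (pform_J_normal _ bX bX) (pform_J_normal _ aX bX).
rewrite (pform_J_normal _ bX aX) !tr0 (tr b) !subr0; split=> //.
by rewrite opprK addrAC addrA addrK.
Qed.

End Algebra.

Section Complex.
Context {R : realType}.

Lemma wirtinger_pform (a b d e : 'rV[R]_4) :
  pform (2^-1 *: (complexify a - 'i *: complexify b))
        (2^-1 *: (complexify d - 'i *: complexify e)) =
  ((pform a d - pform b e) / 4) +i* (- (pform a e + pform b d) / 4).
Proof.
have ent (u v : 'rV[R]_4) k : (2^-1 *: (complexify u - 'i *: complexify v)) 0 k =
    (u 0 k / 2) +i* (- (v 0 k / 2)).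
  rewrite !mxE; have -> : (2^-1 : R[i]) = (2^-1 : R)%:C by rewrite fmorphV /= rmorphMn.
  by apply/eqP; rewrite eq_complex /=; apply/andP; split; apply/eqP; ring.
have gen (u v : 'rV[R[i]]_4) (f g : 'I_4 -> R[i]) : (forall k, u 0 k = f k) ->
    (forall k, v 0 k = g k) ->
    pform u v = f 0 * g 0 + f 1 * g 1 - f 2 * g 2 - f 3 * g 3.
  by move=> uf vg; rewrite /pform sum4 !uf !vg /=; ring.
apply: etrans (gen _ _ _ _ (ent a b) (ent d e)) _; rewrite !pform4E.
by apply/eqP; rewrite eq_complex /=; apply/andP; split; apply/eqP; field.
Qed.

End Complex.

Section MaximalSurface.
Context {R : realType} {T : topologicalType}.
Notation R2 := (R^o * R^o)%type.
Notation L3R := ('rV[R]_3 * R^o)%type.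
Notation crangeR c := [set q : R2 | crange c (q.1 +i* q.2)].
Variables (A : set (chart R T)) (hS : riemann_surface A) (sc : simply_connected R T).
Variables (phi N : T -> L3R).
Hypothesis hphi : conformal_immersion A (@H2R R) (@gH2R R) phi.
Hypothesis hmin : zero_mean_curvature A (@TH2R R) (@gH2R R) 1 phi.
Hypothesis hN : unit_normal_field A (@TH2R R) (@gH2R R) 1 phi N.
Hypothesis hnu : forall p, gH2R (N p) (@dt R) ^+ 2 < 1.
Hypothesis ho : forall c p, A c -> cdom c p -> orient phi N c p < 0.
Let X := hyp_part phi. Let h := height phi.
Let a1 := alpha_x phi N. Let a2 := alpha_y phi N.

Definition J_alpha_x c p := J (a1 c p).
Definition J_alpha_y c p := J (a2 c p).

Lemma smooth_J_alpha_x c : A c -> smooth_on (crangeR c) (loc c (J_alpha_x c)).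
Proof.
move=> Ac; exact: (smooth_linear (L := J) (open_crangeR (rs_chart hS Ac)) J_continuous
  (smooth_alpha_x hS hphi hN hnu Ac)).
Qed.

Lemma smooth_J_alpha_y c : A c -> smooth_on (crangeR c) (loc c (J_alpha_y c)).
Proof.
move=> Ac; exact: (smooth_linear (L := J) (open_crangeR (rs_chart hS Ac)) J_continuous
  (smooth_alpha_y hS hphi hN hnu Ac)).
Qed.

Lemma D_J c p (v : R2) (a : T -> 'rV[R]_3) : smooth_on (crangeR c) (loc c a) -> cdom c p ->
  'D_v (loc c (fun s => J (a s))) (pt c p) = J ('D_v (loc c a) (pt c p)).
Proof.
by move=> sa cp; have [_ e] := derive_linear v J_continuous (csmooth_diff sa cp).
Qed.

Lemma flat_J c p : A c -> cdom c p ->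
  J_alpha_y c p *m J_alpha_x c p + dy c (J_alpha_x c) p = J_alpha_x c p *m J_alpha_y c p + dx c (J_alpha_y c) p.
Proof.
move=> Ac cp.
have -> : dy c (J_alpha_x c) p = J (dy c (a1 c) p) := D_J _ (smooth_alpha_x hS hphi hN hnu Ac) cp.
have -> : dx c (J_alpha_y c) p = J (dx c (a2 c) p) := D_J _ (smooth_alpha_y hS hphi hN hnu Ac) cp.
have -> : dx c (a2 c) p = dy c (a1 c) p - 2 *: cross (a2 c p) (a1 c p).
  by have := d_alpha hS hphi hmin hN hnu ho Ac cp => /eqP; rewrite subr_eq addrC scaleNr => /eqP.
rewrite /J_alpha_x /J_alpha_y !J_J (crossC (a1 c p)) (pformC (a1 c p)) !linearB linearZ linearN /=.
move: (J (cross _ _)) (J (dy c _ p)) (_%:M) => K Y M.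
by apply/matrixP => i j; rewrite !mxE; ring.
Qed.

Lemma jac_J c1 c2 p r s : A c1 -> A c2 -> cdom c1 p -> cdom c2 p -> jac c1 c2 p r s ->
  J_alpha_x c1 p = r *: J_alpha_x c2 p + s *: J_alpha_y c2 p /\ J_alpha_y c1 p = - s *: J_alpha_x c2 p + r *: J_alpha_y c2 p.
Proof.
move=> A1 A2 p1 p2 J12.
have [_ hx hy] := J12 _ h (csmooth_diff (smooth_h hS hphi A2) p2).
have [e1 e2] := alpha_jac r s (weight N p) (dx c2 h p) (dy c2 h p) (conormal phi N p) (normal_hyp N p).
rewrite -hx -hy in e1 e2.
have L k l (u v : 'rV[R]_3) : J (k *: u + l *: v) = k *: J u + l *: J v.
  by rewrite linearD !linearZ.
by split; [exact: etrans (congr1 J e1) (L _ _ _ _)|exact: etrans (congr1 J e2) (L _ _ _ _)].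
Qed.

(** Each J(a) is skew for [pform], so the square of a solution is constant; the initial value is the
    last standard basis vector, of square -1. *)
Lemma maximal_surface_exists (p0 : T) : exists psi : T -> 'rV[R]_4,
  (forall p, pform (psi p) (psi p) = -1) /\
  forall c p, A c -> cdom c p -> is_sol J_alpha_x J_alpha_y c psi p.
Proof.
have [psi [psi0 sol]] := global_solution hS smooth_J_alpha_x smooth_J_alpha_y flat_J jac_J p0 (delta_mx 0 3) sc.
exists psi; split=> // p.
apply: etrans (constant_of_derivatives hS (g := fun s => pform (psi s) (psi s)) p0 _ p) _.
  move=> c s Ac cs; have hc := rs_chart hS Ac; have [dpsi px py] := sol c s Ac cs.
  have Dpsi v : der c s v psi ('D_v (loc c psi) (pt c s)).
    by apply: DeriveDef => //; exact: diff_derivable.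
  have sp : smooth_on (crangeR c) (loc c psi).
    apply: (flat_sol_smooth (open_crangeR hc) (smooth_J_alpha_x Ac) (smooth_J_alpha_y Ac)).
    by move=> q /crangeR_pt[t ct ->]; apply/(is_solP hS) => //; exact: sol.
  split; first exact: (csmooth_diff (smooth_pform (open_crangeR hc) sp sp) cs).
    have [_ e] := der_pform hc cs (Dpsi (1, 0)) (Dpsi (1, 0)).
    have e0 : pform (dx c psi s) (psi s) = 0 by rewrite px pform_J_self.
    by apply: etrans e _; rewrite (pformC (psi s)) [X in X + _]e0 [X in _ + X]e0 addr0.
  have [_ e] := der_pform hc cs (Dpsi (0, 1)) (Dpsi (0, 1)).
  have e0 : pform (dy c psi s) (psi s) = 0 by rewrite py pform_J_self.
  by apply: etrans e _; rewrite (pformC (psi s)) [X in X + _]e0 [X in _ + X]e0 addr0.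
by rewrite psi0 pform4E !mxE /=; ring.
Qed.

End MaximalSurface.

Lemma J_comb (R : realType) (psi : 'rV[R]_4) (k l : R) (a b : 'rV[R]_3) :
  k *: (psi *m J a) + l *: (psi *m J b) = psi *m J (k *: a + l *: b).
Proof.
by rewrite linearD !linearZ /= mulmxDr -!scalemxAr.
Qed.

Lemma OmegaN (R : realType) (a : 'rV[R]_3) : Omega (- a) = - Omega a.
Proof. by apply/matrixP => i j; elim/ord4P: i; elim/ord4P: j; rewrite !mxE /=; ring. Qed.

Lemma wedgeNl (R : realType) (u v : 'rV[R]_4) : wedge (- u) v = - wedge u v.
Proof. by rewrite /wedge linearN /= mulNmx mulmxN opprK opprB addrC. Qed.

Section Verification.
Context {R : realType} {T : topologicalType}.
Notation R2 := (R^o * R^o)%type.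
Notation L3R := ('rV[R]_3 * R^o)%type.
Notation crangeR c := [set q : R2 | crange c (q.1 +i* q.2)].
Variables (A : set (chart R T)) (hS : riemann_surface A).
Variables (phi N : T -> L3R).
Hypothesis hphi : conformal_immersion A (@H2R R) (@gH2R R) phi.
Hypothesis hmin : zero_mean_curvature A (@TH2R R) (@gH2R R) 1 phi.
Hypothesis hN : unit_normal_field A (@TH2R R) (@gH2R R) 1 phi N.
Hypothesis hnu : forall p, gH2R (N p) (@dt R) ^+ 2 < 1.
Hypothesis ho : forall c p, A c -> cdom c p -> orient phi N c p < 0.
Let X := hyp_part phi. Let h := height phi.
Let a1 := alpha_x phi N. Let a2 := alpha_y phi N.
Variable psi : T -> 'rV[R]_4.
Hypothesis psi1 : forall p, pform (psi p) (psi p) = -1.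
Hypothesis sol : forall c p, A c -> cdom c p -> is_sol (J_alpha_x phi N) (J_alpha_y phi N) c psi p.

Lemma dx_psi c p : A c -> cdom c p -> dx c psi p = psi p *m J (a1 c p).
Proof. by move=> Ac cp; have [_ e _] := sol Ac cp. Qed.

Lemma dy_psi c p : A c -> cdom c p -> dy c psi p = psi p *m J (a2 c p).
Proof. by move=> Ac cp; have [_ _ e] := sol Ac cp. Qed.

Lemma smooth_psi c : A c -> smooth_on (crangeR c) (loc c psi).
Proof.
move=> Ac; have hc := rs_chart hS Ac.
apply: (flat_sol_smooth (open_crangeR hc) (smooth_J_alpha_x hS hphi hN hnu Ac)
  (smooth_J_alpha_y hS hphi hN hnu Ac)).
by move=> q /crangeR_pt[t ct ->]; apply/(is_solP hS) => //; exact: sol.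
Qed.

Section AtPoint.
Variables (c : chart R T) (Ac : A c) (p : T) (cp : cdom c p).
Let hc := rs_chart hS Ac.
Let XX := X_X hphi p.
Let a1X := alpha_x_X hN c p.
Let Xa1 := cross_X_alpha_x hphi hN c p.
Let a1_pos := alpha_x_gt0 hS hphi hN hnu ho Ac cp.
Let a2X : pform (a2 c p) (X p) = 0 := conformal_X Xa1.

Lemma psi_conformal : [/\ pform (dx c psi p) (dx c psi p) = pform (dy c psi p) (dy c psi p),
  pform (dx c psi p) (dy c psi p) = 0 & 0 < pform (dx c psi p) (dx c psi p)].
Proof.
rewrite (dx_psi Ac cp) (dy_psi Ac cp) !(pform_J1 (psi1 p)).
by split; [exact: esym (conformal_norm XX a1X Xa1)|exact: conformal_orth Xa1|exact: a1_pos].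
Qed.

Lemma dxx_psi : dxx c psi p = psi p *m J (a1 c p) *m J (a1 c p) + psi p *m J (dx c (a1 c) p).
Proof.
have sJ := smooth_J_alpha_x hS hphi hN hnu Ac.
apply: etrans (dxxE hc psi cp) _.
apply: etrans (d_ext hc ((1, 0) : R2) cp (fun s cs => dx_psi Ac cs)) _.
have [_ e] := der_mulmx hc cp (dx_is_derive (smooth_psi Ac) cp) (dx_is_derive sJ cp).
apply: etrans e _; rewrite (dx_psi Ac cp); congr (_ + _ *m _).
exact: (D_J _ (smooth_alpha_x hS hphi hN hnu Ac) cp).
Qed.

Lemma dyy_psi : dyy c psi p = psi p *m J (a2 c p) *m J (a2 c p) + psi p *m J (dy c (a2 c) p).
Proof.
have sJ := smooth_J_alpha_y hS hphi hN hnu Ac.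
apply: etrans (dyyE hc psi cp) _.
apply: etrans (d_ext hc ((0, 1) : R2) cp (fun s cs => dy_psi Ac cs)) _.
have [_ e] := der_mulmx hc cp (dy_is_derive (smooth_psi Ac) cp) (dy_is_derive sJ cp).
apply: etrans e _; rewrite (dy_psi Ac cp); congr (_ + _ *m _).
exact: (D_J _ (smooth_alpha_y hS hphi hN hnu Ac) cp).
Qed.

(** J(a)^2 is the scalar [pform a a], so the quadratic terms are multiples of psi, while the first
    order terms add up to psi J(div alpha) = 0. *)
Lemma laplacian_psi n : pform (psi p) n = 0 ->
  pform (dxx c psi p) n + pform (dyy c psi p) n = 0.
Proof.
move=> pn; rewrite -pformDl dxx_psi dyy_psi !mulJ_mulJ !crossvv linear0 mulmx0 !subr0.
rewrite addrACA -mulmxDr -linearD.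
have -> : dx c (a1 c) p + dy c (a2 c) p = 0 by exact: (div_alpha hS hphi hmin hN hnu ho Ac cp).
by rewrite linear0 mulmx0 addr0 -scalerDl pformZl pn mulr0.
Qed.

End AtPoint.

Lemma psi_maximal : zero_mean_curvature A (@TH31 R) pform (-1) psi.
Proof.
move=> c p n Ac cp [pn _ _]; have [e1 e2 _] := psi_conformal Ac cp.
exact: (mean_curvature_conformal _ e1 e2 (laplacian_psi Ac cp pn)).
Qed.

Lemma psi_immersion : conformal_immersion A (@H31 R) pform psi.
Proof.
split; [by move=> c Ac; exact: smooth_psi|exact: psi1|].
by move=> c p Ac cp; exact: (psi_conformal Ac cp).
Qed.

Definition Npsi p := psi p *m J (X p).

Lemma smooth_Npsi c : A c -> smooth_on (crangeR c) (loc c Npsi).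
Proof.
move=> Ac; have oU := open_crangeR (rs_chart hS Ac).
have sJ := smooth_linear (L := J) oU J_continuous (smooth_X hS hphi Ac).
exact: (smooth_mulmx oU (smooth_psi Ac) sJ).
Qed.

Lemma Npsi_normal : oriented_normal_field A psi Npsi.
Proof.
have a1X c p : pform (a1 c p) (X p) = 0 := alpha_x_X hN c p.
have Xa1 c p : cross (X p) (a1 c p) = a2 c p := cross_X_alpha_x hphi hN c p.
have XX p : pform (X p) (X p) = -1 := X_X hphi p.
split; first split=> [c Ac|p].
- exact: smooth_Npsi.
- split=> [||c Ac cp].
  + by rewrite /TH31 /= /Npsi pformC pform_J_self.
  + by rewrite /Npsi (pform_J1 (psi1 p)).
  + rewrite (dx_psi Ac cp) (dy_psi Ac cp) /Npsi !(pform_J1 (psi1 p)).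
    by split; [exact: a1X|exact: (conformal_X (Xa1 c p))].
- move=> c p Ac cp; rewrite (dx_psi Ac cp) (dy_psi Ac cp) det4_J psi1 sqrrN expr1n mul1r.
  rewrite (conformal_cross (a1X c p) (Xa1 c p)) pformZl XX mulrN1 opprK.
  exact: (alpha_x_gt0 hS hphi hN hnu ho Ac cp).
Qed.

Lemma psi_gauss : gauss_map_plus A psi Npsi (fun p => (Num.sqrt 2)^-1 *: Omega (X p)).
Proof.
move=> c p e1 e2 Ac cp [u1 uv v1 [a11 [a12 [a21 [a22 [d1 d2 det0]]]]]].
congr (_ *: _).
have a1X : pform (a1 c p) (X p) = 0 := alpha_x_X hN c p.
have Xa1 : cross (X p) (a1 c p) = a2 c p := cross_X_alpha_x hphi hN c p.
rewrite (dx_psi Ac cp) (dy_psi Ac cp) J_comb in d1.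
rewrite (dx_psi Ac cp) (dy_psi Ac cp) J_comb in d2.
rewrite d1 (pform_J1 (psi1 p)) in u1; rewrite d2 (pform_J1 (psi1 p)) in v1.
rewrite d1 d2 (pform_J1 (psi1 p)) in uv; rewrite d1 d2.
rewrite wedge_JJ psi1 (oriented_onb_cross (X_X hphi p) a1X Xa1
  (alpha_x_gt0 hS hphi hN hnu ho Ac cp) u1 uv v1 det0) /Npsi linearN mulmxN.
by rewrite OmegaN wedgeNl scaleN1r opprK addrNK.
Qed.

End Verification.

(** * The Hopf differential and the conformal parameter *)

Section Hopf.
Context {R : realType} {T : topologicalType}.
Notation R2 := (R^o * R^o)%type.
Notation L3R := ('rV[R]_3 * R^o)%type.
Notation crangeR c := [set q : R2 | crange c (q.1 +i* q.2)].
Variables (A : set (chart R T)) (hS : riemann_surface A) (sc : simply_connected R T).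
Variables (phi N : T -> L3R).
Hypothesis hphi : conformal_immersion A (@H2R R) (@gH2R R) phi.
Hypothesis hmin : zero_mean_curvature A (@TH2R R) (@gH2R R) 1 phi.
Hypothesis hN : unit_normal_field A (@TH2R R) (@gH2R R) 1 phi N.
Hypothesis hnu : forall p, gH2R (N p) (@dt R) ^+ 2 < 1.
Hypothesis ho : forall c p, A c -> cdom c p -> orient phi N c p < 0.
Let X := hyp_part phi. Let h := height phi.
Let a1 := alpha_x phi N. Let a2 := alpha_y phi N.

Section Coefficient.
Variable psi : T -> 'rV[R]_4.
Hypothesis psi1 : forall p, pform (psi p) (psi p) = -1.
Hypothesis sol : forall c p, A c -> cdom c p -> is_sol (J_alpha_x phi N) (J_alpha_y phi N) c psi p.
Variables (c : chart R T) (Ac : A c) (p : T) (cp : cdom c p).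
Let hc := rs_chart hS Ac.
Let oU := open_crangeR hc.
Let sX := smooth_X hS hphi Ac.
Let sJ : smooth_on (crangeR c) (loc c (fun s => J (X s))) := smooth_linear (L := J) oU J_continuous sX.
Let spsi := smooth_psi hS hphi hN hnu sol Ac.

Lemma dx_Npsi : dx c (Npsi phi psi) p = psi p *m J (a1 c p) *m J (X p) + psi p *m J (dx c X p).
Proof.
have [_ e] := der_mulmx hc cp (dx_is_derive spsi cp) (dx_is_derive sJ cp).
apply: etrans e _; rewrite (dx_psi sol Ac cp); congr (_ + _ *m _).
exact: (D_J _ sX cp).
Qed.

Lemma dy_Npsi : dy c (Npsi phi psi) p = psi p *m J (a2 c p) *m J (X p) + psi p *m J (dy c X p).
Proof.
have [_ e] := der_mulmx hc cp (dy_is_derive spsi cp) (dy_is_derive sJ cp).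
apply: etrans e _; rewrite (dy_psi sol Ac cp); congr (_ + _ *m _).
exact: (D_J _ sX cp).
Qed.

Lemma hopf_psi : hopf_coef c psi (Npsi phi psi) p =
  (- dx c h p * dy c h p / 4) +i* (- ((dx c h p ^+ 2 - dy c h p ^+ 2) / 2) / 4).
Proof.
have a1X : pform (a1 c p) (X p) = 0 := alpha_x_X hN c p.
have Xa1 : cross (X p) (a1 c p) = a2 c p := cross_X_alpha_x hphi hN c p.
have a2X := conformal_X Xa1.
have [h1 h2] := hopf_alpha hS hphi hN hnu ho Ac cp.
apply: etrans (wirtinger_pform _ _ _ _) _.
rewrite dx_Npsi dy_Npsi (dx_psi sol Ac cp) (dy_psi sol Ac cp).
have [k1 k2] := hopf_J (psi1 p) (dx c X p) (dy c X p) a1X a2X.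
exact: (congr2 (fun x y => (x / 4) +i* (- y / 4)) (etrans k1 h1) (etrans k2 h2)).
Qed.

End Coefficient.

(** The required derivatives are the Cauchy-Riemann equations for a + i h / 2, and they form a
    closed form because h is harmonic. The factor 1/2 matches the second component 2 Im z of the
    modified Gauss map at t = 0. *)
Lemma harmonic_conjugate : T -> exists a : T -> R^o, forall c p, A c -> cdom c p ->
  [/\ differentiable (loc c a) (pt c p), dx c a p = 2^-1 * dy c h p &
      dy c a p = - 2^-1 * dx c h p].
Proof.
move=> p0; have sh c := smooth_h hS hphi (c := c).
apply: (closed_form_primitive hS (u := fun c p => 2^-1 * dy c h p)
  (v := fun c p => - 2^-1 * dx c h p) _ _ _ _ sc p0).
- move=> c Ac; have hc := rs_chart hS Ac; have oU := open_crangeR hc.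
  exact: (smoothM oU (smooth_cst _ (2^-1 : R^o)) (csmooth_dy hc (sh c Ac))).
- move=> c Ac; have hc := rs_chart hS Ac; have oU := open_crangeR hc.
  exact: (smoothM oU (smooth_cst _ (- 2^-1 : R^o)) (csmooth_dx hc (sh c Ac))).
- move=> c p Ac cp; have hc := rs_chart hS Ac.
  have D1 : der c p ((0, 1) : R2) (fun=> 2^-1 : R^o) 0 by exact: is_derive_cst.
  have D2 : der c p ((1, 0) : R2) (fun=> - 2^-1 : R^o) 0 by exact: is_derive_cst.
  have [_ e1] := derM hc cp D1 (dy_is_derive (csmooth_dy hc (sh c Ac)) cp).
  have [_ e2] := derM hc cp D2 (dx_is_derive (csmooth_dx hc (sh c Ac)) cp).
  have f (k x y : R^o) : 0 * x + k * y = k * y by rewrite mul0r add0r.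
  have g (k x y : R^o) : x + y = 0 -> k * y = - k * x.
    by move/eqP; rewrite addrC addr_eq0 => /eqP ->; rewrite mulrN mulNr.
  apply: etrans (etrans e1 (f _ _ _)) _; apply: etrans (esym (etrans e2 (f _ _ _))).
  exact: (g _ _ _ (laplacian_h hS hphi hmin hN ho Ac cp)).
- move=> c1 c2 p r s A1 A2 p1 p2 J12.
  have [_ -> ->] := J12 _ h (csmooth_diff (sh c2 A2) p2).
  by rewrite /GRing.scale /=; split; ring.
Qed.

(** The derivative of z has h_y / 2 and h_x / 2 as real and imaginary parts, so it is nonzero
    because the gradient of h never vanishes. *)
Lemma conformal_parameter_of (a : T -> R^o) :
  (forall c p, A c -> cdom c p -> [/\ differentiable (loc c a) (pt c p),
     dx c a p = 2^-1 * dy c h p & dy c a p = - 2^-1 * dx c h p]) ->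
  let z p := a p +i* (2^-1 * h p) in
  conformal_parameter A z /\
  forall c p, A c -> cdom c p -> dz c z p = (2^-1 * dy c h p) +i* (2^-1 * dx c h p).
Proof.
move=> Ha z.
have H c p : A c -> cdom c p ->
    derivable (z \o cinv c : R[i]^o -> R[i]^o) (cmap c p) 1 /\
    dz c z p = (2^-1 * dy c h p) +i* (2^-1 * dx c h p).
  move=> Ac cp; have hc := rs_chart hS Ac; have [da ax ay] := Ha c p Ac cp.
  have sh := smooth_h hS hphi Ac.
  have sb : smooth_on (crangeR c) (loc c (fun s => 2^-1 * h s : R^o)).
    exact: (smoothM (open_crangeR hc) (smooth_cst _ (2^-1 : R^o)) sh).
  have Dc (v : R2) : der c p v (fun=> 2^-1 : R^o) 0 by exact: is_derive_cst.
  have [_ bx] := derM hc cp (Dc (1, 0)) (dx_is_derive sh cp).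
  have [_ b_y] := derM hc cp (Dc (0, 1)) (dy_is_derive sh cp).
  rewrite mul0r add0r in bx; rewrite mul0r add0r in b_y.
  have cr1 : 'D_((1, 0) : R2) (loc c a) (pt c p) =
      'D_((0, 1) : R2) (loc c (fun s => 2^-1 * h s : R^o)) (pt c p).
    by apply: etrans ax (esym b_y).
  have cr2 : 'D_((0, 1) : R2) (loc c a) (pt c p) =
      - 'D_((1, 0) : R2) (loc c (fun s => 2^-1 * h s : R^o)) (pt c p).
    by apply: etrans ay _; rewrite bx mulNr.
  have [d e] := complex_of_diff da (csmooth_diff sb cp) cr1 cr2.
  rewrite cplx_pt in d e; rewrite bx in e.
  have E : (fun w : R[i]^o => loc c a (uncplx w) +i*
      loc c (fun s => 2^-1 * h s : R^o) (uncplx w)) = z \o cinv c.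
    by apply/funext => -[w1 w2].
  rewrite E in d e; split; first exact: d.
  by apply: etrans e _; rewrite [X in X +i* _]ax.
split=> [c p Ac cp|c p Ac cp]; have [d e] := H c p Ac cp; last exact: e.
split; first exact: d.
apply/eqP => z0; have := grad_h_gt0 hS hphi hN ho Ac cp.
move: (congr1 (@complex.Re R) (etrans (esym e) z0)) (congr1 (@complex.Im R) (etrans (esym e) z0)).
move=> /= /eqP; rewrite mulf_eq0 invr_eq0 pnatr_eq0 /= => /eqP y0.
move=> /eqP; rewrite mulf_eq0 invr_eq0 pnatr_eq0 /= => /eqP x0.
by rewrite [X in X ^+ 2 + _]x0 [X in _ + X ^+ 2]y0 expr0n addr0 ltxx.
Qed.

End Hopf.

(** * The identity as ambient isometry, and the conclusion *)

Lemma smooth_id (R : realType) (V : normedModType R) (U : set V) : smooth_on U (id : V -> V).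
Proof.
case=> [|k]; first by move=> x _; exact: cvg_id.
split=> [x _|v]; first by have : differentiable (id : V -> V) x by []; exact.
rewrite (_ : (fun x => _) = cst v); first exact: Ck_cst.
by apply/funext => x; have [_ ->] := is_derive_id x v.
Qed.

Lemma isometry_H2R_id (R : realType) : isometry_H2R (id : ('rV[R]_3 * R^o)%type -> _).
Proof.
split; first by split=> [x|x y _ _|x Hx]; [|exact|exists x].
exists setT; split; [exact: openT|by []|exact: smooth_id|].
move=> x v w _ _ _.
by have [_ ->] := is_derive_id x v; have [_ ->] := is_derive_id x w.
Qed.

Lemma hopf_square (R : realType) (x y : R) :
  (- x * y / 4) +i* (- ((x ^+ 2 - y ^+ 2) / 2) / 4) =
  'i / 2 * cis 0 * ((2^-1 * y) +i* (2^-1 * x)) ^+ 2.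
Proof.
rewrite /cis cos0 sin0.
have -> : (2^-1 : R[i]) = (2^-1 : R)%:C by rewrite fmorphV /= rmorphMn.
by apply/eqP; rewrite eq_complex /=; apply/andP; split; apply/eqP; field.
Qed.

Theorem theorem2 (R : realType) (Sigma : topologicalType)
    (A : set (chart R Sigma))
    (hSigma : riemann_surface A) (hsc : simply_connected R Sigma)
    (phi N : Sigma -> ('rV[R]_3 * R^o)%type)
    (hphi : conformal_immersion A H2R gH2R phi)
    (hmin : zero_mean_curvature A TH2R gH2R 1 phi)
    (hN : unit_normal_field A TH2R gH2R 1 phi N)
    (hnu : forall p, gH2R (N p) dt ^+ 2 < 1) :
  exists psi : Sigma -> 'rV[R]_4,
    [/\ conformal_immersion A H31 pform psi,
        zero_mean_curvature A TH31 pform (-1) psi &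
        exists (nuhat : Sigma -> ('rV[R]_3 * R^o)%type) (Phi : 'rV[R]_3 * R^o -> 'rV[R]_3 * R^o),
          [/\ modified_gauss_map A psi nuhat, isometry_H2R Phi &
              forall p, phi p = Phi (nuhat p)]].
Proof.
(* The axioms of a Riemann surface admit the empty space, which offers no base point for the
   integration; every pointwise condition is vacuous there. *)
case: (pselect (exists p : Sigma, True)) => [[p0 _]|empty]; last first.
  have F (p : Sigma) : False by apply: empty; exists p.
  exists (fun=> 0); split.
  - by split=> [c Ac|p|c p]; [exact: smooth_cst|case: (F p)|case: (F p)].
  - by move=> c p; case: (F p).
  - exists phi, id; split=> //; last exact: isometry_H2R_id.
    exists (fun=> 0), (fun=> 0), 0, (fun=> 0); split.
    + by split=> [|c p]; [split=> [c Ac|p]; [exact: smooth_cst|case: (F p)]|case: (F p)].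
    + by move=> c p; case: (F p).
    + by split=> c p; case: (F p).
    + by move=> p; case: (F p).
have [N' [{}hN {}hnu ho]] := oriented_normal hSigma hphi hN hnu.
have [psi [psi1 sol]] := maximal_surface_exists hSigma hsc hphi hmin hN hnu ho p0.
have [a Ha] := harmonic_conjugate hSigma hsc hphi hmin hN ho p0.
have [zc zE] := conformal_parameter_of hSigma hphi hN ho Ha.
exists psi; split.
- exact: (psi_immersion hSigma hphi hN hnu ho psi1 sol).
- exact: (psi_maximal hSigma hphi hmin hN hnu ho psi1 sol).
(* The sign of N and the normalization of alpha and z have been arranged so that the modified Gauss
   map is phi itself, with the identity as isometry. *)
exists phi, id; split=> //; last exact: isometry_H2R_id.
exists (Npsi phi psi), (fun p => (Num.sqrt 2)^-1 *: Omega (hyp_part phi p)), 0,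
  (fun p => a p +i* (2^-1 * height phi p)); split.
- exact: (Npsi_normal hSigma hphi hN hnu ho psi1 sol).
- exact: (psi_gauss hSigma hphi hN hnu ho psi1 sol).
- split=> [|c p Ac cp]; first exact: zc.
  apply: etrans (hopf_psi hSigma hphi hN hnu ho psi1 sol Ac cp) _.
  apply: etrans (hopf_square _ _) _; congr (_ * _ ^+ 2); exact: esym (zE c p Ac cp).
move=> p; rewrite mul0r /cis cos0 sin0 /to_H2 coord_plus_Omega.
(* X lies on the upper sheet, so [to_H2] changes no sign. *)
have [_ /(_ p)[_ X2] _] := hphi; rewrite [X in if X then _ else _]X2.
rewrite [LHS](surjective_pairing (phi p)); congr pair.
by rewrite /= mulr0 add0r mulr1 mulrA divff ?mul1r ?pnatr_eq0.
Qed.
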